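(* Let $\Gamma\in C_b^1(\mathbb R)$ be $2\pi$-periodic, $H\in C_b^2(\mathbb R^2)$ be $2\pi$-periodic in each argument, fix $r>M_H$, and let $\{\omega^N\}_{N\ge1}$ be an equal-cell step sequence ($\omega^N\in\mathfrak S_N^\theta$) with $\omega^N\to\omega$ in $X_\theta$ and $\sup_N\|\omega^N\|_{X_\theta}<\infty$. Let $M$ be a common bound, $M\ge\max\{\|\omega\|_{X_\theta},\sup_N\|\omega^N\|_{X_\theta}\}$. After choosing $\varepsilon_{0,r}>0$ uniformly for this frequency bound, the following holds for all $\varepsilon\in(0,\varepsilon_{0,r}]$, with constants $C(r),C_{\mathrm{CF}}(r)$ independent of $\varepsilon$. (i) (Reduce-first route on step fields.) For every $N\in\mathbb N$ and every step field $\theta=\theta^{N,\vartheta}\in\mathfrak S_N^\theta$, the embedded finite-$N$ reduced phase vector field $\mathcal V_\varepsilon^{N,\mathrm{RF}}$ satisfies $$\mathcal V_\varepsilon^{N,\mathrm{RF}}[\theta]=\omega^N+K[\theta]+\varepsilon P[\theta;\omega^N]+\varepsilon T[\theta]+R_\varepsilon^{N,\mathrm{RF}}[\theta],$$ where for $x\in I_i^N$, $R_\varepsilon^{N,\mathrm{RF}}[\theta](x):=\frac1N\sum_{j=1}^Nr_{\varepsilon,ij}^N([\vartheta])\Gamma(\vartheta_j-\vartheta_i)$, and $$\|R_\varepsilon^{N,\mathrm{RF}}[\theta]\|_{X_\theta}\le M_\Gamma C(r)\varepsilon^2$$ with constant independent of $N$ and $\vartheta$. (ii) (Continuum-first route.)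 For any frequency profile $\Omega\in X_\theta$ with $\|\Omega\|_{X_\theta}\le M$, the field $\mathcal V_{\varepsilon,\Omega}^{\mathrm{CF}}[\theta]:=\mathcal F_\Omega(\theta,h_{\varepsilon,\Omega}(\theta))$ satisfies $$\mathcal V_{\varepsilon,\Omega}^{\mathrm{CF}}[\theta]=\Omega+K[\theta]+\varepsilon P[\theta;\Omega]+\varepsilon T[\theta]+R_{\varepsilon,\Omega}^{\mathrm{CF}}[\theta],\qquad\sup_{\theta\in X_\theta}\|R_{\varepsilon,\Omega}^{\mathrm{CF}}[\theta]\|_{X_\theta}\le C_{\mathrm{CF}}(r)\varepsilon^2,$$ where the constant is uniform over all such $\Omega$. (iii) (Compatibility.) For each $N$ and each $\vartheta\in\mathbb R^N$ the two exact vector fields agree on step fields when the continuum-first route uses the same step frequency: $$\mathcal V_{\varepsilon,\omega^N}^{\mathrm{CF}}[\theta^{N,\vartheta}]=\mathcal V_\varepsilon^{N,\mathrm{RF}}[\theta^{N,\vartheta}].$$ Consequently both routes have the common first-order truncation $\mathcal V_\varepsilon^{(1)}[\theta;\Omega]:=\Omega+K[\theta]+\varepsilon P[\theta;\Omega]+\varepsilon T[\theta]$ (with $\Omega=\omega^N$ for the reduce-first route). If the continuum-first vector field is instead evaluated with the limiting frequency $\omega$, then for every $N$ and $\vartheta$, $$\bigl\|\mathcal V_\varepsilon^{N,\mathrm{RF}}[\theta^{N,\vartheta}]-\mathcal V_{\varepsilon,\omega}^{\mathrm{CF}}[\theta^{N,\vartheta}]\bigr\|_{X_\theta}\le(1+2\varepsilon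 M_\Gamma M_{DH})\|\omega^N-\omega\|_{X_\theta}+C(r)\varepsilon^2.$$
   Context: Spaces: $X_\theta=L^\infty([0,1])$, $X_a=L^\infty([0,1]^2)$ (real-valued, essential supremum norms), products with the sum norm. $C_b^k$: $C^k$ functions bounded together with all partial derivatives up to order $k$. Cells $I_1^N=[0,1/N]$, $I_i^N=((i-1)/N,i/N]$ ($2\le i\le N$); $\mathfrak S_N^\theta$ = elements of $X_\theta$ constant on each $I_i^N$. For $\vartheta\in\mathbb R^N$, $\theta^{N,\vartheta}\in\mathfrak S_N^\theta$ equals $\vartheta_i$ on $I_i^N$ and $[\vartheta]\in\mathbb T^N=(\mathbb R/2\pi\mathbb Z)^N$ is its class. $C(r)$ denotes a constant that may be different in different occurrences. For $\Omega\in X_\theta$: $\mathcal F_\Omega(\theta,a)(x)=\Omega(x)+\int_0^1a(x,y)\Gamma(\theta(y)-\theta(x))\,dy$. Critical graph $h_0(\theta)(x,y)=H(\theta(x),\theta(y))$, $(Dh_0(\theta)\varphi)(x,y)=\partial_1H(\theta(x),\theta(y))\varphi(x)+\partial_2H(\theta(x),\theta(y))\varphi(y)$. Operators: $$K[\theta](x)=\int_0^1H(\theta(x),\theta(y))\Gamma(\theta(y)-\theta(x))\,dy,$$ $$P[\theta;\Omega](x)=-\int_0^1\Gamma(\theta(y)-\theta(x))\bigl(\partial_1H(\theta(x),\theta(y))\Omega(x)+\partial_2H(\theta(x),\theta(y))\Omega(y)\bigr)dy,$$ $$T[\theta](x)=-\int_0^1\!\!\int_0^1\Gamma(\theta(y)-\theta(x))\partial_1H(\theta(x),\theta(y))H(\theta(x),\theta(z))\Gamma(\theta(z)-\theta(x))\,dz\,dy$$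 $$\qquad-\int_0^1\!\!\int_0^1\Gamma(\theta(y)-\theta(x))\partial_2H(\theta(x),\theta(y))H(\theta(y),\theta(z))\Gamma(\theta(z)-\theta(y))\,dz\,dy.$$ Constants: $M_H=\|H\|_\infty$, $M_\Gamma=\|\Gamma\|_\infty$, $L_\Gamma=\|\Gamma'\|_\infty$, $M_{DH}=\max_q\|\partial_qH\|_\infty$, $M_{D^2H}=\max_{q,\ell}\|\partial^2_{q\ell}H\|_\infty$; with the frequency bound $M$: $C_2(r)=M+2rM_\Gamma$, $C_1(r)=2M_{DH}C_2(r)$, $C_3(r)=2M_{DH}M_\Gamma+4M_{D^2H}C_2(r)+2M_{DH}(2M_\Gamma M_{DH}+4rL_\Gamma)$, $C_4(r)=M_\Gamma+2M_\Gamma M_{DH}+4rL_\Gamma$. Cut-off: fix an odd $\chi\in C_b^\infty(\mathbb R)$ with $\chi(z)=z$ for $|z|\le1$, $|\chi|\le2$, $|\chi'|\le1$, $\chi$ constant for large $z$ (and for large $-z$); $\sigma_r(z)=r\chi(z/r)$; $B_{r,\Omega}(\xi,\theta)(x)=\Omega(x)+\int_0^1\sigma_r(h_0(\theta)(x,y)+\xi(x,y))\Gamma(\theta(y)-\theta(x))\,dy$. For $\eta<0$ and a Banach space $Y$, $C_\eta(Y)=\{u\in C((-\infty,0];Y):\sup_{t\le0}e^{-\eta t}\|u(t)\|_Y<\infty\}$. Uniform choice of parameters: $\eta_r<0$ and $\varepsilon_{0,r}>0$, depending only on $r$, $M_H$, $M_\Gamma$, $L_\Gamma$, $M_{DH}$,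 $M_{D^2H}$ and $M$, satisfy $C_4(r)/|\eta_r|<1/2$, $C_1(r)\varepsilon_{0,r}<r-M_H$, $1+\varepsilon\eta_r\ge1/2$ for $0<\varepsilon\le\varepsilon_{0,r}$, and $\sup_{0<\varepsilon\le\varepsilon_{0,r}}\bigl(C_3(r)\tfrac{\varepsilon}{1+\varepsilon\eta_r}+\tfrac{C_4(r)}{|\eta_r|}\bigr)<1$ (with $\varepsilon_{0,r}$ sufficiently small). Continuum graph: for $\|\Omega\|_\infty\le M$, $\varepsilon\in(0,\varepsilon_{0,r}]$ and $\theta_0\in X_\theta$, the Lyapunov–Perron operator $(\xi,\theta)\mapsto\bigl(t\mapsto-\int_{-\infty}^te^{-(t-s)/\varepsilon}Dh_0(\theta(s))B_{r,\Omega}(\xi(s),\theta(s))\,ds,\ t\mapsto\theta_0+\int_0^tB_{r,\Omega}(\xi(s),\theta(s))\,ds\bigr)$ has a unique fixed point $(\xi^{\theta_0},\theta^{\theta_0})$ in $C_{\eta_r}(X_a)\times C_{\eta_r}(X_\theta)$; $h_{\varepsilon,\Omega}(\theta_0):=h_0(\theta_0)+\xi^{\theta_0}(0)$. Finite-$N$ graph: let $\omega_i^N$ be the value of $\omega^N$ on $I_i^N$ and $B^N_{r,i}(\xi,\vartheta)=\omega_i^N+\frac1N\sum_j\sigma_r(H(\vartheta_i,\vartheta_j)+\xi_{ij})\Gamma(\vartheta_j-\vartheta_i)$ for $\xi\in\mathbb R^{N\times N}$, $\vartheta\in\mathbb R^N$ ($\ell^\infty$ norms). For anchor $\vartheta^0\in\mathbb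 R^N$, the restricted Lyapunov–Perron problem in $C_{\eta_r}(\mathbb R^{N\times N})\times C_{\eta_r}(\mathbb R^N)$, $\xi_{ij}(t)=-\int_{-\infty}^te^{-(t-s)/\varepsilon}\bigl(\partial_1H(\vartheta_i,\vartheta_j)B^N_{r,i}(\xi,\vartheta)+\partial_2H(\vartheta_i,\vartheta_j)B^N_{r,j}(\xi,\vartheta)\bigr)(s)\,ds$, $\ \vartheta_i(t)=\vartheta_i^0+\int_0^tB^N_{r,i}(\xi(s),\vartheta(s))\,ds$, has a unique solution, and $h^N_{\varepsilon,\omega^N}([\vartheta^0])_{ij}:=H(\vartheta^0_i,\vartheta^0_j)+\xi_{ij}(0)$, which depends only on $[\vartheta^0]$. Reduce-first field: for $x\in I_i^N$, $\mathcal V_\varepsilon^{N,\mathrm{RF}}[\theta^{N,\vartheta}](x)=\omega_i^N+\frac1N\sum_jh^N_{\varepsilon,\omega^N}([\vartheta])_{ij}\Gamma(\vartheta_j-\vartheta_i)$. Graph remainder: $r_\varepsilon^N=h^N_{\varepsilon,\omega^N}-h_0^N-\varepsilon h_1^N$, with $h_{0,ij}^N=H(\vartheta_i,\vartheta_j)$, $h_{1,ij}^N=-\partial_1H(\vartheta_i,\vartheta_j)V_i-\partial_2H(\vartheta_i,\vartheta_j)V_j$, $V_i=\omega_i^N+\frac1N\sum_kH(\vartheta_i,\vartheta_k)\Gamma(\vartheta_k-\vartheta_i)$. *)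

(* Defs.v *)
From HB Require Import structures.
From mathcomp Require Import all_boot all_order all_algebra.
From mathcomp Require Import all_classical all_reals all_analysis.

Set Implicit Arguments.
Unset Strict Implicit.
Unset Printing Implicit Defensive.
Import Order.TTheory GRing.Theory Num.Theory.
Import numFieldNormedType.Exports.
Local Open Scope classical_set_scope.
Local Open Scope ring_scope.

(* An element of an L^oo space is represented by one of its measurable
   functions; equality in L^oo is equality almost everywhere. *)

Section Linfty.
Context d (T : measurableType d) (R : realType).
Variable mu : {measure set T -> \bar R}.

Definition Linfty : set (T -> R) := [set f | f \in Lfun mu +oo%E].

(* Meaningful on Linfty only: [fine] sends +oo to 0. *)
Definition Linfty_norm (f : T -> R) : R := fine ('N[mu]_+oo[EFin \o f])%E.

Definition Linfty_norm_le (f : T -> R) (c : R) : Prop :=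
  Linfty f /\ Linfty_norm f <= c.

(* v is the Bochner integral over D, for Lebesgue measure, of the
   L^oo-valued function f: the simple functions s |-> \sum_i \1_(A k i) s * c k i
   converge to f in L^1(D; L^oo) and their integrals converge to v.  This
   determines v up to equality almost everywhere. *)
Definition is_Bochner_integral (D : set (measurableTypeR R))
    (f : R -> T -> R) (v : T -> R) : Prop :=
  [/\ (forall s, D s -> Linfty (f s)), Linfty v &
    exists (n : nat -> nat) (A : nat -> nat -> set (measurableTypeR R))
           (c : nat -> nat -> T -> R),
      let S k s := \sum_(i < n k) \1_(A k i) s *: c k i in
      let I k := \sum_(i < n k) fine (lebesgue_measure (A k i)) *: c k i in
      [/\ (forall k i, [/\ measurable (A k i), A k i `<=` D,
             (lebesgue_measure (A k i) < +oo)%E & Linfty (c k i)]),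
          (forall k, measurable_fun D (fun s => Linfty_norm (f s - S k s))),
          (fun k => \int[lebesgue_measure]_(s in D)
             (Linfty_norm (f s - S k s))%:E)%E @ \oo --> 0%E &
          (fun k => Linfty_norm (v - I k)) @ \oo --> (0 : R)]].

End Linfty.

Section smoothness.
Variable R : realType.
Implicit Types (f : R -> R) (F : R -> R -> R).

Fixpoint Cb (k : nat) f : Prop :=
  [/\ continuous f, (exists K, forall x, `|f x| <= K) &
    if k is k'.+1 then (forall x, derivable f x 1) /\ Cb k' (derive1 f)
    else True].

Definition d1 F (x y : R) : R := derive1 (F ^~ y) x.
Definition d2 F (x y : R) : R := derive1 (F x) y.

Fixpoint Cb2 (k : nat) F : Prop :=
  [/\ continuous (fun p : R * R => F p.1 p.2),
      (exists K, forall x y, `|F x y| <= K) &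
    if k is k'.+1 then
      [/\ (forall x y, derivable (F ^~ y) x 1),
          (forall x y, derivable (F x) y 1), Cb2 k' (d1 F) & Cb2 k' (d2 F)]
    else True].

Definition sup_norm f : R := sup (range (fun x => `|f x|)).
Definition sup_norm2 F : R := sup (range (fun p : R * R => `|F p.1 p.2|)).

Definition cutoff_profile (chi : R -> R) : Prop :=
  [/\ (forall z, chi (- z) = - chi z), (forall k, Cb k chi),
      (forall z, `|z| <= 1 -> chi z = z),
      (forall z, `|chi z| <= 2) /\ (forall z, `|derive1 chi z| <= 1) &
      exists Z cp cm, forall z, (Z <= z -> chi z = cp) /\
                                (z <= - Z -> chi z = cm)].

End smoothness.

Section constants.
Variable R : realType.
Implicit Types r MH MG LG MDH MD2H M : R.

Definition C2 r MG M := M + 2 * r * MG.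
Definition C1 r MG MDH M := 2 * MDH * C2 r MG M.
Definition C3 r MG LG MDH MD2H M :=
  2 * MDH * MG + 4 * MD2H * C2 r MG M + 2 * MDH * (2 * MG * MDH + 4 * r * LG).
Definition C4 r MG LG MDH := MG + 2 * MG * MDH + 4 * r * LG.

Definition admissible_numbers r MH MG LG MDH MD2H M (eta eps0 : R) : Prop :=
  [/\ eta < 0 /\ 0 < eps0,
      C4 r MG LG MDH / `|eta| < 2^-1,
      C1 r MG MDH M * eps0 < r - MH,
      (forall eps, 0 < eps <= eps0 -> 2^-1 <= 1 + eps * eta) &
      sup [set C3 r MG LG MDH MD2H M * (eps / (1 + eps * eta))
               + C4 r MG LG MDH / `|eta| | eps in `]0, eps0]] < 1].

Definition M_DH (H : R -> R -> R) : R :=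
  Num.max (sup_norm2 (d1 H)) (sup_norm2 (d2 H)).
Definition M_D2H (H : R -> R -> R) : R :=
  Num.max (Num.max (sup_norm2 (d1 (d1 H))) (sup_norm2 (d1 (d2 H))))
          (Num.max (sup_norm2 (d2 (d1 H))) (sup_norm2 (d2 (d2 H)))).

Definition admissible (Gamma : R -> R) (H : R -> R -> R) r M eta eps0 : Prop :=
  admissible_numbers r (sup_norm2 H) (sup_norm Gamma) (sup_norm (derive1 Gamma))
    (M_DH H) (M_D2H H) M eta eps0.

End constants.

Section spaces.
Variable R : realType.

Lemma lebesgue_unit_lty : (lebesgue_measure (`[0%R, 1%R] : set R) < +oo)%E.
Proof. by rewrite lebesgue_measure_itv/= lte_fin ltr01 oppr0 adde0 ltry. Qed.

Lemma measurable_unit : measurable (`[0%R, 1%R] : set (measurableTypeR R)).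
Proof. exact: measurable_itv. Qed.

Definition unit_lebesgue := mfrestr measurable_unit lebesgue_unit_lty.
HB.instance Definition _ := FiniteMeasure.on unit_lebesgue.
Definition unit_lebesgue2 := (unit_lebesgue \x unit_lebesgue)%E.
HB.instance Definition _ := Measure.on unit_lebesgue2.

Definition X_theta : set (R -> R) := Linfty unit_lebesgue.
Definition X_a : set (R * R -> R) := Linfty unit_lebesgue2.
Definition norm_theta (f : R -> R) : R := Linfty_norm unit_lebesgue f.
Definition norm_a (f : R * R -> R) : R := Linfty_norm unit_lebesgue2 f.
Definition norm_theta_le (f : R -> R) (c : R) : Prop :=
  Linfty_norm_le unit_lebesgue f c.

(* C_eta(Y) for the space Y of the elements of the set X, with norm nm; only
   the values of u on (-oo, 0] matter. *)
Definition C_eta (V : zmodType) (X : set V) (nm : V -> R) (eta : R)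
    (u : R -> V) : Prop :=
  [/\ (forall t, t <= 0 -> X (u t)),
      (forall t, t <= 0 ->
         nm (u s - u t) @[s --> within [set s | s <= 0] (nbhs t)] --> (0 : R)) &
      exists K, forall t, t <= 0 -> expR (- eta * t) * nm (u t) <= K].

(* The index i : 'I_N stands for the cell number i + 1. *)
Definition cell (N : nat) (i : 'I_N) : set R :=
  if i == 0%N :> nat then [set` `[0, N%:R^-1]]
  else [set` `]i%:R / N%:R, i.+1%:R / N%:R]].

Definition step_space (N : nat) : set (R -> R) :=
  [set f | X_theta f /\
           forall i : 'I_N, exists c, forall x, cell i x -> f x = c].

(* Each cell contains its right endpoint. *)
Definition cell_values (N : nat) (f : R -> R) : 'rV[R]_N :=
  \row_(i < N) f (i.+1%:R / N%:R).

Definition step (N : nat) (v : 'rV[R]_N) (x : R) : R :=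
  \sum_(i < N) v 0 i * \1_(cell i) x.

End spaces.

Arguments unit_lebesgue : clear implicits.
Arguments unit_lebesgue2 : clear implicits.
Arguments X_theta : clear implicits.
Arguments X_a : clear implicits.
Arguments step_space : clear implicits.

Section model.
Variable R : realType.
Variables (Gamma : R -> R) (H : R -> R -> R).
Implicit Types (theta phi Omega : R -> R) (a xi : R * R -> R).

Local Notation "\int01 ( y ) E" := (\int[lebesgue_measure]_(y in `[0%R, 1%R]) E)
  (at level 36, y name, E at level 36).

Definition F_field Omega theta a (x : R) : R :=
  Omega x + \int01 (y) (a (x, y) * Gamma (theta y - theta x)).

Definition h0 theta (p : R * R) : R := H (theta p.1) (theta p.2).

Definition Dh0 theta phi (p : R * R) : R :=
  d1 H (theta p.1) (theta p.2) * phi p.1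
  + d2 H (theta p.1) (theta p.2) * phi p.2.

Definition K_op theta (x : R) : R :=
  \int01 (y) (H (theta x) (theta y) * Gamma (theta y - theta x)).

Definition P_op theta Omega (x : R) : R :=
  - \int01 (y) (Gamma (theta y - theta x)
      * (d1 H (theta x) (theta y) * Omega x
         + d2 H (theta x) (theta y) * Omega y)).

Definition T_op theta (x : R) : R :=
  (- (\int01 (y) (\int01 (z)
      (Gamma (theta y - theta x) * d1 H (theta x) (theta y)
       * H (theta x) (theta z) * Gamma (theta z - theta x)))))
  - (\int01 (y) (\int01 (z)
      (Gamma (theta y - theta x) * d2 H (theta x) (theta y)
       * H (theta y) (theta z) * Gamma (theta z - theta y)))).

Definition V1_field (eps : R) theta Omega (x : R) : R :=
  Omega x + K_op theta x + eps * P_op theta Omega x + eps * T_op theta x.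

Variables (chi : R -> R) (r eta eps : R).

Definition sigma (z : R) : R := r * chi (z / r).

Section continuum.
Variable Omega : R -> R.

Definition B_field xi theta (x : R) : R :=
  Omega x
  + \int01 (y) (sigma (h0 theta (x, y) + xi (x, y)) * Gamma (theta y - theta x)).

(* p = (xi, theta) is a fixed point; \int_0^t is minus the integral over
   [t, 0] because t <= 0. *)
Definition LP_fixed_point (theta0 : R -> R) :
    set ((R -> R * R -> R) * (R -> R -> R)) :=
  [set p | let xi := p.1 in let theta := p.2 in
    [/\ C_eta (X_a R) (@norm_a R) eta xi,
        C_eta (X_theta R) (@norm_theta R) eta theta &
        forall t, t <= 0 ->
          is_Bochner_integral (unit_lebesgue2 R) `]-oo, t]
            (fun s => expR (- (t - s) / eps) *:
                        Dh0 (theta s) (B_field (xi s) (theta s)))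
            (- xi t) /\
          is_Bochner_integral (unit_lebesgue R) `[t, 0]
            (fun s => B_field (xi s) (theta s)) (theta0 - theta t)]].

Definition continuum_graph (theta0 : R -> R) : R * R -> R :=
  let p := xget (fun=> fun=> 0, fun=> fun=> 0) (LP_fixed_point theta0) in
  h0 theta0 + p.1 0.

Definition V_CF theta : R -> R := F_field Omega theta (continuum_graph theta).

End continuum.

Section finite_N.
Variables (N : nat) (w : 'rV[R]_N).
Implicit Types v : 'rV[R]_N.

Definition BN_field (xi : 'M[R]_N) v (i : 'I_N) : R :=
  w 0 i + N%:R^-1 * \sum_(j < N)
    sigma (H (v 0 i) (v 0 j) + xi i j) * Gamma (v 0 j - v 0 i).

(* The norms of 'rV[R]_N and 'M[R]_N are the maximum norms. *)
Definition LPN_solution (v0 : 'rV[R]_N) :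
    set ((R -> 'M[R]_N) * (R -> 'rV[R]_N)) :=
  [set p | let xi := p.1 in let v := p.2 in
    [/\ C_eta setT (fun A : 'M[R]_N => `|A|) eta xi,
        C_eta setT (fun u : 'rV[R]_N => `|u|) eta v &
        forall t, t <= 0 ->
          (forall i j, xi t i j =
            - \int[lebesgue_measure]_(s in `]-oo, t])
                (expR (- (t - s) / eps) *
                 (d1 H (v s 0 i) (v s 0 j) * BN_field (xi s) (v s) i
                  + d2 H (v s 0 i) (v s 0 j) * BN_field (xi s) (v s) j))) /\
          (forall i, v t 0 i =
            v0 0 i - \int[lebesgue_measure]_(s in `[t, 0])
                       BN_field (xi s) (v s) i)]].

(* A function of the class of v0 in the torus, written on representatives. *)
Definition finite_graph (v0 : 'rV[R]_N) : 'M[R]_N :=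
  let p := xget (fun=> 0, fun=> 0) (LPN_solution v0) in
  \matrix_(i, j) (H (v0 0 i) (v0 0 j) + p.1 0 i j).

Definition h0N v : 'M[R]_N := \matrix_(i, j) H (v 0 i) (v 0 j).

Definition VN v (i : 'I_N) : R :=
  w 0 i + N%:R^-1 * \sum_(k < N) H (v 0 i) (v 0 k) * Gamma (v 0 k - v 0 i).

Definition h1N v : 'M[R]_N :=
  \matrix_(i, j) (- d1 H (v 0 i) (v 0 j) * VN v i
                  - d2 H (v 0 i) (v 0 j) * VN v j).

Definition graph_remainder v : 'M[R]_N :=
  finite_graph v - h0N v - eps *: h1N v.

Definition V_RF v : R -> R :=
  step (\row_(i < N) (w 0 i + N%:R^-1 *
    \sum_(j < N) finite_graph v i j * Gamma (v 0 j - v 0 i))).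

Definition R_RF v : R -> R :=
  step (\row_(i < N) (N%:R^-1 *
    \sum_(j < N) graph_remainder v i j * Gamma (v 0 j - v 0 i))).

End finite_N.

End model.

(* Main.v *)
Require Import Defs.
From mathcomp Require Import all_boot all_order all_algebra.
From mathcomp Require Import all_classical all_reals all_analysis measurable_realfun ess_sup_inf hoelder.
From mathcomp Require Import ring lra.
Set Implicit Arguments.
Unset Strict Implicit.
Unset Printing Implicit Defensive.
Import Order.TTheory GRing.Theory Num.Theory.
Import numFieldNormedType.Exports.
Local Open Scope classical_set_scope.
Local Open Scope ring_scope.

(** Write G(s) for the derivative of the critical graph at theta(s) applied to the
    truncated phase field B(xi(s), theta(s)).  The graph over theta0 is
    h0(theta0) + xi(0), and the first Lyapunov-Perron equation says that xi(0) is
    minus the integral of exp(s / eps) G(s) over s <= 0.  Now G is Lipschitz in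
    (xi, theta) with constant C3, the first equation bounds xi by C1 eps, and the
    second one bounds theta(s) - theta0 by C2 |s|.  Replacing G(s) by its value for
    xi = 0 and theta = theta0 therefore costs C3 (C1 eps + C2 |s|), which the fast
    exponential turns into a term of order eps^2; the new integral is computed
    exactly, because on the critical graph the cut-off is inactive (r exceeds the
    norm of H).  This is [pointwise_graph_expansion].  Multiplied by Gamma and
    integrated over y, the first-order term is P + T by linearity of the integral
    ([V1_fieldE]).

    The expansion uses only that (xi, theta) satisfies the two equations, so what
    remains is to produce such a pair and to identify it with the fixed point from
    which the graph is defined.  Existence is proved for true functions of x and y,
    by Picard iteration in the supremum norms with the weight exp(eta t)
    ([pointwise_solution_exists]).  The iterates are Lipschitz in time uniformly in
    space, hence at each point the time integrals are ordinary Lebesgue integrals,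
    and Riemann sums converging uniformly show that the pointwise integrals are
    Bochner integrals in L^oo ([Lipschitz_Bochner_integral],
    [pointwise_solution_LP]).  Uniqueness is proved for classes of functions: two
    Bochner integrals are compared through their simple approximations
    ([Bochner_integral_norm_le]), and the same contraction estimate, iterated,
    forces the distance of two fixed points to vanish ([LP_fixed_point_unique]).

    The finite system is the continuum system with step data.  A pointwise solution
    takes equal values at points with equal data ([sol_invariant]), so for step data
    its values on the cells solve the finite system; conversely every solution of
    the finite system extends to a pointwise solution ([LPN_embed]).  Uniqueness
    then makes both graphs agree almost everywhere ([V_CF_V_RF]), and the expansion
    of one route is the expansion of the other.  The estimate with the limiting
    frequency follows by the triangle inequality, since the first-order field is
    Lipschitz in the frequency with constant 1 + 2 eps M_Gamma M_DH
    ([V1_fieldB_le]). *)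

(** * Essential supremum norms *)

Section almost_everywhere_rules.
Context d (T : measurableType d) (R : realType).
Variable mu : {measure set T -> \bar R}.
Implicit Types P Q S : T -> Prop.

Lemma aeS P Q : (forall x, P x -> Q x) ->
  {ae mu, forall x, P x} -> {ae mu, forall x, Q x}.
Proof. by move=> PQ; apply: filterS. Qed.

Lemma aeS2 P Q S : (forall x, P x -> Q x -> S x) ->
  {ae mu, forall x, P x} -> {ae mu, forall x, Q x} -> {ae mu, forall x, S x}.
Proof. by move=> PQS; apply: filterS2. Qed.

Lemma aeS3 P P' Q S : (forall x, P x -> P' x -> Q x -> S x) ->
  {ae mu, forall x, P x} -> {ae mu, forall x, P' x} -> {ae mu, forall x, Q x} ->
  {ae mu, forall x, S x}.
Proof. by move=> PQS; apply: filterS3. Qed.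

Lemma ae_ex P : (0 < mu setT)%E -> {ae mu, forall x, P x} -> exists x, P x.
Proof.
move=> mu0 aeP; exact: (@filter_ex _ _ (ae_properfilter_algebraOfSetsType mu0) _ aeP).
Qed.

End almost_everywhere_rules.

Section Linfty_theory.
Context d (T : measurableType d) (R : realType).
Variable mu : {measure set T -> \bar R}.
Hypothesis mu_gt0 : (0 < mu setT)%E.
Implicit Types (f g : T -> R) (c : R).

Lemma Linfty_normE f : Linfty_norm mu f = fine (ess_sup mu (abse \o EFin \o f)).
Proof. by rewrite /Linfty_norm unlock mu_gt0. Qed.

Lemma ess_sup_abs_ge0 f : (0 <= ess_sup mu (abse \o EFin \o f))%E.
Proof. by apply: ess_sup_gee => //; apply: nearW => x /=. Qed.

Lemma Linfty_measurable f : Linfty mu f -> measurable_fun setT f.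
Proof. by rewrite /Linfty /= => /sub_Lfun_mfun; rewrite inE. Qed.

Lemma Linfty_fin_num f : Linfty mu f ->
  ess_sup mu (abse \o EFin \o f) \is a fin_num.
Proof.
rewrite /Linfty /= => /sub_Lfun_finLfun; rewrite inE /= /finite_norm unlock mu_gt0.
by move=> h; rewrite ge0_fin_numE// ess_sup_abs_ge0.
Qed.

Lemma Linfty_norm_ge0 f : 0 <= Linfty_norm mu f.
Proof. by rewrite Linfty_normE fine_ge0// ess_sup_abs_ge0. Qed.

Lemma Linfty_norm_ae f : Linfty mu f ->
  {ae mu, forall x, `|f x| <= Linfty_norm mu f}.
Proof.
move=> Lf; have := ess_sup_ge mu (abse \o EFin \o f).
apply: filterS => x /=; rewrite Linfty_normE -lee_fin fineK//.
exact: Linfty_fin_num.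
Qed.

Lemma Linfty_norm_leI f c : measurable_fun setT f ->
  {ae mu, forall x, `|f x| <= c} -> Linfty_norm_le mu f c.
Proof.
move=> mf fc.
have h : (ess_sup mu (abse \o EFin \o f) <= c%:E)%E.
  by apply/ess_supP; apply: filterS fc => x /=; rewrite lee_fin.
have fin : ess_sup mu (abse \o EFin \o f) \is a fin_num.
  by rewrite ge0_fin_numE ?ess_sup_abs_ge0// (le_lt_trans h)// ltry.
split; last by rewrite Linfty_normE -lee_fin fineK.
rewrite /Linfty /=; apply/andP; split; rewrite inE//=.
by rewrite /finite_norm unlock mu_gt0 (le_lt_trans h)// ltry.
Qed.

Lemma Linfty_norm_leE f c : Linfty_norm_le mu f c ->
  measurable_fun setT f /\ {ae mu, forall x, `|f x| <= c}.
Proof.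
case=> Lf fc; split; first exact: Linfty_measurable.
by apply: filterS (Linfty_norm_ae Lf) => x /le_trans; apply.
Qed.

Lemma Linfty_norm_leD f g a b : Linfty_norm_le mu f a -> Linfty_norm_le mu g b ->
  Linfty_norm_le mu (f + g) (a + b).
Proof.
move=> /Linfty_norm_leE[mf fa] /Linfty_norm_leE[mg gb].
apply: Linfty_norm_leI; first exact: measurable_funD.
by apply: filterS2 fa gb => x fa gb; rewrite (le_trans (ler_normD _ _))// lerD.
Qed.

Lemma Linfty_norm_leN f a : Linfty_norm_le mu f a -> Linfty_norm_le mu (- f) a.
Proof.
move=> /Linfty_norm_leE[mf fa]; apply: Linfty_norm_leI.
  exact: measurable_funN.
by apply: filterS fa => x; rewrite normrN.
Qed.

Lemma Linfty_norm_leB f g a b : Linfty_norm_le mu f a -> Linfty_norm_le mu g b ->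
  Linfty_norm_le mu (f - g) (a + b).
Proof. by move=> fa gb; apply/Linfty_norm_leD/Linfty_norm_leN. Qed.

Lemma Linfty_norm_leZ k f a : Linfty_norm_le mu f a ->
  Linfty_norm_le mu (k *: f) (`|k| * a).
Proof.
move=> /Linfty_norm_leE[mf fa]; apply: Linfty_norm_leI.
  exact: measurable_funM.
by apply: filterS fa => x fa /=; rewrite normrM ler_wpM2l.
Qed.

Lemma Linfty_norm_le_trans f a b : a <= b -> Linfty_norm_le mu f a ->
  Linfty_norm_le mu f b.
Proof. by move=> ab [Lf fa]; split => //; exact: le_trans ab. Qed.

Lemma Linfty_norm_le_ae f g a : measurable_fun setT g ->
  {ae mu, forall x, f x = g x} ->
  Linfty_norm_le mu f a -> Linfty_norm_le mu g a.
Proof.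
move=> mg fg /Linfty_norm_leE[mf fa]; apply: Linfty_norm_leI => //.
by apply: filterS2 fg fa => x ->.
Qed.

Lemma LinftyB f g : Linfty mu f -> Linfty mu g -> Linfty mu (f - g).
Proof. by move=> Lf Lg; case: (Linfty_norm_leB (conj Lf (lexx _)) (conj Lg (lexx _))). Qed.

Lemma Linfty_cst0 : Linfty_norm_le mu (fun=> 0) 0.
Proof. by apply: Linfty_norm_leI => //; apply: nearW => x; rewrite normr0. Qed.

Lemma eq_Linfty_norm f g : {ae mu, forall x, f x = g x} ->
  Linfty_norm mu f = Linfty_norm mu g.
Proof.
move=> fg; rewrite !Linfty_normE (@eq_ess_sup _ _ _ _ _ (abse \o EFin \o g))//.
by apply: filterS fg => x /= ->.
Qed.

Lemma Linfty_normN f : Linfty_norm mu (- f) = Linfty_norm mu f.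
Proof.
rewrite !Linfty_normE; congr (fine (ess_sup mu _)).
by apply/funext => x /=; rewrite normrN.
Qed.

Lemma LinftyD f g : Linfty mu f -> Linfty mu g -> Linfty mu (f + g).
Proof. by move=> Lf Lg; case: (Linfty_norm_leD (conj Lf (lexx _)) (conj Lg (lexx _))). Qed.

Lemma LinftyZ k f : Linfty mu f -> Linfty mu (k *: f).
Proof. by move=> Lf; case: (Linfty_norm_leZ k (conj Lf (lexx _))). Qed.

Lemma Linfty_sum (I : Type) (s : seq I) (P : pred I) (F : I -> T -> R) :
  (forall i, Linfty mu (F i)) -> Linfty mu (\sum_(i <- s | P i) F i).
Proof.
move=> LF; elim/big_ind : _ => //; first by case: Linfty_cst0.
by move=> f g; exact: LinftyD.
Qed.

End Linfty_theory.

(** * Comparison of Bochner integrals *)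

Section integral_bounds.
Context d (T : measurableType d) (R : realType).
Variable mu : {measure set T -> \bar R}.
Variables (D : set T) (mD : measurable D).
Implicit Types (f g : T -> R) (B : R).

Lemma integral_normr_le f g B : measurable_fun D f -> measurable_fun D g ->
  {ae mu, forall x, D x -> `|f x| <= g x} ->
  (forall x, D x -> 0 <= g x) ->
  (\int[mu]_(x in D) (g x)%:E <= B%:E)%E ->
  (\int[mu]_(x in D) `|f x|%:E <= B%:E)%E.
Proof.
move=> mf mg fg g0 gB; apply: le_trans gB; apply: ae_ge0_le_integral => //.
- by apply/measurable_EFinP; exact: measurableT_comp.
- exact/measurable_EFinP.
Qed.

Lemma Rintegral_normr_le f g B : measurable_fun D f -> measurable_fun D g ->
  {ae mu, forall x, D x -> `|f x| <= g x} ->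
  (forall x, D x -> 0 <= g x) ->
  (\int[mu]_(x in D) (g x)%:E <= B%:E)%E ->
  mu.-integrable D (EFin \o f) /\ `|\int[mu]_(x in D) f x| <= B.
Proof.
move=> mf mg fg g0 gB; have h := integral_normr_le mf mg fg g0 gB.
have intf : mu.-integrable D (EFin \o f).
  apply/integrableP; split; first exact/measurable_EFinP.
  by rewrite (le_lt_trans h)// ltry.
split => //; rewrite -lee_fin EFin_normr_Rintegral//.
by apply: le_trans h; apply: le_abse_integral => //; exact/measurable_EFinP.
Qed.

End integral_bounds.

Section Bochner_comparison.
Context d (T : measurableType d) (R : realType).
Variable mu : {measure set T -> \bar R}.
Hypothesis mu_gt0 : (0 < mu setT)%E.
Local Notation leb := (@lebesgue_measure R).

Lemma indic_sum n (A : 'I_n -> set R) (c : 'I_n -> T -> R) s :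
  \sum_(i < n) \1_(A i) s *: c i = \sum_(i in [set i | s \in A i]%SET) c i.
Proof.
rewrite [RHS]big_mkcond/=; apply: eq_bigr => i _.
rewrite inE indicE; case: (s \in A i); first by rewrite scale1r.
by rewrite scale0r.
Qed.

Lemma Rintegral_simple (D : set (measurableTypeR R)) n (A : 'I_n -> set R)
    (c : 'I_n -> R) : measurable D ->
  (forall i, [/\ measurable (A i : set (measurableTypeR R)), A i `<=` D &
                 (leb (A i) < +oo)%E]) ->
  leb.-integrable D (EFin \o (fun s => \sum_(i < n) \1_(A i) s * c i)) /\
  \int[leb]_(s in D) (\sum_(i < n) \1_(A i) s * c i)
    = \sum_(i < n) fine (leb (A i)) * c i.
Proof.
move=> mD AP.
have i1 i : leb.-integrable D (EFin \o (\1_(A i) : R -> R)).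
  have [mA AD Afin] := AP i; apply/integrableP; split.
    by apply/measurable_EFinP; exact: measurable_indic.
  under eq_integral do rewrite /= ger0_norm//.
  by rewrite integral_indic// setIidl.
have i2 i : leb.-integrable D (EFin \o (fun s => \1_(A i) s * c i)).
  have := integrableZr mD (c i) (i1 i).
  by apply: eq_integrable => // x _; rewrite /= EFinM.
have i3 : leb.-integrable D (fun s => \sum_(i < n) (\1_(A i) s * c i)%:E)%E.
  by apply: integrable_sum => // i _; exact: i2.
split.
  by apply: eq_integrable i3 => // x _; rewrite /= sumEFin.
rewrite /Rintegral; under eq_integral do rewrite -sumEFin.
rewrite integral_sum// -sum_fine; last first.
  by move=> i _; exact: integrable_fin_num (i2 i).
apply: eq_bigr => i _; have [mA AD Afin] := AP i.
rewrite -[LHS]/(\int[leb]_(s in D) (\1_(A i) s * c i)) RintegralZr//.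
by congr (_ * _); rewrite /Rintegral integral_indic// setIidl.
Qed.

(** Two Bochner integrals are compared through their simple approximations,
    and those pointwise in T: off one null set, every value taken by the
    difference of two simple functions, one for each pair of sets of active
    cells, is bounded by its essential supremum, so that the scalar triangle
    inequality for integrals applies at the point. *)
Lemma Bochner_integral_norm_le (D : set (measurableTypeR R))
    (f g : R -> T -> R) (v w : T -> R) (b : R -> R) (B : R) :
  measurable D ->
  is_Bochner_integral mu D f v -> is_Bochner_integral mu D g w ->
  measurable_fun D b -> (forall s, D s -> Linfty_norm mu (f s - g s) <= b s) ->
  (\int[leb]_(s in D) (b s)%:E <= B%:E)%E ->
  Linfty_norm mu (v - w) <= B.
Proof.
move=> mD [Lf Lv [n [A [c [Ac mfS fS vI]]]]] [Lg Lw [m [A' [c' [Ac' mgS gS wI]]]]].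
move=> mb fgb bB.
pose S k (s : R) : T -> R := \sum_(i < n k) \1_(A k i) s *: c k i.
pose S' k (s : R) : T -> R := \sum_(i < m k) \1_(A' k i) s *: c' k i.
pose I k : T -> R := \sum_(i < n k) fine (leb (A k i)) *: c k i.
pose I' k : T -> R := \sum_(i < m k) fine (leb (A' k i)) *: c' k i.
pose nf k s := Linfty_norm mu (f s - S k s).
pose ng k s := Linfty_norm mu (g s - S' k s).
have LS k s : Linfty mu (S k s).
  by apply: Linfty_sum => // i; apply: LinftyZ => //; case: (Ac k i).
have LS' k s : Linfty mu (S' k s).
  by apply: Linfty_sum => // i; apply: LinftyZ => //; case: (Ac' k i).
have LI k : Linfty mu (I k).
  by apply: Linfty_sum => // i; apply: LinftyZ => //; case: (Ac k i).
have LI' k : Linfty mu (I' k).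
  by apply: Linfty_sum => // i; apply: LinftyZ => //; case: (Ac' k i).
have b0 s : D s -> 0 <= b s.
  by move=> /fgb; apply: le_trans; exact: Linfty_norm_ge0.
have SS' k s : D s -> Linfty_norm mu (S k s - S' k s) <= nf k s + ng k s + b s.
  move=> Ds.
  have -> : S k s - S' k s = (f s - g s) - (f s - S k s) + (g s - S' k s).
    by rewrite opprB addrA -[LHS](subrK (f s)); apply/funext => x;
       rewrite /GRing.add /GRing.opp /=; ring.
  have := Linfty_norm_leD mu_gt0 (Linfty_norm_leB mu_gt0
    (conj (LinftyB mu_gt0 (Lf _ Ds) (Lg _ Ds)) (fgb _ Ds))
    (conj (LinftyB mu_gt0 (Lf _ Ds) (LS k s)) (lexx _)))
    (conj (LinftyB mu_gt0 (Lg _ Ds) (LS' k s)) (lexx _)).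
  by case=> _; rewrite -/(nf k s) -/(ng k s); lra.
(* There are finitely many pairs J of sets of active cells, so the exceptional
   null set does not depend on the time s. *)
have aeSS' k : {ae mu, forall p, forall s, D s ->
    `|S k s p - S' k s p| <= nf k s + ng k s + b s}.
  pose F (J : {set 'I_(n k)} * {set 'I_(m k)}) : T -> R :=
    \sum_(i in J.1) c k i - \sum_(i in J.2) c' k i.
  have LF J : Linfty mu (F J).
    apply: LinftyB => //; apply: Linfty_sum => // i.
    - by case: (Ac k i).
    - by case: (Ac' k i).
  have : {ae mu, forall p, forall J, `|F J p| <= Linfty_norm mu (F J)}.
    apply: (@filter_forall _ _ (fun J p => `|F J p| <= Linfty_norm mu (F J))) => J.
    exact: Linfty_norm_ae.
  apply: filterS => p /= Fp s Ds; apply: le_trans (SS' k s Ds).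
  have := Fp ([set i : 'I_(n k) | s \in A k i]%SET, [set i : 'I_(m k) | s \in A' k i]%SET).
  by rewrite /F/= -!indic_sum.
pose e k := (\int[leb]_(s in D) (nf k s)%:E)%E.
pose e' k := (\int[leb]_(s in D) (ng k s)%:E)%E.
have e_ge0 k : (0 <= e k)%E by apply: integral_ge0 => s _; rewrite lee_fin Linfty_norm_ge0.
have e'_ge0 k : (0 <= e' k)%E by apply: integral_ge0 => s _; rewrite lee_fin Linfty_norm_ge0.
have II' k : e k \is a fin_num -> e' k \is a fin_num ->
    Linfty_norm mu (I k - I' k) <= fine (e k) + fine (e' k) + B.
  move=> ek e'k; apply: (Linfty_norm_leI mu_gt0 _ _).2.
    by apply: (@Linfty_measurable _ _ _ mu); exact: (LinftyB mu_gt0 (LI k) (LI' k)).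
  apply: filterS (aeSS' k) => p SSp.
  have [|intS IS] := @Rintegral_simple D (n k) (A k) (c k ^~ p) mD.
    by move=> i; case: (Ac k i).
  have [|intS' IS'] := @Rintegral_simple D (m k) (A' k) (c' k ^~ p) mD.
    by move=> i; case: (Ac' k i).
  have -> : (I k - I' k) p = \int[leb]_(s in D) (S k s p - S' k s p).
    rewrite (_ : (I k - I' k) p = I k p - I' k p)// /I /I' !fct_sumE.
    under eq_bigr do rewrite /GRing.scale/=.
    under [X in _ - X]eq_bigr do rewrite /GRing.scale/=.
    rewrite -IS -IS' -RintegralB//; apply: eq_Rintegral => s _.
    by rewrite /S /S' !fct_sumE.
  have [] // := @Rintegral_normr_le _ _ _ leb D mD (fun s => S k s p - S' k s p)
    (fun s => nf k s + ng k s + b s) (fine (e k) + fine (e' k) + B).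
  - have := integrableB mD intS intS' => /(@measurable_int _ _ _ _ _ _) h.
    apply/measurable_EFinP; move: h; apply: eq_measurable_fun => s _.
    by rewrite /= /S /S' !fct_sumE EFinB.
  - apply: measurable_funD => //.
    by apply: measurable_funD; [exact: mfS|exact: mgS].
  - by apply: nearW => s; exact: SSp.
  - by move=> s Ds; rewrite !addr_ge0 ?b0// Linfty_norm_ge0.
  - under eq_integral do rewrite !EFinD.
    rewrite ge0_integralD//; [|by move=> s Ds; rewrite -EFinD lee_fin addr_ge0// Linfty_norm_ge0
      |by apply: emeasurable_funD; apply/measurable_EFinP; [exact: mfS|exact: mgS]|exact/measurable_EFinP].
    rewrite ge0_integralD//; [|by move=> s Ds; rewrite lee_fin Linfty_norm_ge0
       |apply/measurable_EFinP; exact: mfS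
       |by move=> s Ds; rewrite lee_fin Linfty_norm_ge0
       |apply/measurable_EFinP; exact: mgS].
    by rewrite !EFinD !fineK// leeD2l.
have vw k : e k \is a fin_num -> e' k \is a fin_num ->
   Linfty_norm mu (v - w) <= Linfty_norm mu (v - I k) + Linfty_norm mu (w - I' k)
      + (fine (e k) + fine (e' k) + B).
  move=> ek e'k.
  have -> : v - w = (v - I k) - (w - I' k) + (I k - I' k).
    by apply/funext => x; rewrite /GRing.add /GRing.opp /=; ring.
  have [_] := Linfty_norm_leD mu_gt0 (Linfty_norm_leB mu_gt0
     (conj (LinftyB mu_gt0 Lv (LI k)) (lexx _)) (conj (LinftyB mu_gt0 Lw (LI' k)) (lexx _)))
     (conj (LinftyB mu_gt0 (LI k) (LI' k)) (II' k ek e'k)).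
  by [].
have fe : \forall k \near \oo, e k \is a fin_num.
  by have /fine_cvgP[] := fS.
have fe' : \forall k \near \oo, e' k \is a fin_num.
  by have /fine_cvgP[] := gS.
have lim : (fun k => Linfty_norm mu (v - I k) + Linfty_norm mu (w - I' k)
      + (fine (e k) + fine (e' k) + B)) @ \oo --> (0 + 0 + (0 + 0 + B) : R).
  apply: cvgD; first exact: cvgD vI wI.
  apply: cvgD; last exact: cvg_cst.
  apply: cvgD.
  - by have /fine_cvgP[] := fS.
  - by have /fine_cvgP[] := gS.
rewrite !add0r in lim.
rewrite -(cvg_lim _ lim)//; apply: limr_ge; first by apply/cvg_ex; exists B.
by apply: filterS2 fe fe' => k; exact: vw.
Qed.

End Bochner_comparison.

(** * Bochner integrals of Lipschitz curves *)

Section exponential_integrals.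
Context (R : realType).
Local Notation leb := (@lebesgue_measure R).
Implicit Types (a c t : R).

Lemma continuous_expRM c : continuous (fun x : R => expR (c * x)).
Proof.
by move=> x; apply: continuous_comp; [exact: mulrl_continuous|exact: continuous_expR].
Qed.

Lemma measurable_expRM c (D : set (measurableTypeR R)) :
  measurable_fun D (fun x : R => expR (c * x)).
Proof. by apply: measurable_funTS; exact: (continuous_measurable_fun (@continuous_expRM c)). Qed.

Lemma integral_expR_itvy c a : 0 < c ->
  (\int[leb]_(x in `[a, +oo[) (expR (- c * x))%:E = (expR (- c * a) / c)%:E)%E.
Proof.
move=> c0.
have d (x : R) : is_derive x 1 (fun x : R => - c^-1 * expR (- c * x)) (expR (- c * x)).
  apply: is_derive_eq; rewrite /GRing.scale/=; field; exact: lt0r_neq0.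
rewrite (@ge0_continuous_FTC2y _ _ (fun x => - c^-1 * expR (- c * x)) _ 0).
- by rewrite -EFinB; congr EFin; rewrite sub0r mulNr opprK mulrC.
- by move=> x _; exact: expR_ge0.
- by apply: continuous_subspaceT; exact: continuous_expRM.
- rewrite -[X in _ --> X](mulr0 (- c^-1)); apply: cvgM; first exact: cvg_cst.
  rewrite (_ : (fun x => expR (- c * x)) =
               (fun z => expR (- z)) \o (fun z => c * z)); last first.
    by apply: eq_fun => x; rewrite mulNr.
  apply: (@cvg_comp _ _ _ _ _ _ (pinfty_nbhs R)); last exact: cvgr_expR.
  exact: gt0_cvgMry.
- by move=> x _.
- apply: cvg_at_right_filter; apply: cvgM; [exact: cvg_cst|exact: continuous_expRM].
- by move=> x _; rewrite derive1E; exact: derive_val.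
Qed.

Lemma integral_expR_Nyitv c t : 0 < c ->
  (\int[leb]_(s in `]-oo, t]) (expR (c * s))%:E = (expR (c * t) / c)%:E)%E.
Proof.
move=> c0; rewrite -{1}[t]opprK ge0_integration_by_substitutionNy.
- under eq_integral do rewrite /= mulrN -mulNr.
  by rewrite integral_expR_itvy// mulrN mulNr opprK.
- by apply: continuous_subspaceT; exact: continuous_expRM.
- by move=> x _; exact: expR_ge0.
Qed.

Lemma integral_expR_itv_le c t : 0 < c ->
  (\int[leb]_(s in `[t, 0%R]) (expR (- c * s))%:E <= (expR (- c * t) / c)%:E)%E.
Proof.
move=> c0; rewrite -integral_expR_itvy//; apply: ge0_subset_integral => //.
- by apply/measurable_EFinP; exact: measurable_expRM.
- by apply: subset_itv => //; rewrite bnd_simp.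
Qed.

End exponential_integrals.

Section Lipschitz_Bochner.
Context d (T : measurableType d) (R : realType).
Variable mu : {measure set T -> \bar R}.
Hypothesis mu_gt0 : (0 < mu setT)%E.
Local Notation leb := (@lebesgue_measure R).

Lemma Lipschitz_measurable (D : set (measurableTypeR R)) (f : R -> R) (L : R) :
  measurable D ->
  (forall s s', D s -> D s' -> `|f s - f s'| <= L * `|s - s'|) ->
  measurable_fun D f.
Proof.
move=> mD fL; apply: subspace_continuous_measurable_fun => //.
apply/subspace_continuousP => x Dx; apply/cvgrPdist_le => e e0.
have L1 : 0 < `|L| + 1 by rewrite ltr_wpDl.
rewrite near_withinE; near=> s => Ds.
rewrite (le_trans (fL _ _ Dx Ds))// (@le_trans _ _ ((`|L| + 1) * `|x - s|))//.
  by rewrite ler_wpM2r// (le_trans (ler_norm _))// lerDl.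
rewrite -ler_pdivlMl// mulrC; near: s.
by apply: cvgr_dist_le => //; rewrite divr_gt0.
Unshelve. all: by end_near. Qed.

(** A curve in L^oo that is Lipschitz in time and exponentially small at -oo is
    Bochner integrable, and its integral is computed point by point.  The Riemann
    sums use cells of length 1/m with m >= K exp(c K) on ]-K, 0]: the error of the
    approximation is then at most const/K times exp(c s / 2) at every time s,
    which serves both for the cells and for the discarded tail. *)
Lemma Lipschitz_Bochner_integral (D : set (measurableTypeR R)) (f : R -> T -> R)
    (L C c : R) (s0 : R) :
  measurable D -> D s0 -> D `<=` `]-oo, 0] -> 0 <= L -> 0 <= C -> 0 < c ->
  (forall s, D s -> measurable_fun setT (f s)) ->
  (forall s s' p, D s -> D s' -> `|f s p - f s' p| <= L * `|s - s'|) ->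
  (forall s p, D s -> `|f s p| <= C * expR (c * s)) ->
  is_Bochner_integral mu D f (fun p => \int[leb]_(s in D) f s p).
Proof.
move=> mD Ds0 D0 L0 C0 c0 mf fL fC.
set v := fun p => _.
pose K k : R := k.+1%:R.
have K0 k : 0 < K k by [].
pose m k := (Num.truncn (K k * expR (c * K k))).+1.
have m0 k : 0 < (m k)%:R :> R by [].
have mK k : K k * expR (c * K k) <= (m k)%:R.
  by rewrite ltW// /m truncnS_gt.
pose n k := (k.+1 * m k)%N.
pose A k i : set (measurableTypeR R) :=
  D `&` `](- (i.+1%:R / (m k)%:R)), (- (i%:R / (m k)%:R))].
have AE k i s : A k i s <-> D s /\ (i%:R <= - s * (m k)%:R < i.+1%:R).
  rewrite /A /= in_itv/=; split=> [[Ds]|[Ds]].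
    move=> /andP[h1 h2]; split => //.
    by rewrite -ler_pdivrMr// -ltr_pdivlMr// lerNr h2 ltrNl h1.
  rewrite -ler_pdivrMr// -ltr_pdivlMr// lerNr ltrNl => /andP[-> ->].
  by [].
have Asame k i s s' : A k i s -> A k i s' -> `|s - s'| <= (m k)%:R^-1.
  move=> /AE[_ /andP[h1 h2]] /AE[_ /andP[h3 h4]].
  have : `|s - s'| * (m k)%:R <= 1.
    rewrite -{1}(@ger0_norm _ (m k)%:R)// -normrM mulrBl ler_norml.
    by move: h1 h2 h3 h4; rewrite -!natr1; lra.
  by rewrite -ler_pdivlMr// div1r.
pose sp k i := xget s0 (A k i).
have Dsp k i : D (sp k i) by rewrite /sp; case: xgetP => // y _ [].
have Asp k i s : A k i s -> A k i (sp k i) by move=> As; exact: (xgetI _ As).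
have mA k i : measurable (A k i).
  by apply: measurableI => //; exact: measurable_itv.
have D_cup k : D = \bigcup_i A k i.
  apply/seteqP; split => [s Ds|s [i _ []]//].
  have s_le0 : s <= 0 by have := D0 _ Ds; rewrite /= in_itv.
  exists (Num.truncn (- s * (m k)%:R)) => //; apply/AE; split => //.
  by apply: truncn_itv; rewrite mulr_ge0// oppr_ge0.
have A_uniq k i j s : A k i s -> A k j s -> i = j.
  move=> /AE[_ /andP[h1 h2]] /AE[_ /andP[h3 h4]].
  have := le_lt_trans h1 h4; have := le_lt_trans h3 h2.
  by rewrite !ltr_nat !ltnS => ? ?; apply/eqP; rewrite eqn_leq; apply/andP.
have Lf s : D s -> Linfty mu (f s).
  move=> Ds; case: (@Linfty_norm_leI _ _ _ _ mu_gt0 (f s) (C * expR (c * s)) (mf _ Ds)) => //.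
  by apply: nearW => p; exact: fC.
have Lfe s s' : D s -> D s' -> Linfty_norm mu (f s - f s') <= L * `|s - s'|.
  move=> Ds Ds'; case: (@Linfty_norm_leI _ _ _ _ mu_gt0 (f s - f s') (L * `|s - s'|)) => //.
    by apply: measurable_funB; exact: mf.
  by apply: nearW => p; exact: fL.
pose S k (s : R) : T -> R := \sum_(i < n k) \1_(A k i) s *: f (sp k i).
pose I k : T -> R := \sum_(i < n k) fine (leb (A k i)) *: f (sp k i).
have SE k i s : A k i s -> S k s = if (i < n k)%N then f (sp k i) else (fun=> 0).
  move=> As; case: ifPn => [ilt|]; last first.
    rewrite -leqNgt => nlei; rewrite /S big1// => j _.
    rewrite indicE (_ : (s \in _) = false) ?scale0r//.
    apply/negP; rewrite inE => Aj; have := ltn_ord j.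
    by rewrite (A_uniq _ _ _ _ Aj As) ltnNge nlei.
  rewrite /S (bigD1 (Ordinal ilt))//= big1 ?addr0.
    by rewrite indicE mem_set// scale1r.
  move=> j /eqP ji; rewrite indicE (_ : (s \in _) = false) ?scale0r//.
  apply/negP; rewrite inE => Aj; apply: ji; apply/val_inj => /=.
  exact: A_uniq Aj As.
have LS k s : Linfty mu (S k s).
  by apply: Linfty_sum => // i; apply: LinftyZ => //; exact: Lf.
have LI k : Linfty mu (I k).
  by apply: Linfty_sum => // i; apply: LinftyZ => //; exact: Lf.
pose Q : R := L + C * (2 / c).
have Q0 : 0 <= Q by rewrite addr_ge0// mulr_ge0// divr_ge0// ltW.
pose h k s : R := Q / K k * expR (c / 2 * s).
have fSh k s p : D s -> `|f s p - S k s p| <= h k s.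
  move=> Ds; have := Ds; rewrite {1}(D_cup k) => -[i _ As]; rewrite (SE k i)//.
  have e0 := expR_gt0 (c / 2 * s).
  have s_le0 : s <= 0 by have := D0 _ Ds; rewrite /= in_itv.
  have cs : c * s <= c / 2 * s.
    have cE : c * s = c / 2 * s + c / 2 * s by field.
    by rewrite cE gerDl mulr_ge0_le0// divr_ge0// ltW.
  have [AEs /andP[h1 h2]] := (AE k i s).1 As.
  case: ifPn => [ilt|].
    have sK : - K k <= s.
      have : - s * (m k)%:R <= K k * (m k)%:R.
        rewrite (le_trans (ltW h2))// /K -natrM ler_nat; exact: ilt.
      by rewrite ler_pM2r// lerNl.
    rewrite (le_trans (fL _ _ _ Ds (Dsp k i)))//.
    rewrite (@le_trans _ _ (L / K k * expR (c / 2 * s)))//; last first.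
      apply: ler_wpM2r; first exact: ltW.
      apply: ler_wpM2r; first by rewrite invr_ge0.
      by rewrite /Q lerDl mulr_ge0// divr_ge0// ltW.
    rewrite -mulrA ler_wpM2l// (le_trans (Asame k i _ _ As (Asp _ _ _ As)))//.
    rewrite (@le_trans _ _ ((K k)^-1 * expR (c * s)))//; last first.
      by apply: ler_wpM2l; rewrite ?invr_ge0// ler_expR.
    rewrite -(invrK (expR (c * s))) -expRN -invfM lef_pV2 ?posrE ?mulr_gt0 ?expR_gt0//.
    rewrite (le_trans _ (mK k))//; apply: ler_wpM2l => //.
    by rewrite ler_expR -mulrN ler_pM2l// lerNl.
  rewrite -leqNgt => nlei; rewrite subr0.
  have sK : s <= - K k.
    have : K k * (m k)%:R <= - s * (m k)%:R.
      rewrite (le_trans _ h1)// /K -natrM ler_nat; exact: nlei.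
    by rewrite ler_pM2r// lerNr.
  rewrite (le_trans (fC _ _ Ds))//.
  have -> : c * s = c / 2 * s + c / 2 * s by field.
  rewrite expRD mulrA /h; apply: ler_wpM2r; first exact: ltW.
  rewrite (@le_trans _ _ (C * (2 / c) / K k))//; last first.
    by apply: ler_wpM2r; rewrite ?invr_ge0// /Q lerDr.
  rewrite -[leRHS]mulrA; apply: ler_wpM2l => //.
  rewrite -(invrK (expR _)) -expRN.
  rewrite -[X in _ <= X]invrK lef_pV2 ?posrE ?expR_gt0//; last first.
    by rewrite invr_gt0 divr_gt0// divr_gt0.
  rewrite (@le_trans _ _ (- (c / 2 * s)))//; last first.
    by rewrite (le_trans _ (expR_ge1Dx _))// lerDr.
  have -> : (2 / c / K k)^-1 = c / 2 * K k by rewrite !invfM !invrK [2^-1 * c]mulrC.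
  rewrite -mulrN; apply: ler_wpM2l; first by rewrite divr_ge0// ltW.
  by rewrite lerNr.
have mh k : measurable_fun D (h k).
  by apply: measurable_funM => //; exact: measurable_expRM.
have h0 k s : 0 <= h k s.
  by rewrite mulr_ge0 ?expR_ge0// divr_ge0// ltW.
pose E k : R := Q / K k * (c / 2)^-1.
have intexp b : 0 < b -> (\int[leb]_(s in D) (expR (b * s))%:E <= (b^-1)%:E)%E.
  move=> b0; rewrite -[X in (_ <= X%:E)%E]mul1r -expR0 -(mulr0 b).
  rewrite -integral_expR_Nyitv//; apply: ge0_subset_integral => //.
  by apply/measurable_EFinP; exact: measurable_expRM.
have hE k : (\int[leb]_(s in D) (h k s)%:E <= (E k)%:E)%E.
  under eq_integral do rewrite /h EFinM.
  rewrite ge0_integralZl_EFin//.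
  - rewrite /E [leRHS]EFinM; apply: lee_wpmul2l; first by rewrite lee_fin divr_ge0// ltW.
    by apply: intexp; rewrite divr_gt0.
  - by apply/measurable_EFinP; exact: measurable_expRM.
  - by rewrite divr_ge0// ltW.
have E_cvg : E k @[k --> \oo] --> (0 : R).
  rewrite (_ : E = fun k => Q * harmonic k * (c / 2)^-1)//.
  rewrite [X in _ --> X](_ : _ = Q * 0 * (c / 2)^-1); last by rewrite mulr0 mul0r.
  by apply: cvgM; [apply: cvgM; [exact: cvg_cst|exact: cvg_harmonic]|exact: cvg_cst].
have mfp p : measurable_fun D (f ^~ p).
  by apply: (@Lipschitz_measurable _ _ L) => // s s' Ds Ds'; exact: fL.
have [intf vC] : (forall p, leb.-integrable D (EFin \o f ^~ p)) /\
    (forall p, `|v p| <= C * c^-1).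
  apply/all_and2 => p.
  apply: (@Rintegral_normr_le _ _ _ leb D mD _ (fun s => C * expR (c * s))) => //.
  - by apply: measurable_funM => //; exact: measurable_expRM.
  - by apply: nearW => s; exact: fC.
  - by move=> s _; rewrite mulr_ge0// expR_ge0.
  - under eq_integral do rewrite EFinM.
    rewrite ge0_integralZl_EFin//.
      by rewrite EFinM; apply: lee_wpmul2l; [rewrite lee_fin|exact: intexp].
    by apply/measurable_EFinP; exact: measurable_expRM.
have Afin k i : (leb (A k i) < +oo)%E.
  apply: (@le_lt_trans _ _ (leb `](- (i.+1%:R / (m k)%:R)), (- (i%:R / (m k)%:R))]%classic)).
    by apply: le_measure => [||s []//]; rewrite inE; [exact: mA|exact: measurable_itv].
  by rewrite lebesgue_measure_itv/=; case: ifP => _; rewrite ltry.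
have vI k p : `|v p - I k p| <= E k.
  have [|intS IS] := @Rintegral_simple R D (n k) (A k) (fun i => f (sp k i) p) mD.
    by move=> i; split => // s [].
  have -> : v p - I k p = \int[leb]_(s in D) (f s p - S k s p).
    rewrite /v /I !fct_sumE.
    under [X in _ - X]eq_bigr do rewrite /GRing.scale/=.
    rewrite -IS -RintegralB//; apply: eq_Rintegral => s _.
    by rewrite /S !fct_sumE.
  have [] // := @Rintegral_normr_le _ _ _ leb D mD (fun s => f s p - S k s p)
    (h k) (E k); last by apply: nearW => s; exact: fSh.
  apply: measurable_funB => //.
  apply/measurable_EFinP; move/measurable_int : intS.
  by apply: eq_measurable_fun => s _; rewrite /= /S !fct_sumE.
have mv : measurable_fun setT v.
  apply: (@measurable_fun_cvg _ _ _ setT I) => [k|p _].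
    exact: (Linfty_measurable (LI k)).
  apply/cvgrPdist_le => e e0; near=> k; rewrite (le_trans (vI k p))//.
  rewrite -[E k]subr0 (le_trans (ler_norm _))// distrC; near: k.
  by have /cvgrPdist_le := E_cvg; exact.
have Lv : Linfty mu v.
  by case: (@Linfty_norm_leI _ _ _ _ mu_gt0 v (C * c^-1) mv) => //; exact: nearW.
have nSh k s : D s -> Linfty_norm mu (f s - S k s) <= h k s.
  move=> Ds; case: (@Linfty_norm_leI _ _ _ _ mu_gt0 (f s - S k s) (h k s)) => //.
    by apply: (@Linfty_measurable _ _ _ mu); apply: LinftyB => //; exact: Lf.
  by apply: nearW => p; exact: fSh.
have mN k : measurable_fun D (fun s => Linfty_norm mu (f s - S k s)).
  rewrite [X in measurable_fun X _](D_cup k).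
  apply/(measurable_fun_bigcup _ (mA k)) => i.
  apply: (@Lipschitz_measurable _ _ L) => // s s' As As'.
  have -> : S k s' = S k s by rewrite (SE k i)// (SE k i).
  have [Ds Ds'] : D s /\ D s' by case: As As' => + _ [].
  have a u w : D u -> D w -> Linfty_norm mu (f u - S k s) <=
      Linfty_norm mu (f w - S k s) + L * `|u - w|.
    move=> Du Dw; have -> : f u - S k s = (f w - S k s) + (f u - f w).
      by apply/funext => x; rewrite /GRing.add /GRing.opp /=; ring.
    have [] // := Linfty_norm_leD mu_gt0
      (conj (LinftyB mu_gt0 (Lf _ Dw) (LS k s)) (lexx _))
      (conj (LinftyB mu_gt0 (Lf _ Du) (Lf _ Dw)) (Lfe _ _ Du Dw)).
  have := a _ _ Ds Ds'; have := a _ _ Ds' Ds.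
  by rewrite [`|s' - s|]distrC ler_norml; lra.
split => //; exists n, A, (fun k i => f (sp k i)); split => //.
- by move=> k i; split => //; [move=> s []|exact: Lf].
- apply: (@squeeze_cvge _ _ _ _ (cst 0%E) _ (fun k => (E k)%:E)) => //.
  + apply: nearW => k; apply/andP; split.
      by apply: integral_ge0 => s _; rewrite lee_fin Linfty_norm_ge0.
    apply: le_trans (hE k); apply: ge0_le_integral => //.
    * by move=> s _; rewrite lee_fin Linfty_norm_ge0.
    * by apply/measurable_EFinP; exact: mN.
    * exact/measurable_EFinP.
    * by move=> s Ds; rewrite lee_fin nSh.
  + exact: cvg_cst.
  + by apply/fine_cvgP; split => //; apply: nearW.
- apply: (squeeze_cvgr (f := fun=> 0) (h := E)) => //; last exact: cvg_cst.
  apply: nearW => k; rewrite Linfty_norm_ge0//=.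
  case: (@Linfty_norm_leI _ _ _ _ mu_gt0 (v - I k) (E k)) => //.
    by apply: (@Linfty_measurable _ _ _ mu); exact: LinftyB.
  by apply: nearW => p; exact: vI.
Unshelve. all: by end_near. Qed.

End Lipschitz_Bochner.

(** * The unit interval and Lipschitz functions of two variables *)

Section unit_interval.
Context (R : realType).
Local Notation leb := (@lebesgue_measure R).
Local Notation mu := (unit_lebesgue R).
Local Notation mu2 := (unit_lebesgue2 R).
Local Notation I01 f := (\int[leb]_(y in `[0%R, 1%R]) f y).
Local Notation unit_itv := (`[0%R, 1%R]%classic : set (measurableTypeR R)).

Lemma measurable_unit_itv : measurable unit_itv.
Proof. exact: measurable_itv. Qed.

Lemma lebesgue_unit_itv : leb `[0%R, 1%R]%classic = 1%E.
Proof. by rewrite lebesgue_measure_itv/= lte_fin ltr01 oppr0 adde0. Qed.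

Lemma unit_lebesgueT : mu setT = 1%E.
Proof. by rewrite /unit_lebesgue /mfrestr /mrestr setTI lebesgue_unit_itv. Qed.

Lemma unit_lebesgue_gt0 : (0 < mu setT)%E.
Proof. by rewrite unit_lebesgueT. Qed.

Lemma unit_lebesgue2_gt0 : (0 < mu2 setT)%E.
Proof.
rewrite -setXTT /unit_lebesgue2 product_measure1E//.
by apply: mule_gt0; exact: unit_lebesgue_gt0.
Qed.

Lemma ae_unit_lebesgue (P : R -> Prop) : {ae mu, forall y, P y} ->
  {ae leb, forall y, `[0%R, 1%R]%classic y -> P y}.
Proof.
move=> [N [mN N0 PN]]; exists (N `&` `[0%R, 1%R]%classic); split.
- by apply: measurableI => //; exact: measurable_unit_itv.
- exact: N0.
- by move=> y /= /not_implyP[y01 nP]; split => //; exact: PN.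
Qed.

Lemma ae_unit_lebesgueW (P : R -> Prop) :
  (forall y, `[0%R, 1%R]%classic y -> P y) -> {ae mu, forall y, P y}.
Proof.
move=> h; exists (~` `[0%R, 1%R]%classic); split.
- by apply: measurableC; exact: measurable_unit_itv.
- by rewrite /unit_lebesgue /mfrestr /mrestr setICl measure0.
- by move=> y /= + y01; apply; exact: h.
Qed.

Lemma ae_prod1 (P : R -> Prop) : {ae mu, forall x, P x} ->
  {ae mu2, forall p, P p.1}.
Proof.
move=> [N [mN N0 PN]]; exists (N `*` setT); split.
- exact: measurableX.
- rewrite /unit_lebesgue2 product_measure1E//.
  by rewrite [X in (X * _)%E](_ : _ = 0%E) ?mul0e//; exact: N0.
- by move=> p /= nP; split => //; exact: PN.
Qed.

Lemma ae_prod2 (P : R -> Prop) : {ae mu, forall x, P x} ->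
  {ae mu2, forall p, P p.2}.
Proof.
move=> [N [mN N0 PN]]; exists (setT `*` N); split.
- exact: measurableX.
- rewrite /unit_lebesgue2 product_measure1E//.
  by rewrite [X in (_ * X)%E](_ : _ = 0%E) ?mule0//; exact: N0.
- by move=> p /= nP; split => //; exact: PN.
Qed.

(** Tonelli: the measures of the sections of a null set integrate to zero. *)
Lemma ae_section (P : R * R -> Prop) : {ae mu2, forall p, P p} ->
  {ae mu, forall x, {ae mu, forall y, P (x, y)}}.
Proof.
move=> [N [mN N0 PN]].
have mf := measurable_fun_xsection mu mN.
have : ae_eq mu setT (mu \o xsection N) (cst 0%E).
  apply/ae_eq_integral_abs => //; rewrite -[RHS]N0; apply: eq_integral => x _.
  by rewrite /= gee0_abs.
apply: filterS => x /(_ Logic.I) /= xN; exists (xsection N x); split => //.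
  exact: measurable_xsection.
by move=> y /= nP; rewrite /xsection /= inE; exact: PN.
Qed.

Lemma I01_normr_le (f : R -> R) (c : R) : 0 <= c -> measurable_fun setT f ->
  {ae mu, forall y, `|f y| <= c} ->
  leb.-integrable unit_itv (EFin \o f) /\ `|I01 f| <= c.
Proof.
move=> c0 mf fc.
apply: (@Rintegral_normr_le _ _ _ leb _ measurable_unit_itv f (fun=> c)) => //.
- exact: measurable_funTS.
- exact: ae_unit_lebesgue.
- rewrite integral_cst; last exact: measurable_unit_itv.
  rewrite [X in (_ * X <= _)%E](_ : _ = 1%E) ?mule1//; exact: lebesgue_unit_itv.
Qed.

Lemma I01_ae_eq (f g : R -> R) : measurable_fun setT f -> measurable_fun setT g ->
  {ae mu, forall y, f y = g y} -> I01 f = I01 g.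
Proof.
move=> mf mg fg; rewrite /Rintegral; congr fine; apply: ae_eq_integral.
- exact: measurable_unit_itv.
- by apply/measurable_EFinP; exact: measurable_funTS.
- by apply/measurable_EFinP; exact: measurable_funTS.
- apply: (@filterS _ _ (ae_filter_ringOfSetsType leb) _ _ _ (ae_unit_lebesgue fg)).
  by move=> y + y01 => /(_ y01) /= ->.
Qed.

Lemma I01B (f g : R -> R) : leb.-integrable unit_itv (EFin \o f) ->
  leb.-integrable unit_itv (EFin \o g) ->
  I01 f - I01 g = I01 (fun y => f y - g y).
Proof. by move=> intf intg; rewrite -RintegralB//; exact: measurable_unit_itv. Qed.

Lemma measurable_I01 (g : R * R -> R) : measurable_fun setT g ->
  measurable_fun setT (fun x => I01 (fun y => g (x, y))).
Proof.
move=> mg; pose g' (p : R * R) : R := g p * \1_(`[0%R, 1%R]%classic) p.2.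
have mg' : measurable_fun setT g'.
  apply: measurable_funM => //.
  apply: (@measurableT_comp _ _ _ _ _ _ (\1_(`[0%R, 1%R]%classic) : R -> R)).
    by apply: measurable_indic; exact: measurable_unit_itv.
  exact: measurable_snd.
have h (h' : R * R -> R) : measurable_fun setT h' -> (forall p, 0 <= h' p) ->
    measurable_fun setT (fun x => (\int[leb]_y (h' (x, y))%:E)%E).
  move=> mh h0.
  have := @measurable_fun_fubini_tonelli_F _ _ _ _ _ leb (EFin \o h').
  by apply => //; exact/measurable_EFinP.
have -> : (fun x => I01 (fun y => g (x, y))) =
  (fun x => fine ((\int[leb]_y (g'^\+ (x, y))%:E)%E - (\int[leb]_y (g'^\- (x, y))%:E)%E)%E).
  apply/funext => x; rewrite /Rintegral; congr fine.
  rewrite integral_mkcond integralE; congr (_ - _)%E.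
    apply: eq_integral => y _; rewrite funeposE /g' /funrpos /= /patch indicE.
    case: (y \in _); first by rewrite mulr1 EFin_max.
    by rewrite mulr0 EFin_max.
  apply: eq_integral => y _; rewrite funenegE /g' /funrneg /= /patch indicE.
  case: (y \in _); first by rewrite mulr1 EFin_max EFinN.
  by rewrite mulr0 EFin_max EFinN.
apply: measurableT_comp => //; apply: emeasurable_funB; apply: h.
- exact: measurable_funrpos.
- by move=> p; rewrite /funrpos le_max lexx orbT.
- exact: measurable_funrneg.
- by move=> p; rewrite /funrneg le_max lexx orbT.
Qed.

End unit_interval.

Section Lipschitz2.
Context (R : realType).

Lemma derivable_Lipschitz (f : R -> R) (K : R) :
  (forall x, derivable f x 1) -> (forall x, `|derive1 f x| <= K) ->
  forall x y, `|f x - f y| <= K * `|x - y|.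
Proof.
move=> df fK.
have main x y : y <= x -> `|f x - f y| <= K * `|x - y|.
  move=> yx; have [||c _ ->] := @MVT_segment R f (derive1 f) y x yx.
  - by move=> z _; rewrite derive1E; exact: derivableP.
  - by apply: derivable_within_continuous => z _.
  - by rewrite normrM ler_wpM2r.
move=> x y; have [|/ltW xy] := leP y x; first exact: main.
by rewrite distrC [`|x - y|]distrC; exact: main.
Qed.

Definition Lipschitz2 (F : R -> R -> R) (K : R) :=
  forall x y x' y', `|F x y - F x' y'| <= K * (`|x - x'| + `|y - y'|).

Lemma derivable_Lipschitz2 (F : R -> R -> R) (K : R) :
  (forall x y, derivable (F ^~ y) x 1) -> (forall x y, derivable (F x) y 1) ->
  (forall x y, `|d1 F x y| <= K) -> (forall x y, `|d2 F x y| <= K) ->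
  Lipschitz2 F K.
Proof.
move=> d1F d2F K1 K2 x y x' y'.
rewrite (_ : F x y - F x' y' = (F x y - F x' y) + (F x' y - F x' y')); last by ring.
rewrite (le_trans (ler_normD _ _))// mulrDr lerD//.
- exact: (@derivable_Lipschitz (F ^~ y) K (d1F ^~ y) (K1 ^~ y)).
- exact: (@derivable_Lipschitz (F x') K (d2F x') (K2 x')).
Qed.

(** A Lipschitz function of two variables is the supremum, over rational base
    points, of cones of slope K, so that its superlevel sets are countable unions
    of superlevel sets of sums of functions of one variable. *)
Lemma measurable_Lipschitz2 d (T : measurableType d) (F : R -> R -> R) (K : R)
    (D : set T) (f g : T -> R) :
  0 <= K -> Lipschitz2 F K -> measurable_fun D f -> measurable_fun D g ->
  measurable_fun D (fun p => F (f p) (g p)).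
Proof.
move=> K0 FK mf mg mD; apply: (measurability _ (RGenOInfty.measurableE R)) => //.
move=> /= _ [_ [a ->] <-].
pose G (q q' : rat) (p : T) : R := F (ratr q) (ratr q')
  - K * (`|f p - ratr q| + `|g p - ratr q'|).
have mG q q' : measurable_fun D (G q q').
  apply: measurable_funB => //; apply: measurable_funM => //.
  apply: measurable_funD; apply: measurableT_comp => //; exact: measurable_funB.
have GF q q' p : G q q' p <= F (f p) (g p).
  have := FK (ratr q) (ratr q') (f p) (g p).
  by rewrite /G [`|ratr q - _|]distrC [`|ratr q' - _|]distrC ler_norml; lra.
rewrite [X in measurable X](_ : _ = \bigcup_(q : rat) \bigcup_(q' : rat)
    (D `&` G q q' @^-1` `]a, +oo[)).
  apply: bigcupT_measurable_rat => q; apply: bigcupT_measurable_rat => q'.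
  by apply: mG => //; exact: measurable_itv.
apply/seteqP; split => [p [Dp]|p [q _ [q' _ [Dp]]]] /=; rewrite !in_itv/= !andbT.
  move=> aF; pose e : R := (F (f p) (g p) - a) / (4 * (K + 1)).
  have K1 : 0 < 4 * (K + 1) by rewrite mulr_gt0// ltr_wpDl.
  have e0 : 0 < e by rewrite divr_gt0// subr_gt0.
  have [q /itvP qE] : exists q : rat, ratr q \in `]f p - e, f p + e[.
    by apply: rat_in_itvoo; lra.
  have [q' /itvP q'E] : exists q : rat, ratr q \in `]g p - e, g p + e[.
    by apply: rat_in_itvoo; lra.
  exists q => //; exists q' => //; split => //=; rewrite in_itv/= andbT.
  have h1 : `|f p - ratr q| <= e by rewrite ler_distlC !ltW// qE.
  have h2 : `|g p - ratr q'| <= e by rewrite ler_distlC !ltW// q'E.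
  have FE := FK (f p) (g p) (ratr q) (ratr q').
  have h3 : K * (`|f p - ratr q| + `|g p - ratr q'|) <= K * (e + e).
    by apply: ler_wpM2l => //; exact: lerD.
  have h4 : 4 * (K * e) < F (f p) (g p) - a.
    rewrite (_ : F (f p) (g p) - a = e * (4 * (K + 1))); last by rewrite divfK// gt_eqF.
    have -> : e * (4 * (K + 1)) = 4 * (K * e) + 4 * e by ring.
    by rewrite ltrDl mulr_gt0.
  move: FE; rewrite /G ler_norml => /andP[_ FE].
  by move: h3; rewrite mulrDr; lra.
by move=> aG; split => //; rewrite (lt_le_trans aG).
Qed.

End Lipschitz2.

(** * Lipschitz estimates for the truncated phase field *)

Section sup_norm_theory.
Context (R : realType).

Lemma sup_norm_ub (f : R -> R) : (exists K, forall x, `|f x| <= K) ->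
  forall x, `|f x| <= sup_norm f.
Proof.
move=> [K fK] x; apply: ub_le_sup; last by exists x.
by exists K => _ [y _ <-].
Qed.

Lemma sup_norm2_ub (F : R -> R -> R) : (exists K, forall x y, `|F x y| <= K) ->
  forall x y, `|F x y| <= sup_norm2 F.
Proof.
move=> [K FK] x y; apply: ub_le_sup; last by exists (x, y).
by exists K => _ [p _ <-].
Qed.

Lemma ler_normM_sub (a b a' b' A B A' B' : R) :
  `|a - a'| <= A -> `|b| <= B -> `|a'| <= A' -> `|b - b'| <= B' ->
  `|a * b - a' * b'| <= A * B + A' * B'.
Proof.
move=> hA hB hA' hB'.
rewrite (_ : a * b - a' * b' = (a - a') * b + a' * (b - b')); last by ring.
by rewrite (le_trans (ler_normD _ _))// lerD// normrM ler_pM.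
Qed.

End sup_norm_theory.

Definition smooth_model (R : realType) (Gamma : R -> R) (H : R -> R -> R)
    (chi : R -> R) (r : R) : Prop :=
  [/\ Cb 1 Gamma, Cb2 2 H, cutoff_profile chi & sup_norm2 H < r].

Section model_bounds.
Context (R : realType).
Variables (Gamma : R -> R) (H : R -> R -> R) (chi : R -> R) (r M : R).
Hypothesis mdl : smooth_model Gamma H chi r.

Local Notation leb := (@lebesgue_measure R).
Local Notation mu := (unit_lebesgue R).
Local Notation mu2 := (unit_lebesgue2 R).
Local Notation I01 f := (\int[leb]_(y in `[0%R, 1%R]) f y).
Local Notation unit_itv := (`[0%R, 1%R]%classic : set (measurableTypeR R)).
Local Notation MG := (sup_norm Gamma).
Local Notation LG := (sup_norm (derive1 Gamma)).
Local Notation MDH := (M_DH H).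
Local Notation MD2H := (M_D2H H).
Local Notation c1 := (C1 r MG MDH M).
Local Notation c2 := (C2 r MG M).
Local Notation c3 := (C3 r MG LG MDH MD2H M).
Local Notation c4 := (C4 r MG LG MDH).
Local Notation sig := (sigma chi r).
Local Notation B := (B_field Gamma H chi r).
Local Notation DhB Omega xi theta := (Dh0 H theta (B Omega xi theta)).

Let GammaC1 : Cb 1 Gamma. Proof. by case: mdl. Qed.
Let HC2 : Cb2 2 H. Proof. by case: mdl. Qed.
Let chiP : cutoff_profile chi. Proof. by case: mdl. Qed.
Let rMH : sup_norm2 H < r. Proof. by case: mdl. Qed.

Lemma Gamma_le x : `|Gamma x| <= MG.
Proof. by apply: sup_norm_ub; case: GammaC1. Qed.

Lemma Gamma_Lipschitz x y : `|Gamma x - Gamma y| <= LG * `|x - y|.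
Proof.
case: GammaC1 => _ _ [dG [_ bG _]].
by apply: derivable_Lipschitz => // z; exact: sup_norm_ub.
Qed.

Lemma H_le x y : `|H x y| <= sup_norm2 H.
Proof. by apply: sup_norm2_ub; case: HC2. Qed.

Lemma d1H_le x y : `|d1 H x y| <= MDH.
Proof.
case: HC2 => _ _ [_ _ [_ b1 _] _].
by rewrite /M_DH le_max; apply/orP; left; exact: (@sup_norm2_ub _ (d1 H)).
Qed.

Lemma d2H_le x y : `|d2 H x y| <= MDH.
Proof.
case: HC2 => _ _ [_ _ _ [_ b2 _]].
by rewrite /M_DH le_max; apply/orP; right; exact: (@sup_norm2_ub _ (d2 H)).
Qed.

Lemma H_Lipschitz : Lipschitz2 H MDH.
Proof.
case: HC2 => _ _ [h1 h2 _ _].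
by apply: derivable_Lipschitz2 => // x y; [exact: d1H_le|exact: d2H_le].
Qed.

Lemma d1H_Lipschitz : Lipschitz2 (d1 H) MD2H.
Proof.
case: HC2 => _ _ [_ _ [_ _ [h1 h2 [_ b11 _] [_ b21 _]]] _].
apply: (derivable_Lipschitz2 h1 h2) => x y; rewrite /M_D2H le_max; apply/orP.
- left; rewrite le_max; apply/orP; left; exact: (@sup_norm2_ub _ (d1 (d1 H)) b11 x y).
- right; rewrite le_max; apply/orP; left; exact: (@sup_norm2_ub _ (d2 (d1 H)) b21 x y).
Qed.

Lemma d2H_Lipschitz : Lipschitz2 (d2 H) MD2H.
Proof.
case: HC2 => _ _ [_ _ _ [_ _ [h1 h2 [_ b12 _] [_ b22 _]]]].
apply: (derivable_Lipschitz2 h1 h2) => x y; rewrite /M_D2H le_max; apply/orP.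
- left; rewrite le_max; apply/orP; right; exact: (@sup_norm2_ub _ (d1 (d2 H)) b12 x y).
- right; rewrite le_max; apply/orP; right; exact: (@sup_norm2_ub _ (d2 (d2 H)) b22 x y).
Qed.

Lemma MG_ge0 : 0 <= MG. Proof. exact: le_trans (Gamma_le 0). Qed.

Lemma LG_ge0 : 0 <= LG.
Proof.
by have := Gamma_Lipschitz 1 0; rewrite subr0 normr1 mulr1; apply: le_trans.
Qed.

Lemma MH_ge0 : 0 <= sup_norm2 H. Proof. exact: le_trans (H_le 0 0). Qed.

Lemma MDH_ge0 : 0 <= MDH. Proof. exact: le_trans (d1H_le 0 0). Qed.

Lemma MD2H_ge0 : 0 <= MD2H.
Proof.
have := d1H_Lipschitz 1 0 0 0; rewrite subrr normr0 subr0 normr1 addr0 mulr1.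
exact: le_trans.
Qed.

Lemma r_gt0 : 0 < r. Proof. exact: (le_lt_trans MH_ge0 rMH). Qed.

Lemma sigma_le z : `|sig z| <= 2 * r.
Proof.
have r0 := r_gt0; rewrite /sigma normrM gtr0_norm// mulrC ler_pM2r//.
by case: chiP => _ _ _ [+ _] _; apply.
Qed.

Lemma sigma_Lipschitz x y : `|sig x - sig y| <= `|x - y|.
Proof.
have r0 := r_gt0; rewrite /sigma -mulrBr normrM gtr0_norm//.
have -> : `|x - y| = r * `|x / r - y / r|.
  by rewrite -mulrBl normrM [`|r^-1|]gtr0_norm ?invr_gt0// mulrCA divff ?mulr1// gt_eqF.
rewrite ler_pM2l// -[X in _ <= X]mul1r.
case: chiP => _ Cchi _ [_ chi1] _; case: (Cchi 1) => _ _ [dchi _].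
exact: derivable_Lipschitz.
Qed.

Lemma sigma_id z : `|z| <= r -> sig z = z.
Proof.
have r0 := r_gt0; move=> zr; case: chiP => _ _ chi_id _ _.
rewrite /sigma chi_id; first by rewrite mulrC divfK// gt_eqF.
by rewrite normrM [`|r^-1|]gtr0_norm ?invr_gt0// ler_pdivrMr// mul1r.
Qed.

Lemma measurable_sigma d (T : measurableType d) (D : set T) (f : T -> R) :
  measurable_fun D f -> measurable_fun D (fun p => sig (f p)).
Proof.
move=> mf; apply: (@measurableT_comp _ _ _ _ _ _ sig) => //.
by apply: (@Lipschitz_measurable _ _ _ 1) => // x y _ _; rewrite mul1r; exact: sigma_Lipschitz.
Qed.

Lemma measurable_Gamma d (T : measurableType d) (D : set T) (f : T -> R) :
  measurable_fun D f -> measurable_fun D (fun p => Gamma (f p)).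
Proof.
move=> mf; apply: (@measurableT_comp _ _ _ _ _ _ Gamma) => //.
by apply: (@Lipschitz_measurable _ _ _ LG) => // x y _ _; exact: Gamma_Lipschitz.
Qed.

Lemma measurable_H d (T : measurableType d) (D : set T) (f g : T -> R) :
  measurable_fun D f -> measurable_fun D g -> measurable_fun D (fun p => H (f p) (g p)).
Proof. exact: measurable_Lipschitz2 MDH_ge0 H_Lipschitz. Qed.

Lemma measurable_d1H d (T : measurableType d) (D : set T) (f g : T -> R) :
  measurable_fun D f -> measurable_fun D g -> measurable_fun D (fun p => d1 H (f p) (g p)).
Proof. exact: measurable_Lipschitz2 MD2H_ge0 d1H_Lipschitz. Qed.

Lemma measurable_d2H d (T : measurableType d) (D : set T) (f g : T -> R) :
  measurable_fun D f -> measurable_fun D g -> measurable_fun D (fun p => d2 H (f p) (g p)).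
Proof. exact: measurable_Lipschitz2 MD2H_ge0 d2H_Lipschitz. Qed.

Lemma measurable_fst_comp (f : R -> R) : measurable_fun setT f ->
  measurable_fun setT (fun p : R * R => f p.1).
Proof. by move=> mf; apply: measurableT_comp => //; exact: measurable_fst. Qed.

Lemma measurable_snd_comp (f : R -> R) : measurable_fun setT f ->
  measurable_fun setT (fun p : R * R => f p.2).
Proof. by move=> mf; apply: measurableT_comp => //; exact: measurable_snd. Qed.

Lemma measurable_section (f : R * R -> R) x : measurable_fun setT f ->
  measurable_fun setT (fun y => f (x, y)).
Proof. by move=> mf; apply: measurableT_comp => //; exact: pair1_measurable. Qed.

Implicit Types (xi : R * R -> R) (theta Omega : R -> R).

Definition kern xi theta (p : R * R) : R :=
  sig (h0 H theta p + xi p) * Gamma (theta p.2 - theta p.1).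

Lemma measurable_h0 theta : measurable_fun setT theta ->
  measurable_fun setT (h0 H theta).
Proof.
move=> mt; apply: measurable_H; [exact: measurable_fst_comp|exact: measurable_snd_comp].
Qed.

Lemma measurable_Gamma_diff theta : measurable_fun setT theta ->
  measurable_fun setT (fun p : R * R => Gamma (theta p.2 - theta p.1)).
Proof.
move=> mt; apply: measurable_Gamma; apply: measurable_funB.
- exact: measurable_snd_comp.
- exact: measurable_fst_comp.
Qed.

Lemma measurable_kern xi theta : measurable_fun setT xi -> measurable_fun setT theta ->
  measurable_fun setT (kern xi theta).
Proof.
move=> mx mt; apply: measurable_funM; last exact: measurable_Gamma_diff.
by apply: measurable_sigma; apply: measurable_funD => //; exact: measurable_h0.
Qed.

Lemma kern_le xi theta p : `|kern xi theta p| <= 2 * r * MG.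
Proof. by rewrite normrM ler_pM// ?sigma_le// Gamma_le. Qed.

Lemma kern_int xi theta x : measurable_fun setT xi -> measurable_fun setT theta ->
  leb.-integrable unit_itv (EFin \o (fun y => kern xi theta (x, y))) /\
  `|I01 (fun y => kern xi theta (x, y))| <= 2 * r * MG.
Proof.
move=> mx mt; apply: I01_normr_le.
- by rewrite !mulr_ge0 ?MG_ge0// ltW// r_gt0.
- by apply: measurable_section; exact: measurable_kern.
- by apply: nearW => y; exact: kern_le.
Qed.

Lemma B_field_le Omega xi theta x : measurable_fun setT xi -> measurable_fun setT theta ->
  `|Omega x| <= M -> `|B Omega xi theta x| <= c2.
Proof.
move=> mx mt OM; rewrite (le_trans (ler_normD _ _))// /C2 lerD//.
by case: (kern_int x mx mt).
Qed.

Lemma measurable_B_field Omega xi theta : measurable_fun setT Omega ->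
  measurable_fun setT xi -> measurable_fun setT theta ->
  measurable_fun setT (B Omega xi theta).
Proof.
move=> mO mx mt; apply: measurable_funD => //.
exact: (measurable_I01 (measurable_kern mx mt)).
Qed.

Lemma kern_Lipschitz xi theta xi' theta' p dx dt :
  `|xi p - xi' p| <= dx ->
  `|theta p.1 - theta' p.1| <= dt -> `|theta p.2 - theta' p.2| <= dt ->
  `|kern xi theta p - kern xi' theta' p|
    <= MG * dx + (2 * MG * MDH + 4 * r * LG) * dt.
Proof.
move=> hx ht1 ht2; have dx0 : 0 <= dx by exact: le_trans hx.
have dt0 : 0 <= dt by exact: le_trans ht1.
rewrite (@le_trans _ _ ((2 * MDH * dt + dx) * MG + 2 * r * (LG * (2 * dt))))//; last first.
  by rewrite le_eqVlt; apply/orP; left; apply/eqP; ring.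
apply: ler_normM_sub.
- rewrite (le_trans (sigma_Lipschitz _ _))//.
  rewrite (_ : _ - _ = (h0 H theta p - h0 H theta' p) + (xi p - xi' p)); last by ring.
  rewrite (le_trans (ler_normD _ _))// lerD//.
  rewrite (le_trans (H_Lipschitz _ _ _ _))// -mulrA mulrCA ler_wpM2l ?MDH_ge0//.
  by rewrite mulr_natl mulr2n lerD.
- exact: Gamma_le.
- exact: sigma_le.
- rewrite (le_trans (Gamma_Lipschitz _ _))// ler_wpM2l ?LG_ge0//.
  rewrite (_ : _ - _ = (theta p.2 - theta' p.2) - (theta p.1 - theta' p.1)); last by ring.
  by rewrite (le_trans (ler_normB _ _))// mulr_natl mulr2n lerD.
Qed.

(** The value at x involves xi only along the section at x, and theta at x and
    almost everywhere: this form serves both for true functions and for classes. *)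
Lemma B_field_Lipschitz Omega xi theta xi' theta' x dx dt :
  measurable_fun setT xi -> measurable_fun setT theta ->
  measurable_fun setT xi' -> measurable_fun setT theta' ->
  0 <= dx ->
  {ae mu, forall y, `|xi (x, y) - xi' (x, y)| <= dx} ->
  `|theta x - theta' x| <= dt ->
  {ae mu, forall y, `|theta y - theta' y| <= dt} ->
  `|B Omega xi theta x - B Omega xi' theta' x|
    <= MG * dx + (2 * MG * MDH + 4 * r * LG) * dt.
Proof.
move=> mx mt mx' mt' dx0 hx ht1 ht2.
have dt0 : 0 <= dt by exact: le_trans ht1.
rewrite /B_field opprD addrACA subrr add0r.
have [i1 _] := kern_int x mx mt; have [i2 _] := kern_int x mx' mt'.
rewrite I01B//.
case: (@I01_normr_le _ (fun y => kern xi theta (x, y) - kern xi' theta' (x, y))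
  (MG * dx + (2 * MG * MDH + 4 * r * LG) * dt)) => //.
- have := MG_ge0; have := MDH_ge0; have := LG_ge0; have := ltW r_gt0 => r0 L0 D0 G0.
  by rewrite addr_ge0// mulr_ge0// addr_ge0// !mulr_ge0.
- by apply: measurable_funB; apply: measurable_section; exact: measurable_kern.
- by apply: aeS2 hx ht2 => y hx hy; exact: kern_Lipschitz.
Qed.

Lemma measurable_DhB Omega xi theta : measurable_fun setT Omega ->
  measurable_fun setT xi -> measurable_fun setT theta ->
  measurable_fun setT (DhB Omega xi theta).
Proof.
move=> mO mx mt; have mB := measurable_B_field mO mx mt.
apply: measurable_funD; apply: measurable_funM.
- by apply: measurable_d1H; [exact: measurable_fst_comp|exact: measurable_snd_comp].
- exact: measurable_fst_comp.
- by apply: measurable_d2H; [exact: measurable_fst_comp|exact: measurable_snd_comp].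
- exact: measurable_snd_comp.
Qed.

Lemma Dh0_le theta phi p K : `|phi p.1| <= K -> `|phi p.2| <= K ->
  `|Dh0 H theta phi p| <= 2 * MDH * K.
Proof.
move=> h1 h2; rewrite -mulrA mulr_natl mulr2n (le_trans (ler_normD _ _))//.
by apply: lerD; rewrite normrM; apply: ler_pM => //; [exact: d1H_le|exact: d2H_le].
Qed.

Lemma DhB_le Omega xi theta p : measurable_fun setT xi -> measurable_fun setT theta ->
  `|Omega p.1| <= M -> `|Omega p.2| <= M -> `|DhB Omega xi theta p| <= c1.
Proof. by move=> mx mt h1 h2; apply: Dh0_le; exact: B_field_le. Qed.

Lemma Dh0_Lipschitz theta theta' phi phi' p dt K db :
  `|theta p.1 - theta' p.1| <= dt -> `|theta p.2 - theta' p.2| <= dt ->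
  `|phi p.1| <= K -> `|phi p.2| <= K ->
  `|phi p.1 - phi' p.1| <= db -> `|phi p.2 - phi' p.2| <= db ->
  `|Dh0 H theta phi p - Dh0 H theta' phi' p| <= 4 * MD2H * K * dt + 2 * MDH * db.
Proof.
move=> t1 t2 p1 p2 q1 q2; rewrite /Dh0 opprD addrACA.
have hD F : Lipschitz2 F MD2H ->
    `|F (theta p.1) (theta p.2) - F (theta' p.1) (theta' p.2)| <= MD2H * (2 * dt).
  move=> FL; rewrite (le_trans (FL _ _ _ _))// ler_wpM2l ?MD2H_ge0//.
  by rewrite mulr_natl mulr2n lerD.
have := ler_normM_sub (hD _ d1H_Lipschitz) p1 (d1H_le _ _) q1.
have := ler_normM_sub (hD _ d2H_Lipschitz) p2 (d2H_le _ _) q2.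
move=> h2 h1; rewrite (le_trans (ler_normD _ _))// (le_trans (lerD h1 h2))//.
by rewrite le_eqVlt; apply/orP; left; apply/eqP; ring.
Qed.

Lemma c2_ge0 : 0 <= M -> 0 <= c2.
Proof. by move=> M0; rewrite addr_ge0// !mulr_ge0 ?MG_ge0// ltW// r_gt0. Qed.

Lemma c4_ge0 : 0 <= c4.
Proof.
have := MG_ge0; have := MDH_ge0; have := LG_ge0; have := ltW r_gt0 => r0 L0 D0 G0.
by rewrite !addr_ge0// !mulr_ge0.
Qed.

Lemma c1_ge0 : 0 <= M -> 0 <= c1.
Proof. by move=> M0; rewrite !mulr_ge0 ?MDH_ge0// c2_ge0. Qed.

Lemma c3_ge0 : 0 <= M -> 0 <= c3.
Proof.
move=> M0; have := c2_ge0 M0; have := MD2H_ge0.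
have := MG_ge0; have := MDH_ge0; have := LG_ge0; have := ltW r_gt0.
move=> r0 L0 D0 G0 D20 c20.
by rewrite /C3 !addr_ge0// !mulr_ge0// addr_ge0// !mulr_ge0.
Qed.

(** C4 and C3 are the sums of the coefficients of the two distances, in the
    estimates for the truncated phase field and for its image under the derivative
    of the critical graph; hence they serve for the sum of the distances. *)
Lemma c4_bound dx dt : 0 <= dx -> 0 <= dt ->
  MG * dx + (2 * MG * MDH + 4 * r * LG) * dt <= c4 * (dx + dt).
Proof.
move=> dx0 dt0; have := MG_ge0; have := MDH_ge0; have := LG_ge0; have := ltW r_gt0.
move=> r0 L0 D0 G0; rewrite /C4 -subr_ge0.
rewrite (_ : _ - _ = (2 * MG * MDH + 4 * r * LG) * dx + MG * dt); last by ring.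
by rewrite addr_ge0// mulr_ge0// addr_ge0// !mulr_ge0.
Qed.

Lemma c3_bound dx dt : 0 <= M -> 0 <= dx -> 0 <= dt ->
  4 * MD2H * c2 * dt + 2 * MDH * (MG * dx + (2 * MG * MDH + 4 * r * LG) * dt)
    <= c3 * (dx + dt).
Proof.
move=> M0 dx0 dt0; have := c2_ge0 M0; have := MD2H_ge0.
have := MG_ge0; have := MDH_ge0; have := LG_ge0; have := ltW r_gt0.
move=> r0 L0 D0 G0 D20 c20; rewrite /C3 -subr_ge0.
rewrite (_ : _ - _ = 2 * MDH * MG * dt
  + (4 * MD2H * c2 + 2 * MDH * (2 * MG * MDH + 4 * r * LG)) * dx); last by ring.
by rewrite addr_ge0// !mulr_ge0// !addr_ge0// !mulr_ge0// !addr_ge0// !mulr_ge0.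
Qed.

Lemma B_field_sup_Lipschitz Omega xi theta xi' theta' dx dt :
  measurable_fun setT xi -> measurable_fun setT theta ->
  measurable_fun setT xi' -> measurable_fun setT theta' ->
  (forall p, `|xi p - xi' p| <= dx) -> (forall x, `|theta x - theta' x| <= dt) ->
  forall x, `|B Omega xi theta x - B Omega xi' theta' x| <= c4 * (dx + dt).
Proof.
move=> mx mt mx' mt' hx ht x.
have dx0 : 0 <= dx by exact: le_trans (hx (0, 0)).
have dt0 : 0 <= dt by exact: le_trans (ht 0).
apply: le_trans (c4_bound dx0 dt0).
by apply: B_field_Lipschitz => //; apply: nearW.
Qed.

Lemma DhB_sup_Lipschitz Omega xi theta xi' theta' dx dt :
  (forall x, `|Omega x| <= M) ->
  measurable_fun setT xi -> measurable_fun setT theta ->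
  measurable_fun setT xi' -> measurable_fun setT theta' ->
  (forall p, `|xi p - xi' p| <= dx) -> (forall x, `|theta x - theta' x| <= dt) ->
  forall p, `|DhB Omega xi theta p - DhB Omega xi' theta' p| <= c3 * (dx + dt).
Proof.
move=> OM mx mt mx' mt' hx ht p.
have dx0 : 0 <= dx by exact: le_trans (hx (0, 0)).
have dt0 : 0 <= dt by exact: le_trans (ht 0).
have M0 : 0 <= M by exact: le_trans (OM 0).
apply: le_trans (c3_bound M0 dx0 dt0).
by apply: Dh0_Lipschitz => //; first [exact: B_field_le|
  by apply: B_field_Lipschitz => //; apply: nearW].
Qed.

(** Uniqueness of fixed points concerns classes, hence needs the two estimates in
    the essential norms: for almost every x the hypotheses of the pointwise bound
    hold along the section at x. *)
Lemma B_field_norm_Lipschitz Omega xi theta xi' theta' dx dt :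
  measurable_fun setT Omega ->
  X_a R xi -> X_theta R theta -> X_a R xi' -> X_theta R theta' ->
  norm_a (xi - xi') <= dx -> norm_theta (theta - theta') <= dt ->
  Linfty_norm mu (B Omega xi theta - B Omega xi' theta') <= c4 * (dx + dt) /\
  ({ae mu, forall x, `|Omega x| <= M} ->
   Linfty_norm mu2 (DhB Omega xi theta - DhB Omega xi' theta') <= c3 * (dx + dt)).
Proof.
move=> mO Lx Lt Lx' Lt' nx nt.
have [mx mt] := (Linfty_measurable Lx, Linfty_measurable Lt).
have [mx' mt'] := (Linfty_measurable Lx', Linfty_measurable Lt').
have g1 := @unit_lebesgue_gt0 R; have g2 := @unit_lebesgue2_gt0 R.
have dx0 : 0 <= dx by apply: le_trans nx; exact: Linfty_norm_ge0.
have dt0 : 0 <= dt by apply: le_trans nt; exact: Linfty_norm_ge0.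
have [_ hx] := Linfty_norm_leE g2 (conj (LinftyB g2 Lx Lx') nx).
have [_ ht] := Linfty_norm_leE g1 (conj (LinftyB g1 Lt Lt') nt).
have hB : {ae mu, forall x, `|B Omega xi theta x - B Omega xi' theta' x|
    <= MG * dx + (2 * MG * MDH + 4 * r * LG) * dt}.
  apply: (aeS2 _ (ae_section hx) ht) => x hx1 ht1.
  exact: (B_field_Lipschitz _ mx mt mx' mt' dx0 hx1 ht1 ht).
split=> [|OM].
  case: (@Linfty_norm_leI _ _ _ _ g1 (B Omega xi theta - B Omega xi' theta')
    (c4 * (dx + dt))) => //.
    by apply: measurable_funB; exact: measurable_B_field.
  by apply: (aeS _ hB) => x h; exact: le_trans (c4_bound dx0 dt0).
have M0 : 0 <= M.
  by have [x] := ae_ex g1 OM; exact: le_trans.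
case: (@Linfty_norm_leI _ _ _ _ g2 (DhB Omega xi theta - DhB Omega xi' theta')
    (c3 * (dx + dt))) => //.
  by apply: measurable_funB; exact: measurable_DhB.
have h : {ae mu, forall x, [/\ `|Omega x| <= M, `|theta x - theta' x| <= dt &
    `|B Omega xi theta x - B Omega xi' theta' x|
    <= MG * dx + (2 * MG * MDH + 4 * r * LG) * dt]}.
  by apply: (aeS3 _ OM ht hB) => x.
apply: aeS2 (ae_prod1 h) (ae_prod2 h) => p [w1 t1 b1] [w2 t2 b2].
apply: le_trans (c3_bound M0 dx0 dt0).
by apply: Dh0_Lipschitz => //; exact: B_field_le.
Qed.

End model_bounds.

(** * Geometric convergence and scalar time integrals *)

Section geometric.
Context (R : realType).
Implicit Types (u : nat -> R) (x y l A q K : R).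

Lemma geometric_small q K e : 0 <= q < 1 -> 0 < e ->
  exists n, K * q ^+ n <= e.
Proof.
move=> /andP[q0 q1] e0.
have : (fun n => K * q ^+ n) @ \oo --> (K * 0 : R).
  by apply: cvgM; [exact: cvg_cst|apply: cvg_expr; rewrite ger0_norm].
rewrite mulr0 => /cvgrPdist_le/(_ _ e0)[n _ /(_ n (leqnn n))].
rewrite /= sub0r normrN => h; exists n; exact: le_trans (ler_norm _) h.
Qed.

Lemma ler_add_geometric q K x y : 0 <= q < 1 ->
  (forall n, x <= y + K * q ^+ n) -> x <= y.
Proof.
move=> q01 h; apply/ler_addgt0Pr => e e0.
by have [n Kn] := geometric_small K q01 e0; rewrite (le_trans (h n))// lerD2l.
Qed.

(** With c_n the tail of the geometric series, u_n - c_n increases and u_n + c_n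
    decreases, and both enclose the limit. *)
Lemma geometric_cauchy u A q : 0 <= q < 1 -> 0 <= A ->
  (forall n, `|u n.+1 - u n| <= A * q ^+ n) ->
  forall n, `|u n - lim (u @ \oo)| <= A / (1 - q) * q ^+ n.
Proof.
move=> q01 A0 hu; have /andP[q0 q1] := q01.
pose c n : R := A / (1 - q) * q ^+ n.
have q1' : 1 - q != 0 by rewrite subr_eq0 eq_sym lt_eqF.
have cE n : c n = A * q ^+ n + c n.+1 by rewrite /c exprS; field.
have c0 n : 0 <= c n by rewrite mulr_ge0 ?exprn_ge0// divr_ge0// subr_ge0 ltW.
pose v n := u n - c n; pose w n := u n + c n.
have vw n : v n <= w n by rewrite /v /w; have := c0 n; lra.
have v_inc : nondecreasing_seq v.
  apply/nondecreasing_seqP => n.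
  by have := hu n; rewrite /v (cE n) ler_norml; lra.
have w_dec : nonincreasing_seq w.
  apply/nonincreasing_seqP => n.
  by have := hu n; rewrite /w (cE n) ler_norml; lra.
have vwmn m n : v m <= w n.
  have [mn|/ltnW nm] := leqP m n.
    by rewrite (le_trans (v_inc _ _ mn)).
  by rewrite (le_trans (vw m))// w_dec.
have cv : cvgn v.
  apply: nondecreasing_is_cvgn => //.
  by exists (w 0%N) => _ [n _ <-].
have vl n : v n <= lim (v @ \oo) by exact: nondecreasing_cvgn_le.
have lw n : lim (v @ \oo) <= w n by apply: limr_le => //; apply: nearW => m.
have ul n : `|u n - lim (v @ \oo)| <= c n.
  by have := vl n; have := lw n; rewrite /v /w ler_norml; lra.
have -> : lim (u @ \oo) = lim (v @ \oo).
  apply/cvg_lim => //; apply/cvgrPdist_le => e e0.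
  have [n0 cn0] := geometric_small (A / (1 - q)) q01 e0.
  exists n0 => // n /= n0n; rewrite distrC (le_trans (ul n))// (le_trans _ cn0)//.
  apply: ler_wpM2l; first by rewrite divr_ge0// subr_ge0 ltW.
  by apply: ler_wiXn2l => //; exact: ltW.
exact: ul.
Qed.

Lemma geometric_cvg u l q K : 0 <= q < 1 ->
  (forall n, `|u n - l| <= K * q ^+ n) -> u @ \oo --> l.
Proof.
move=> q01 ul; have K0 : 0 <= K by have := ul 0%N; rewrite expr0 mulr1; exact: le_trans.
apply/cvgrPdist_le => e e0; have [n0 cn0] := geometric_small K q01 e0.
have /andP[q0 q1] := q01.
exists n0 => // n /= n0n; rewrite distrC (le_trans (ul n))// (le_trans _ cn0)//.
by apply: ler_wpM2l => //; apply: ler_wiXn2l => //; exact: ltW.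
Qed.

End geometric.

Section scalar_integrals.
Context (R : realType).
Local Notation leb := (@lebesgue_measure R).
Local Notation Ny t := (`]-oo, t]%classic : set (measurableTypeR R)).
Implicit Types (g : R -> R) (t s a e K : R).

Lemma expR_sub_le x y : x <= 0 -> y <= 0 -> `|expR x - expR y| <= `|x - y| :> R.
Proof.
have main u v : u <= v -> v <= 0 -> `|expR u - expR v| <= `|u - v| :> R.
  move=> uv v0; rewrite distrC [`|u - v|]distrC.
  rewrite ger0_norm ?subr_ge0 ?ler_expR// ger0_norm ?subr_ge0//.
  have -> : expR v - expR u = expR v * (1 - expR (u - v)).
    by rewrite mulrBr mulr1 -expRD [v + _]addrC subrK.
  have h1 : 1 - expR (u - v) <= v - u.
    by have := expR_ge1Dx (u - v); lra.
  have h2 : expR v <= 1 by rewrite -expR0 ler_expR.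
  have h3 : 0 <= 1 - expR (u - v).
    by rewrite subr_ge0 -expR0 ler_expR subr_le0.
  by rewrite (le_trans _ h1)// -[leRHS]mul1r ler_wpM2r.
move=> x0 y0; have [xy|/ltW yx] := leP x y; first exact: main.
by rewrite distrC [`|x - y|]distrC; exact: main.
Qed.

(** The history integral of a bounded scalar function, as it occurs in the graph
    component of the Lyapunov-Perron system. *)
Definition history e g t : R := \int[leb]_(s in `]-oo, t]) (expR (- (t - s) / e) * g s).

Lemma historyE e t s : expR (- (t - s) / e) = expR (- t / e) * expR (e^-1 * s) :> R.
Proof. by rewrite -expRD; congr expR; ring. Qed.

Lemma measurable_history e g t : measurable_fun (Ny t) g ->
  measurable_fun (Ny t) (fun s => expR (- (t - s) / e) * g s).
Proof.
move=> mg; apply: measurable_funM => //.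
apply: (@eq_measurable_fun _ _ _ _ _ (fun s => expR (- t / e) * expR (e^-1 * s))).
  by move=> s _; rewrite historyE.
by apply: measurable_funM => //; exact: measurable_expRM.
Qed.

Lemma integral_history_weight e t K a : 0 < e -> 0 < 1 + e * a -> 0 <= K ->
  (\int[leb]_(s in Ny t) (expR (- (t - s) / e) * (K * expR (a * s)))%:E
    = (K * (e / (1 + e * a)) * expR (a * t))%:E)%E.
Proof.
move=> e0 ea0 K0.
have ea : 0 < e^-1 + a by rewrite -(pmulr_rgt0 _ e0) mulrDr divff// gt_eqF.
transitivity (\int[leb]_(s in Ny t)
    ((K * expR (- t / e))%:E * (expR ((e^-1 + a) * s))%:E))%E.
  apply: eq_integral => s _; rewrite -EFinM; congr EFin.
  by rewrite historyE mulrDl expRD; ring.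
rewrite ge0_integralZl_EFin//.
- rewrite integral_expR_Nyitv// -EFinM; congr EFin; rewrite mulrDl expRD.
  have -> : expR (e^-1 * t) = (expR (- t / e))^-1.
    by rewrite -expRN; congr expR; rewrite mulNr opprK mulrC.
  have := lt0r_neq0 (expR_gt0 (- t / e)); move: (expR (- t / e)) => E E0.
  by field; rewrite E0 !gt_eqF.
- by apply/measurable_EFinP; exact: measurable_expRM.
- by rewrite mulr_ge0// expR_ge0.
Qed.

Lemma integral_back_weight t K a : a < 0 -> 0 <= K ->
  (\int[leb]_(s in `[t, 0%R]) (K * expR (a * s))%:E
    <= (K / `|a| * expR (a * t))%:E)%E.
Proof.
move=> a0 K0; under eq_integral do rewrite EFinM.
rewrite ge0_integralZl_EFin//.
- rewrite -mulrA EFinM; apply: lee_wpmul2l; first by rewrite lee_fin.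
  have := @integral_expR_itv_le R (- a) t; rewrite opprK oppr_gt0 => /(_ a0).
  by rewrite ltr0_norm// [in X in _ -> X]mulrC.
- by apply/measurable_EFinP; exact: measurable_expRM.
Qed.

(** The exponential rate a is zero for bounded functions, the weight eta of the
    solution space for the contraction estimate, and - 1 / (2 e) for functions of
    linear growth. *)
Lemma history_le e g t K a : 0 < e -> 0 < 1 + e * a -> 0 <= K ->
  measurable_fun (Ny t) g -> (forall s, s <= t -> `|g s| <= K * expR (a * s)) ->
  leb.-integrable (Ny t) (EFin \o (fun s => expR (- (t - s) / e) * g s)) /\
  `|history e g t| <= K * (e / (1 + e * a)) * expR (a * t).
Proof.
move=> e0 ea0 K0 mg gK.
apply: (@Rintegral_normr_le _ _ _ leb _ _ _
   (fun s => expR (- (t - s) / e) * (K * expR (a * s)))).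
- exact: measurable_itv.
- exact: measurable_history.
- apply: measurable_history; apply: measurable_funM => //; exact: measurable_expRM.
- apply: nearW => s; rewrite /= in_itv/= => st.
  by rewrite normrM gtr0_norm ?expR_gt0// ler_wpM2l ?gK// expR_ge0.
- by move=> s _; rewrite !mulr_ge0// expR_ge0.
- by rewrite integral_history_weight.
Qed.

Lemma history_bounded e g t K : 0 < e -> 0 <= K ->
  measurable_fun (Ny t) g -> (forall s, s <= t -> `|g s| <= K) ->
  leb.-integrable (Ny t) (EFin \o (fun s => expR (- (t - s) / e) * g s)) /\
  `|history e g t| <= K * e.
Proof.
move=> e0 K0 mg gK; have [] := @history_le e g t K 0 e0 _ K0 mg.
- by rewrite mulr0 addr0.
- by move=> s st; rewrite mul0r expR0 mulr1 gK.
- by rewrite mul0r expR0 mulr0 addr0 divr1 mulr1.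
Qed.

Lemma measurable_Ny t : measurable (Ny t). Proof. exact: measurable_itv. Qed.

Lemma measurable_funNy t g : t <= 0 -> measurable_fun (Ny 0) g -> measurable_fun (Ny t) g.
Proof.
move=> t0; apply: measurable_funS; first exact: measurable_itv.
by apply: subset_itvl; rewrite bnd_simp.
Qed.

Lemma historyB e g g' t :
  leb.-integrable (Ny t) (EFin \o (fun s => expR (- (t - s) / e) * g s)) ->
  leb.-integrable (Ny t) (EFin \o (fun s => expR (- (t - s) / e) * g' s)) ->
  history e g t - history e g' t = history e (fun s => g s - g' s) t.
Proof.
move=> i i'; rewrite /history -RintegralB//.
by apply: eq_Rintegral => s _; rewrite mulrBr.
Qed.

(** For t' < t the integral up to t is that up to t', damped by a factor that
    differs from 1 by at most (t - t') / e, plus an integral of length t - t'; each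
    of the two changes contributes K (t - t'). *)
Lemma history_Lipschitz e g K : 0 < e -> 0 <= K ->
  measurable_fun (Ny 0) g -> (forall s, s <= 0 -> `|g s| <= K) ->
  forall t t', t <= 0 -> t' <= 0 ->
  `|history e g t - history e g t'| <= 2 * K * `|t - t'|.
Proof.
move=> e0 K0 mg gK.
have main t t' : t' <= t -> t <= 0 -> `|history e g t - history e g t'| <= 2 * K * `|t - t'|.
  move=> t't t0; have t'0 := le_trans t't t0.
  have gKt u : u <= 0 -> forall s, s <= u -> `|g s| <= K.
    by move=> u0 s su; apply: gK; exact: le_trans u0.
  have [it _] := history_bounded e0 K0 (measurable_funNy t0 mg) (gKt _ t0).
  have [it' bt'] := history_bounded e0 K0 (measurable_funNy t'0 mg) (gKt _ t'0).
  have := @Rintegral_itvB R (fun s => expR (- (t - s) / e) * g s) -oo%O (BRight t) t' it.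
  rewrite !bnd_simp => /(_ isT t't) hB.
  have E1 : \int[leb]_(s in `]-oo, t']) (expR (- (t - s) / e) * g s)
      = expR (- (t - t') / e) * history e g t'.
    rewrite /history -RintegralZl//.
    apply: eq_Rintegral => s _; rewrite mulrA -expRD; congr (expR _ * _).
    by rewrite -mulrDl; congr (_ * _); ring.
  have [_ E2] : leb.-integrable `]t', t]%classic (EFin \o (fun s => expR (- (t - s) / e) * g s)) /\
      `|\int[leb]_(s in `]t', t]) (expR (- (t - s) / e) * g s)| <= K * (t - t').
    apply: (@Rintegral_normr_le _ _ _ leb _ _ _ (fun=> K)) => //.
    - apply: measurable_funS (measurable_history e (measurable_funNy t0 mg)).
        exact: measurable_itv.
      by apply: subset_itvr; rewrite bnd_simp.
    - apply: nearW => s; rewrite /= in_itv/= => /andP[_ st].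
      rewrite normrM gtr0_norm ?expR_gt0// -[leRHS]mul1r ler_pM ?expR_ge0//.
        rewrite -expR0 ler_expR mulNr oppr_le0 divr_ge0// ?subr_ge0//; exact: ltW.
      exact: gKt t0 _ st.
    - rewrite integral_cst; last exact: measurable_itv.
      rewrite [X in (_ * X <= _)%E](_ : _ = (t - t')%:E) ?EFinM//.
      rewrite [LHS]lebesgue_measure_itv/= lte_fin.
      case: ltP => // tt'.
      by have -> : t = t' by [apply/le_anti; rewrite tt' t't]; rewrite subrr.
  have h1 : history e g t - history e g t' =
      (expR (- (t - t') / e) - 1) * history e g t'
      + \int[leb]_(s in `]t', t]) (expR (- (t - s) / e) * g s).
    rewrite -hB E1 -/(history e g t).
    by move: (history e g t) (history e g t') (expR _) => x y z; ring.
  rewrite h1 (le_trans (ler_normD _ _))// [`|t - t'|]ger0_norm ?subr_ge0//.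
  rewrite -mulrA mulr_natl mulr2n lerD// normrM.
  have h2 : `|expR (- (t - t') / e) - 1| <= (t - t') / e.
    rewrite -{1}expR0 (le_trans (expR_sub_le _ _))//.
      by rewrite mulNr oppr_le0 divr_ge0// ?subr_ge0// ltW.
    by rewrite subr0 mulNr normrN ger0_norm// divr_ge0// ?subr_ge0// ltW.
  rewrite (le_trans (ler_pM _ _ h2 bt'))//.
  by rewrite le_eqVlt; apply/orP; left; apply/eqP; field; rewrite gt_eqF.
move=> t t' t0 t'0; have [tt'|/ltW t't] := leP t t'; last exact: main.
by rewrite distrC [`|t - t'|]distrC; exact: main.
Qed.

Definition back_integral g t : R := \int[leb]_(s in `[t, 0]) g s.

Lemma measurable_fun_back t g : measurable_fun (Ny 0) g ->
  measurable_fun `[t, 0]%classic g.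
Proof.
apply: measurable_funS; first exact: measurable_itv.
by apply: subset_itvr; rewrite bnd_simp.
Qed.

Lemma back_integral_le g t K a : a < 0 -> 0 <= K ->
  measurable_fun (Ny 0) g -> (forall s, s <= 0 -> `|g s| <= K * expR (a * s)) ->
  leb.-integrable `[t, 0]%classic (EFin \o g) /\
  `|back_integral g t| <= K / `|a| * expR (a * t).
Proof.
move=> a0 K0 mg gK.
apply: (@Rintegral_normr_le _ _ _ leb _ _ _ (fun s => K * expR (a * s))).
- exact: measurable_itv.
- exact: measurable_fun_back.
- by apply: measurable_funM => //; exact: measurable_expRM.
- by apply: nearW => s; rewrite /= in_itv/= => /andP[_ s0]; exact: gK.
- by move=> s _; rewrite mulr_ge0// expR_ge0.
- exact: integral_back_weight.
Qed.

Lemma back_integrable g t K : measurable_fun (Ny 0) g ->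
  (forall s, s <= 0 -> `|g s| <= K) ->
  leb.-integrable `[t, 0]%classic (EFin \o g).
Proof.
move=> mg gK.
have K0 : 0 <= K by exact: le_trans (gK 0 (lexx _)).
have [||//] := @back_integral_le g t K (-1) _ K0 mg; first by rewrite ltrN10.
move=> s s0; rewrite (le_trans (gK s s0))// -[leLHS]mulr1 ler_wpM2l//.
by rewrite -[leLHS]expR0 ler_expR mulN1r oppr_ge0.
Qed.

Lemma back_integral_Lipschitz g K : measurable_fun (Ny 0) g ->
  (forall s, s <= 0 -> `|g s| <= K) ->
  forall t t', t <= 0 -> t' <= 0 ->
  `|back_integral g t - back_integral g t'| <= K * `|t - t'|.
Proof.
move=> mg gK.
have K0 : 0 <= K by exact: le_trans (gK 0 (lexx _)).
have main t t' : t <= t' -> t' <= 0 ->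
    `|back_integral g t - back_integral g t'| <= K * `|t - t'|.
  move=> tt' t'0; have t0 := le_trans tt' t'0.
  have it := back_integrable t mg gK; have it' := back_integrable t' mg gK.
  have := @Rintegral_itvB R g (BLeft t) (BRight 0) t' it.
  rewrite !bnd_simp => /(_ tt' t'0) hB.
  have E : \int[leb]_(s in `]t', 0]) g s = back_integral g t'.
    apply: Rintegral_itv_obnd_cbnd; apply: integrableS it'.
    - exact: measurable_itv.
    - exact: measurable_itv.
    - by apply: subset_itvr; rewrite bnd_simp.
  have -> : back_integral g t - back_integral g t' = \int[leb]_(s in `[t, t']) g s.
    by rewrite -E -hB /back_integral; ring.
  have [] // := @Rintegral_normr_le _ _ _ leb `[t, t']%classic _ g (fun=> K) (K * `|t - t'|).
  - apply: measurable_funS mg; first exact: measurable_itv.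
    by move=> s; rewrite /= !in_itv/= => /andP[_ st']; exact: le_trans t'0.
  - apply: nearW => s; rewrite /= in_itv/= => /andP[_ st']; apply: gK.
    exact: le_trans t'0.
  - rewrite integral_cst; last exact: measurable_itv.
    rewrite [X in (_ * X <= _)%E](_ : _ = (`|t - t'|)%:E) ?EFinM//.
    rewrite [LHS]lebesgue_measure_itv/= lte_fin distrC ger0_norm ?subr_ge0//.
    case: ltP => // t't.
    by have -> : t = t' by [apply/le_anti; rewrite tt' t't]; rewrite subrr.
move=> t t' t0 t'0; have [tt'|/ltW t't] := leP t t'; first exact: main.
by rewrite distrC [`|t - t'|]distrC; exact: main.
Qed.

Lemma back_integralB g g' t :
  leb.-integrable `[t, 0]%classic (EFin \o g) ->
  leb.-integrable `[t, 0]%classic (EFin \o g') ->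
  back_integral g t - back_integral g' t = back_integral (fun s => g s - g' s) t.
Proof. by move=> i i'; rewrite /back_integral -RintegralB. Qed.

Lemma back_integral0 g : back_integral g 0 = 0.
Proof. by rewrite /back_integral set_itv1 Rintegral_set1. Qed.

End scalar_integrals.

(** * Pointwise solutions of the Lyapunov-Perron system *)

Section Lyapunov_Perron.
Context (R : realType).
Variables (Gamma : R -> R) (H : R -> R -> R) (chi : R -> R) (r M eta eps : R).
Variables (Omega theta0 : R -> R).
Hypothesis mdl : smooth_model Gamma H chi r.
Hypothesis eps_gt0 : 0 < eps.
Hypothesis measurable_Omega : measurable_fun setT Omega.
Hypothesis Omega_le : forall x, `|Omega x| <= M.
Hypothesis measurable_theta0 : measurable_fun setT theta0.

Local Notation leb := (@lebesgue_measure R).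
Local Notation mu := (unit_lebesgue R).
Local Notation mu2 := (unit_lebesgue2 R).
Local Notation MG := (sup_norm Gamma).
Local Notation LG := (sup_norm (derive1 Gamma)).
Local Notation MDH := (M_DH H).
Local Notation MD2H := (M_D2H H).
Local Notation c1 := (C1 r MG MDH M).
Local Notation c2 := (C2 r MG M).
Local Notation c3 := (C3 r MG LG MDH MD2H M).
Local Notation c4 := (C4 r MG LG MDH).
Local Notation B := (B_field Gamma H chi r Omega).
Local Notation DhB xi theta := (Dh0 H theta (B xi theta)).
Local Notation Ny t := (`]-oo, t]%classic : set (measurableTypeR R)).
Implicit Types (xi : R -> R * R -> R) (theta : R -> R -> R).

Let M_ge0 : 0 <= M. Proof. exact: le_trans (Omega_le 0). Qed.
Let c1_pos : 0 <= c1. Proof. exact: (c1_ge0 mdl M_ge0). Qed.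
Let c2_pos : 0 <= c2. Proof. exact: (c2_ge0 mdl M_ge0). Qed.
Let c3_pos : 0 <= c3. Proof. exact: (c3_ge0 mdl M_ge0). Qed.
Let c4_pos : 0 <= c4. Proof. exact: (c4_ge0 mdl). Qed.

(** The Lyapunov-Perron system is solved for true functions of x and y.  The
    curves are kept Lipschitz in time, uniformly in space, with the constants that
    every image of the Lyapunov-Perron operator has; measurability in space at
    each time is then enough for all the time integrals. *)
Record regular xi theta : Prop := Regular {
  regular_mxi : forall t, t <= 0 -> measurable_fun setT (xi t);
  regular_mtheta : forall t, t <= 0 -> measurable_fun setT (theta t);
  regular_Lxi : forall t t' p, t <= 0 -> t' <= 0 ->
    `|xi t p - xi t' p| <= 2 * c1 * `|t - t'|;
  regular_Ltheta : forall t t' x, t <= 0 -> t' <= 0 ->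
    `|theta t x - theta t' x| <= c2 * `|t - t'| }.

Let normrNN (a b : R) : `|- a - - b| = `|a - b|.
Proof. by rewrite -normrN opprB opprK addrC. Qed.

Let normrBB (a b c : R) : `|(c - a) - (c - b)| = `|a - b|.
Proof. by rewrite -normrN; congr `|_|; ring. Qed.

Definition LP_xi xi theta (t : R) (p : R * R) : R :=
  - history eps (fun s => DhB (xi s) (theta s) p) t.

Definition LP_theta xi theta (t x : R) : R :=
  theta0 x - back_integral (fun s => B (xi s) (theta s) x) t.

Section regular_state.
Variables (xi : R -> R * R -> R) (theta : R -> R -> R).
Hypothesis reg : regular xi theta.

Lemma regular_B_le s x : s <= 0 -> `|B (xi s) (theta s) x| <= c2.
Proof.
move=> s0; exact: (B_field_le mdl (regular_mxi reg s0) (regular_mtheta reg s0)).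
Qed.

Lemma regular_DhB_le s p : s <= 0 -> `|DhB (xi s) (theta s) p| <= c1.
Proof.
move=> s0; exact: (DhB_le mdl (regular_mxi reg s0) (regular_mtheta reg s0)).
Qed.

Lemma regular_B_Lipschitz s s' x : s <= 0 -> s' <= 0 ->
  `|B (xi s) (theta s) x - B (xi s') (theta s') x|
    <= c4 * (2 * c1 + c2) * `|s - s'|.
Proof.
move=> s0 s'0; rewrite -mulrA [(2 * c1 + c2) * _]mulrDl.
apply: (B_field_sup_Lipschitz mdl).
- exact: regular_mxi reg _ s0.
- exact: regular_mtheta reg _ s0.
- exact: regular_mxi reg _ s'0.
- exact: regular_mtheta reg _ s'0.
- by move=> p; exact: (regular_Lxi reg).
- by move=> y; exact: (regular_Ltheta reg).
Qed.

Lemma regular_DhB_Lipschitz s s' p : s <= 0 -> s' <= 0 ->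
  `|DhB (xi s) (theta s) p - DhB (xi s') (theta s') p|
    <= c3 * (2 * c1 + c2) * `|s - s'|.
Proof.
move=> s0 s'0; rewrite -mulrA [(2 * c1 + c2) * _]mulrDl.
apply: (DhB_sup_Lipschitz mdl Omega_le).
- exact: regular_mxi reg _ s0.
- exact: regular_mtheta reg _ s0.
- exact: regular_mxi reg _ s'0.
- exact: regular_mtheta reg _ s'0.
- by move=> q; exact: (regular_Lxi reg).
- by move=> y; exact: (regular_Ltheta reg).
Qed.

Lemma measurable_time_DhB p : measurable_fun (Ny 0) (fun s => DhB (xi s) (theta s) p).
Proof.
apply: (@Lipschitz_measurable _ _ _ (c3 * (2 * c1 + c2))); first exact: measurable_itv.
by move=> s s'; rewrite /= !in_itv/= => s0 s'0; exact: regular_DhB_Lipschitz.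
Qed.

Lemma measurable_time_B x : measurable_fun (Ny 0) (fun s => B (xi s) (theta s) x).
Proof.
apply: (@Lipschitz_measurable _ _ _ (c4 * (2 * c1 + c2))); first exact: measurable_itv.
by move=> s s'; rewrite /= !in_itv/= => s0 s'0; exact: regular_B_Lipschitz.
Qed.

Lemma LP_xi_le t p : t <= 0 -> `|LP_xi xi theta t p| <= c1 * eps.
Proof.
move=> t0; rewrite /LP_xi normrN; apply: (history_bounded eps_gt0 c1_pos _ _).2.
- exact: measurable_funNy t0 (measurable_time_DhB p).
- by move=> s st; apply: regular_DhB_le; exact: le_trans t0.
Qed.

Lemma LP_xi_Bochner t : t <= 0 ->
  is_Bochner_integral mu2 (Ny t)
    (fun s => expR (- (t - s) / eps) *: DhB (xi s) (theta s))
    (fun p => - LP_xi xi theta t p).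
Proof.
move=> t0.
have -> : (fun p => - LP_xi xi theta t p) = (fun p => \int[leb]_(s in Ny t)
    (expR (- (t - s) / eps) *: DhB (xi s) (theta s)) p).
  by apply/funext => p; rewrite /LP_xi opprK.
have st0 s : Ny t s -> s <= 0 by rewrite /= in_itv/= => /le_trans; apply.
have neg s : Ny t s -> - (t - s) / eps <= 0.
  by rewrite /= in_itv/= => st; rewrite mulNr oppr_le0 divr_ge0 ?subr_ge0// ltW.
apply: (@Lipschitz_Bochner_integral _ _ _ _ (@unit_lebesgue2_gt0 R) (Ny t) _
  (c1 / eps + c3 * (2 * c1 + c2)) (c1 * expR (- t / eps)) eps^-1 t).
- exact: measurable_itv.
- by rewrite /= in_itv/=.
- by apply: subset_itvl; rewrite bnd_simp.
- apply: addr_ge0; first exact: divr_ge0 c1_pos (ltW eps_gt0).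
  by rewrite mulr_ge0// addr_ge0// mulr_ge0.
- by rewrite mulr_ge0// expR_ge0.
- by rewrite invr_gt0.
- move=> s Ds; apply: measurable_funM => //.
  by apply: (measurable_DhB mdl) => //;
    [exact: (regular_mxi reg (st0 _ Ds))|exact: (regular_mtheta reg (st0 _ Ds))].
- move=> s s' p Ds Ds'.
  have h1 : `|expR (- (t - s) / eps) - expR (- (t - s') / eps)| <= `|s - s'| / eps.
    rewrite (le_trans (expR_sub_le (neg _ Ds) (neg _ Ds')))// -mulrBl normrM.
    rewrite [`|eps^-1|]gtr0_norm ?invr_gt0//.
    by rewrite (_ : - (t - s) - - (t - s') = s - s')//; ring.
  have h2 : `|expR (- (t - s') / eps)| <= 1.
    by rewrite gtr0_norm ?expR_gt0// -[leRHS]expR0 ler_expR neg.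
  have h3 := regular_DhB_Lipschitz p (st0 _ Ds) (st0 _ Ds').
  rewrite (le_trans (ler_normM_sub h1 (regular_DhB_le p (st0 _ Ds)) h2 h3))//.
  by rewrite le_eqVlt; apply/orP; left; apply/eqP; ring.
- move=> s p Ds; rewrite /GRing.scale/= normrM gtr0_norm ?expR_gt0// historyE.
  rewrite [leRHS](_ : _ = expR (- t / eps) * expR (eps^-1 * s) * c1); last by ring.
  by rewrite ler_wpM2l ?regular_DhB_le ?st0// mulr_ge0// expR_ge0.
Qed.

Lemma LP_theta_Bochner t : t <= 0 ->
  is_Bochner_integral mu `[t, 0]%classic (fun s => B (xi s) (theta s))
    (fun x => theta0 x - LP_theta xi theta t x).
Proof.
move=> t0.
have -> : (fun x => theta0 x - LP_theta xi theta t x) =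
    (fun x => \int[leb]_(s in `[t, 0]) B (xi s) (theta s) x).
  by apply/funext => x; rewrite /LP_theta subKr.
have st0 s : `[t, 0]%classic s -> s <= 0 by rewrite /= in_itv/= => /andP[].
apply: (@Lipschitz_Bochner_integral _ _ _ _ (@unit_lebesgue_gt0 R) `[t, 0]%classic _
  (c4 * (2 * c1 + c2)) (c2 * expR (- t)) 1 t).
- exact: measurable_itv.
- by rewrite /= in_itv/= lexx.
- by apply: subset_itvr; rewrite bnd_simp.
- by rewrite mulr_ge0// addr_ge0// mulr_ge0.
- by rewrite mulr_ge0// expR_ge0.
- by [].
- move=> s Ds; apply: (measurable_B_field mdl) => //;
    [exact: (regular_mxi reg (st0 _ Ds))|exact: (regular_mtheta reg (st0 _ Ds))].
- by move=> s s' x Ds Ds'; apply: regular_B_Lipschitz; exact: st0.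
- move=> s x Ds; rewrite (le_trans (regular_B_le _ (st0 _ Ds)))//.
  rewrite -[leLHS]mulr1 -mulrA ler_wpM2l// mul1r -expRD -[leLHS]expR0 ler_expR.
  by move: Ds; rewrite /= in_itv/= => /andP[ts _]; rewrite addrC subr_ge0.
Qed.

Lemma regular_LP : regular (LP_xi xi theta) (LP_theta xi theta).
Proof.
split.
- move=> t t0; have [_ /Linfty_measurable h _] := LP_xi_Bochner t0.
  have -> : LP_xi xi theta t = \- (fun p => - LP_xi xi theta t p).
    by apply/funext => p /=; rewrite opprK.
  exact: measurable_funN.
- move=> t t0; have [_ /Linfty_measurable h _] := LP_theta_Bochner t0.
  have -> : LP_theta xi theta t = theta0 \- (fun x => theta0 x - LP_theta xi theta t x).
    by apply/funext => x /=; rewrite subKr.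
  exact: measurable_funB.
- move=> t t' p t0 t'0; rewrite /LP_xi normrNN.
  apply: history_Lipschitz => //; first exact: measurable_time_DhB.
  by move=> s; exact: regular_DhB_le.
- move=> t t' x t0 t'0; rewrite /LP_theta normrBB.
  apply: back_integral_Lipschitz => //; first exact: measurable_time_B.
  by move=> s; exact: regular_B_le.
Qed.

Lemma LP_theta0 x : LP_theta xi theta 0 x = theta0 x.
Proof. by rewrite /LP_theta back_integral0 subr0. Qed.

End regular_state.

Hypothesis eta_lt0 : eta < 0.
Hypothesis eps_eta : 0 < 1 + eps * eta.
Local Notation qx := (c3 * (eps / (1 + eps * eta))).
Local Notation qt := (c4 / `|eta|).
Hypothesis q_lt1 : qx + qt < 1.

Lemma qx_ge0 : 0 <= qx.
Proof. by rewrite mulr_ge0// divr_ge0 ?ltW. Qed.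

Lemma qt_ge0 : 0 <= qt.
Proof. by rewrite divr_ge0. Qed.

Lemma q01 : 0 <= qx + qt < 1.
Proof. by rewrite q_lt1 andbT addr_ge0 ?qx_ge0 ?qt_ge0. Qed.

Lemma expR_eta_ge1 t : t <= 0 -> 1 <= expR (eta * t).
Proof. by move=> t0; rewrite -[leLHS]expR0 ler_expR mulr_le0// ltW. Qed.

(** The two factors are the integrals of the weight exp(eta s) against the kernels
    of the two equations, relative to exp(eta t), times the Lipschitz constants C3
    and C4 of the integrands. *)
Lemma LP_contraction xi theta xi' theta' a b :
  regular xi theta -> regular xi' theta' ->
  (forall t p, t <= 0 -> `|xi t p - xi' t p| <= a * expR (eta * t)) ->
  (forall t x, t <= 0 -> `|theta t x - theta' t x| <= b * expR (eta * t)) ->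
  (forall t p, t <= 0 -> `|LP_xi xi theta t p - LP_xi xi' theta' t p|
     <= qx * (a + b) * expR (eta * t)) /\
  (forall t x, t <= 0 -> `|LP_theta xi theta t x - LP_theta xi' theta' t x|
     <= qt * (a + b) * expR (eta * t)).
Proof.
move=> reg reg' ha hb.
have a0 : 0 <= a.
  by have := ha 0 (0, 0) (lexx _); rewrite mulr0 expR0 mulr1; exact: le_trans.
have b0 : 0 <= b.
  by have := hb 0 0 (lexx _); rewrite mulr0 expR0 mulr1; exact: le_trans.
split=> t p t0.
- rewrite /LP_xi normrNN.
  have m := measurable_funNy t0 (measurable_time_DhB reg p).
  have m' := measurable_funNy t0 (measurable_time_DhB reg' p).
  have [i _] := history_bounded eps_gt0 c1_pos m
    (fun s st => regular_DhB_le reg p (le_trans st t0)).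
  have [i' _] := history_bounded eps_gt0 c1_pos m'
    (fun s st => regular_DhB_le reg' p (le_trans st t0)).
  rewrite historyB//.
  rewrite [X in X * expR _](_ : _ = c3 * (a + b) * (eps / (1 + eps * eta))); last by ring.
  apply: (history_le eps_gt0 eps_eta _ _ _).2.
  + by rewrite mulr_ge0// addr_ge0.
  + exact: measurable_funB.
  + move=> s st; have s0 := le_trans st t0; rewrite -mulrA [(a + b) * _]mulrDl.
    apply: (DhB_sup_Lipschitz mdl Omega_le).
    * exact: regular_mxi reg _ s0.
    * exact: regular_mtheta reg _ s0.
    * exact: regular_mxi reg' _ s0.
    * exact: regular_mtheta reg' _ s0.
    * by move=> q; exact: ha.
    * by move=> y; exact: hb.
- rewrite /LP_theta normrBB.
  have m := measurable_time_B reg p; have m' := measurable_time_B reg' p.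
  have i := back_integrable t m (fun s => @regular_B_le _ _ reg s p).
  have i' := back_integrable t m' (fun s => @regular_B_le _ _ reg' s p).
  rewrite back_integralB//.
  rewrite [X in X * expR _](_ : _ = c4 * (a + b) / `|eta|); last by ring.
  apply: (back_integral_le _ eta_lt0 _ _ _).2.
  + by rewrite mulr_ge0// addr_ge0.
  + exact: measurable_funB.
  + move=> s s0; rewrite -mulrA [(a + b) * _]mulrDl.
    apply: (B_field_sup_Lipschitz mdl).
    * exact: regular_mxi reg _ s0.
    * exact: regular_mtheta reg _ s0.
    * exact: regular_mxi reg' _ s0.
    * exact: regular_mtheta reg' _ s0.
    * by move=> q; exact: ha.
    * by move=> y; exact: hb.
Qed.

Definition pointwise_solution xi theta : Prop :=
  regular xi theta /\ forall t, t <= 0 ->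
    (forall p, xi t p = LP_xi xi theta t p) /\
    (forall x, theta t x = LP_theta xi theta t x).

Fixpoint picard n : (R -> R * R -> R) * (R -> R -> R) :=
  if n is n'.+1 then
    (LP_xi (picard n').1 (picard n').2, LP_theta (picard n').1 (picard n').2)
  else (fun=> fun=> 0, fun=> theta0).

Lemma regular_picard n : regular (picard n).1 (picard n).2.
Proof.
elim: n => [|n IHn]; last exact: (regular_LP IHn).
split=> /=.
- by move=> t _; exact: measurable_cst.
- by move=> t _.
- by move=> t t' p _ _; rewrite subrr normr0 mulr_ge0// mulr_ge0.
- by move=> t t' x _ _; rewrite subrr normr0 mulr_ge0.
Qed.

Local Notation D0 := (c1 * eps + c2 / `|eta|).

Lemma D0_ge0 : 0 <= D0.
Proof. by rewrite addr_ge0 ?divr_ge0// mulr_ge0// ltW. Qed.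

(** The two components are estimated separately because only the sum of the two
    contraction factors is known to be small. *)
Lemma picard_step n : exists a b, a + b = D0 * (qx + qt) ^+ n /\
  (forall t p, t <= 0 ->
     `|(picard n.+1).1 t p - (picard n).1 t p| <= a * expR (eta * t)) /\
  (forall t x, t <= 0 ->
     `|(picard n.+1).2 t x - (picard n).2 t x| <= b * expR (eta * t)).
Proof.
elim: n => [|n [a [b [ab [ha hb]]]]]; last first.
  exists (qx * (a + b)), (qt * (a + b)); split.
    by rewrite -mulrDl ab exprS; ring.
  exact: LP_contraction (regular_picard _) (regular_picard _) ha hb.
exists (c1 * eps), (c2 / `|eta|); split; first by rewrite expr0 mulr1.
split=> t p t0.
  rewrite /= subr0 (le_trans (LP_xi_le (regular_picard 0) p t0))//.
  by rewrite -[leLHS]mulr1 ler_wpM2l ?expR_eta_ge1// mulr_ge0// ltW.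
rewrite /= /LP_theta addrC addKr normrN.
apply: (back_integral_le _ eta_lt0 c2_pos _ _).2.
  exact: (measurable_time_B (regular_picard 0)).
move=> s s0; rewrite (le_trans (regular_B_le (regular_picard 0) p s0))//.
by rewrite -[leLHS]mulr1 ler_wpM2l// expR_eta_ge1.
Qed.

Lemma picard_step_xi n t p : t <= 0 ->
  `|(picard n.+1).1 t p - (picard n).1 t p| <= D0 * expR (eta * t) * (qx + qt) ^+ n.
Proof.
move=> t0; have [a [b [ab [ha hb]]]] := picard_step n.
rewrite (le_trans (ha _ p t0))// mulrAC -ab ler_wpM2r ?expR_ge0// lerDl.
by have := hb 0 0 (lexx _); rewrite mulr0 expR0 mulr1; exact: le_trans.
Qed.

Lemma picard_step_theta n t x : t <= 0 ->
  `|(picard n.+1).2 t x - (picard n).2 t x| <= D0 * expR (eta * t) * (qx + qt) ^+ n.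
Proof.
move=> t0; have [a [b [ab [ha hb]]]] := picard_step n.
rewrite (le_trans (hb _ x t0))// mulrAC -ab ler_wpM2r ?expR_ge0// lerDr.
by have := ha 0 (0, 0) (lexx _); rewrite mulr0 expR0 mulr1; exact: le_trans.
Qed.

Definition xi_sol t p : R := lim ((picard n).1 t p @[n --> \oo]).
Definition theta_sol t x : R := lim ((picard n).2 t x @[n --> \oo]).

Local Notation D1 := (D0 / (1 - (qx + qt))).

Lemma picard_xi n t p : t <= 0 ->
  `|(picard n).1 t p - xi_sol t p| <= D1 * (qx + qt) ^+ n * expR (eta * t).
Proof.
move=> t0.
rewrite [leRHS](_ : _ = D0 * expR (eta * t) / (1 - (qx + qt)) * (qx + qt) ^+ n);
  last by ring.
apply: (geometric_cauchy (u := fun n => (picard n).1 t p) q01).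
- by rewrite mulr_ge0 ?D0_ge0// expR_ge0.
- by move=> m; exact: picard_step_xi.
Qed.

Lemma picard_theta n t x : t <= 0 ->
  `|(picard n).2 t x - theta_sol t x| <= D1 * (qx + qt) ^+ n * expR (eta * t).
Proof.
move=> t0.
rewrite [leRHS](_ : _ = D0 * expR (eta * t) / (1 - (qx + qt)) * (qx + qt) ^+ n);
  last by ring.
apply: (geometric_cauchy (u := fun n => (picard n).2 t x) q01).
- by rewrite mulr_ge0 ?D0_ge0// expR_ge0.
- by move=> m; exact: picard_step_theta.
Qed.

Lemma regular_sol : regular xi_sol theta_sol.
Proof.
have swap a b c : a * b * c = a * c * b :> R by ring.
have lim_Lipschitz (u : nat -> R -> R) (l : R -> R) L t t' :
    (forall n, `|u n t - l t| <= D1 * (qx + qt) ^+ n * expR (eta * t)) ->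
    (forall n, `|u n t' - l t'| <= D1 * (qx + qt) ^+ n * expR (eta * t')) ->
    (forall n, `|u n t - u n t'| <= L) -> `|l t - l t'| <= L.
  move=> ut ut' uu; apply: (ler_add_geometric (K := D1 * expR (eta * t) + D1 * expR (eta * t')) q01).
  move=> n; have h1 := ut n; have h2 := ut' n; have h3 := uu n.
  rewrite (_ : l t - l t' = (u n t - u n t') - (u n t - l t) + (u n t' - l t')); last by ring.
  rewrite (le_trans (ler_normD _ _))// mulrDl addrA swap [D1 * expR (eta * t') * _]swap.
  by rewrite lerD// (le_trans (ler_normB _ _))// lerD.
split.
- move=> t t0; apply: (@measurable_fun_cvg _ _ _ setT (fun n => (picard n).1 t)).
    by move=> n; exact: (regular_mxi (regular_picard n)).
  move=> p _; apply: (geometric_cvg (K := D1 * expR (eta * t)) q01) => n.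
  by rewrite swap; exact: picard_xi.
- move=> t t0; apply: (@measurable_fun_cvg _ _ _ setT (fun n => (picard n).2 t)).
    by move=> n; exact: (regular_mtheta (regular_picard n)).
  move=> p _; apply: (geometric_cvg (K := D1 * expR (eta * t)) q01) => n.
  by rewrite swap; exact: picard_theta.
- move=> t t' p t0 t'0.
  apply: (lim_Lipschitz (fun n t => (picard n).1 t p) (xi_sol ^~ p)) => n.
  + exact: picard_xi.
  + exact: picard_xi.
  + exact: (regular_Lxi (regular_picard n)).
- move=> t t' x t0 t'0.
  apply: (lim_Lipschitz (fun n t => (picard n).2 t x) (theta_sol ^~ x)) => n.
  + exact: picard_theta.
  + exact: picard_theta.
  + exact: (regular_Ltheta (regular_picard n)).
Qed.

Theorem pointwise_solution_exists : pointwise_solution xi_sol theta_sol.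
Proof.
split; first exact: regular_sol.
have D1_ge0 : 0 <= D1 by rewrite divr_ge0 ?D0_ge0// subr_ge0 ltW.
have eq_lim (u : nat -> R) (l l' K K' : R) : (forall n, `|u n - l| <= K * (qx + qt) ^+ n) ->
    (forall n, `|u n.+1 - l'| <= K' * (qx + qt) ^+ n) -> l = l'.
  move=> h1 h2; apply/eqP; rewrite -subr_eq0 -normr_le0.
  apply: (ler_add_geometric (K := K * (qx + qt) + K') q01) => n.
  rewrite add0r mulrDl -mulrA -exprS.
  rewrite (_ : l - l' = (u n.+1 - l') - (u n.+1 - l)); last by ring.
  by rewrite (le_trans (ler_normB _ _))// addrC lerD.
have contr n := LP_contraction (regular_picard n) regular_sol
  (fun t p => @picard_xi n t p) (fun t x => @picard_theta n t x).
have swap a b c : a * b * c = a * c * b :> R by ring.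
move=> t t0; split=> p.
- apply: (eq_lim (fun n => (picard n).1 t p) _ _ (D1 * expR (eta * t))
     (qx * (D1 + D1) * expR (eta * t))) => n.
    by rewrite swap; exact: picard_xi.
  have [/(_ t p t0) h _] := contr n.
  by rewrite [leRHS](_ : _ = qx * (D1 * (qx + qt) ^+ n + D1 * (qx + qt) ^+ n) * expR (eta * t))//; ring.
- apply: (eq_lim (fun n => (picard n).2 t p) _ _ (D1 * expR (eta * t))
     (qt * (D1 + D1) * expR (eta * t))) => n.
    by rewrite swap; exact: picard_theta.
  have [_ /(_ t p t0) h] := contr n.
  by rewrite [leRHS](_ : _ = qt * (D1 * (qx + qt) ^+ n + D1 * (qx + qt) ^+ n) * expR (eta * t))//; ring.
Qed.

(** Points that carry the same data cannot be told apart by the iteration, so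
    that data constant on cells have a solution constant on cells. *)
Lemma sol_invariant x x' : theta0 x = theta0 x' -> Omega x = Omega x' ->
  forall t, [/\ theta_sol t x = theta_sol t x',
    forall y, xi_sol t (x, y) = xi_sol t (x', y) &
    forall y, xi_sol t (y, x) = xi_sol t (y, x')].
Proof.
move=> t0E OE.
have B_eq (xi : R * R -> R) (theta : R -> R) : theta x = theta x' -> (forall y, xi (x, y) = xi (x', y)) ->
    B xi theta x = B xi theta x'.
  move=> tE xE; rewrite /B_field OE; congr (_ + _); apply: eq_Rintegral => y _.
  by rewrite /h0 /= tE xE.
have LP_xi_eq (g g' : R -> R) t : (forall s, g s = g' s) ->
    - history eps g t = - history eps g' t by move=> /funext ->.
have LP_theta_eq (g g' : R -> R) t : (forall s, g s = g' s) ->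
    theta0 x' - back_integral g t = theta0 x' - back_integral g' t.
  by move=> /funext ->.
have pE n : forall t, [/\ (picard n).2 t x = (picard n).2 t x',
    forall y, (picard n).1 t (x, y) = (picard n).1 t (x', y) &
    forall y, (picard n).1 t (y, x) = (picard n).1 t (y, x')].
  elim: n => [|n IHn] t; first by split.
  split=> [|y|y] /=.
  - rewrite /LP_theta t0E; apply: LP_theta_eq => s.
    by case: (IHn s) => h1 h2 h3; exact: B_eq.
  - apply: LP_xi_eq => s; case: (IHn s) => h1 h2 h3.
    by rewrite /Dh0 /= h1 (B_eq _ _ h1 h2).
  - apply: LP_xi_eq => s; case: (IHn s) => h1 h2 h3.
    by rewrite /Dh0 /= h1 (B_eq _ _ h1 h2).
move=> t; split=> [|y|y]; rewrite /theta_sol /xi_sol; congr (lim (_ @ \oo));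
  apply/funext => n; by case: (pE n t).
Qed.

End Lyapunov_Perron.

(** * Fixed points in the spaces of classes *)

Lemma eq_Bochner_integral d (T : measurableType d) (R : realType)
    (mu : {measure set T -> \bar R}) (D : set (measurableTypeR R))
    (f f' : R -> T -> R) (v v' : T -> R) : (0 < mu setT)%E ->
  (forall s, D s -> Linfty mu (f' s)) -> Linfty mu v' ->
  (forall s, D s -> {ae mu, forall p, f s p = f' s p}) ->
  {ae mu, forall p, v p = v' p} ->
  is_Bochner_integral mu D f v -> is_Bochner_integral mu D f' v'.
Proof.
move=> mu0 Lf' Lv' ff' vv' [Lf Lv [n [A [c [Ac mN fN vN]]]]]; split => //.
have E k s : D s -> Linfty_norm mu (f' s - \sum_(i < n k) \1_(A k i) s *: c k i)
    = Linfty_norm mu (f s - \sum_(i < n k) \1_(A k i) s *: c k i).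
  move=> Ds; apply: eq_Linfty_norm => //; apply: (aeS _ (ff' _ Ds)) => p fp.
  by rewrite /GRing.add/= fp.
exists n, A, c; split => //.
- by move=> k; apply: eq_measurable_fun (mN k) => s /set_mem Ds; rewrite E.
- apply: cvg_trans fN; apply: near_eq_cvg; apply: nearW => k /=.
  by apply: eq_integral => s /set_mem Ds; rewrite E.
- apply: cvg_trans vN; apply: near_eq_cvg; apply: nearW => k /=.
  apply: eq_Linfty_norm => //; apply: (aeS _ vv') => p vp.
  by rewrite /GRing.add/= vp.
Qed.

Section fixed_points.
Context (R : realType).
Variables (Gamma : R -> R) (H : R -> R -> R) (chi : R -> R) (r M eta eps : R).
Hypothesis mdl : smooth_model Gamma H chi r.
Hypothesis eps_gt0 : 0 < eps.
Hypothesis eta_lt0 : eta < 0.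
Hypothesis eps_eta : 0 < 1 + eps * eta.

Local Notation leb := (@lebesgue_measure R).
Local Notation mu := (unit_lebesgue R).
Local Notation mu2 := (unit_lebesgue2 R).
Local Notation I01 f := (\int[leb]_(y in `[0%R, 1%R]) f y).
Local Notation MG := (sup_norm Gamma).
Local Notation LG := (sup_norm (derive1 Gamma)).
Local Notation MDH := (M_DH H).
Local Notation MD2H := (M_D2H H).
Local Notation c1 := (C1 r MG MDH M).
Local Notation c2 := (C2 r MG M).
Local Notation c3 := (C3 r MG LG MDH MD2H M).
Local Notation c4 := (C4 r MG LG MDH).
Local Notation qx := (c3 * (eps / (1 + eps * eta))).
Local Notation qt := (c4 / `|eta|).
Hypothesis q_lt1 : qx + qt < 1.
Local Notation B := (B_field Gamma H chi r).
Local Notation DhB Omega xi theta := (Dh0 H theta (B Omega xi theta)).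
Local Notation Ny t := (`]-oo, t]%classic : set (measurableTypeR R)).
Local Notation pw_solution := (pointwise_solution Gamma H chi r M eps).

Variables (Omega theta0 : R -> R).
Hypothesis OmegaM : norm_theta_le Omega M.
Hypothesis theta0X : X_theta R theta0.
Local Notation LPF := (LP_fixed_point Gamma H chi r eta eps Omega theta0).

Let mu_gt0 : (0 < mu setT)%E. Proof. exact: unit_lebesgue_gt0. Qed.
Let mu2_gt0 : (0 < mu2 setT)%E. Proof. exact: unit_lebesgue2_gt0. Qed.
Let mOmega : measurable_fun setT Omega.
Proof. by case: (Linfty_norm_leE mu_gt0 OmegaM). Qed.
Let aeOmega : {ae mu, forall x, `|Omega x| <= M}.
Proof. by case: (Linfty_norm_leE mu_gt0 OmegaM). Qed.
Let M_ge0 : 0 <= M.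
Proof. by case: OmegaM => _; apply: le_trans; exact: Linfty_norm_ge0. Qed.
Let mtheta0 : measurable_fun setT theta0. Proof. exact: Linfty_measurable theta0X. Qed.
Let c1_pos : 0 <= c1. Proof. exact: (c1_ge0 mdl M_ge0). Qed.
Let c2_pos : 0 <= c2. Proof. exact: (c2_ge0 mdl M_ge0). Qed.
Let c3_pos : 0 <= c3. Proof. exact: (c3_ge0 mdl M_ge0). Qed.
Let c4_pos : 0 <= c4. Proof. exact: (c4_ge0 mdl). Qed.

Lemma B_field_Linfty xi theta : X_a R xi -> X_theta R theta ->
  Linfty mu (B Omega xi theta) /\ Linfty mu2 (DhB Omega xi theta).
Proof.
move=> /Linfty_measurable mx /Linfty_measurable mt; split.
  case: (@Linfty_norm_leI _ _ _ _ mu_gt0 (B Omega xi theta) c2) => //.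
    exact: (measurable_B_field mdl).
  by apply: (aeS _ aeOmega) => x; exact: (B_field_le mdl).
case: (@Linfty_norm_leI _ _ _ _ mu2_gt0 (DhB Omega xi theta) c1) => //.
  exact: (measurable_DhB mdl).
by apply: (aeS2 _ (ae_prod1 aeOmega) (ae_prod2 aeOmega)) => p; exact: (DhB_le mdl).
Qed.

Lemma C_eta_Lipschitz d (T : measurableType d) (m : {measure set T -> \bar R})
    (u : R -> T -> R) L K : (0 < m setT)%E ->
  (forall t, t <= 0 -> Linfty m (u t)) ->
  (forall s t, s <= 0 -> t <= 0 -> Linfty_norm m (u s - u t) <= L * `|s - t|) ->
  (forall t, t <= 0 -> Linfty_norm m (u t) <= K * expR (eta * t)) ->
  C_eta (Linfty m) (Linfty_norm m) eta u.
Proof.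
move=> m0 Lu uL uK; split => //.
  move=> t t0; apply/cvgrPdist_le => e e0; rewrite near_withinE.
  have L1 : 0 < `|L| + 1 by rewrite ltr_wpDl.
  near=> s => s0; rewrite sub0r normrN ger0_norm ?Linfty_norm_ge0//.
  rewrite (le_trans (uL _ _ s0 t0))// (@le_trans _ _ ((`|L| + 1) * `|s - t|))//.
    by rewrite ler_wpM2r// (le_trans (ler_norm _))// lerDl.
  rewrite -ler_pdivlMl// mulrC distrC; near: s.
  by apply: cvgr_dist_le => //; rewrite divr_gt0.
exists K => t t0; have := uK _ t0; rewrite -ler_pdivrMr ?expR_gt0//.
by rewrite -expRN mulrC mulNr.
Unshelve. all: by end_near. Qed.

(** The pointwise theory needs a frequency bounded everywhere and, for step data, an
    initial profile that is constant on cells also outside of the unit interval;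
    both are representatives of the given classes, and the classes alone enter a
    Bochner integral. *)
Lemma pointwise_solution_LP (Om th0 : R -> R) (xi : R -> R * R -> R)
    (theta : R -> R -> R) : (forall x, `|Om x| <= M) ->
  measurable_fun setT Om -> {ae mu, forall x, Om x = Omega x} ->
  {ae mu, forall x, th0 x = theta0 x} ->
  pw_solution Om th0 xi theta -> LPF (xi, theta).
Proof.
move=> OmM mOm OmE th0E [reg sol].
have xiE t : t <= 0 -> xi t = LP_xi Gamma H chi r eps Om xi theta t.
  by move=> t0; apply/funext => p; case: (sol t t0).
have thE t : t <= 0 -> theta t = LP_theta Gamma H chi r Om th0 xi theta t.
  by move=> t0; apply/funext => x; case: (sol t t0).
have xi_le t p : t <= 0 -> `|xi t p| <= c1 * eps.
  by move=> t0; rewrite xiE//; exact: (LP_xi_le mdl eps_gt0 OmM reg).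
have Lxi t : t <= 0 -> X_a R (xi t).
  move=> t0; case: (@Linfty_norm_leI _ _ _ _ mu2_gt0 (xi t) (c1 * eps)) => //.
    exact: (regular_mxi reg).
  by apply: nearW => p; exact: xi_le.
have expR_ge1 t : t <= 0 -> 1 <= expR (eta * t).
  by move=> t0; rewrite -[leLHS]expR0 ler_expR mulr_le0// ltW.
have [n0 n00 aen0] : exists2 K, 0 <= K & {ae mu, forall x, `|theta0 x| <= K}.
  by exists (Linfty_norm mu theta0); [exact: Linfty_norm_ge0|exact: Linfty_norm_ae].
have theta_le t : t <= 0 -> Linfty_norm_le mu (theta t) ((n0 + c2 / `|eta|) * expR (eta * t)).
  move=> t0; apply: Linfty_norm_leI => //; first exact: (regular_mtheta reg).
  apply: (aeS2 _ th0E aen0) => x x1 x0; rewrite thE// /LP_theta x1.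
  rewrite (le_trans (ler_normB _ _))// mulrDl lerD//.
    by rewrite (le_trans x0)// -[leLHS]mulr1 ler_wpM2l ?expR_ge1// n00.
  apply: (back_integral_le _ eta_lt0 c2_pos _ _).2.
    exact: (measurable_time_B Om mdl reg).
  move=> s s0; rewrite (le_trans (regular_B_le mdl OmM reg x s0))//.
  by rewrite -[leLHS]mulr1 ler_wpM2l// expR_ge1.
have Lth t : t <= 0 -> X_theta R (theta t) by move=> t0; case: (theta_le t t0).
split => /=.
- apply: (@C_eta_Lipschitz _ _ mu2 xi (2 * c1) (c1 * eps)) => //.
  + move=> s t s0 t0.
    case: (@Linfty_norm_leI _ _ _ _ mu2_gt0 (xi s - xi t) (2 * c1 * `|s - t|)) => //.
      by apply: measurable_funB; exact: (regular_mxi reg).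
    by apply: nearW => p; exact: (regular_Lxi reg).
  + move=> t t0.
    case: (@Linfty_norm_leI _ _ _ _ mu2_gt0 (xi t) (c1 * eps * expR (eta * t))) => //.
      exact: (regular_mxi reg).
    apply: nearW => p; rewrite (le_trans (xi_le _ _ t0))//.
    by rewrite -[leLHS]mulr1 ler_wpM2l ?expR_ge1// mulr_ge0// ltW.
- apply: (@C_eta_Lipschitz _ _ mu theta c2 (n0 + c2 / `|eta|)) => //.
  + move=> s t s0 t0.
    case: (@Linfty_norm_leI _ _ _ _ mu_gt0 (theta s - theta t) (c2 * `|s - t|)) => //.
      by apply: measurable_funB; exact: (regular_mtheta reg).
    by apply: nearW => p; exact: (regular_Ltheta reg).
  + by move=> t t0; case: (theta_le t t0).
- have B_ae s : s <= 0 ->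
      {ae mu, forall x, B Om (xi s) (theta s) x = B Omega (xi s) (theta s) x}.
    by move=> s0; apply: (aeS _ OmE) => x; rewrite /B_field => ->.
  move=> t t0; split.
  + have := LP_xi_Bochner mdl eps_gt0 mOm OmM reg t0.
    have <- : - xi t = (fun p => - LP_xi Gamma H chi r eps Om xi theta t p).
      by rewrite xiE.
    have st0 s : Ny t s -> s <= 0 by rewrite /= in_itv/= => /le_trans; apply.
    apply: eq_Bochner_integral => //.
    - move=> s /st0 s0; apply: LinftyZ => //.
      by apply: (B_field_Linfty _ _).2; [exact: Lxi|exact: Lth].
    - by have := LinftyZ mu2_gt0 (-1) (Lxi _ t0); rewrite scaleN1r.
    - move=> s /st0 s0; apply: (aeS2 _ (ae_prod1 (B_ae _ s0)) (ae_prod2 (B_ae _ s0))).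
      by move=> p h1 h2; rewrite /GRing.scale/= /Dh0 h1 h2.
    - exact: nearW.
  + have := LP_theta_Bochner th0 mdl mOm OmM reg t0.
    have <- : th0 - theta t = (fun x => th0 x - LP_theta Gamma H chi r Om th0 xi theta t x).
      by rewrite thE.
    have st0 s : `[t, 0]%classic s -> s <= 0 by rewrite /= in_itv/= => /andP[].
    apply: eq_Bochner_integral => //.
    - by move=> s /st0 s0; apply: (B_field_Linfty _ _).1; [exact: Lxi|exact: Lth].
    - exact: (LinftyB mu_gt0 theta0X (Lth _ t0)).
    - by move=> s /st0 s0; exact: B_ae.
    - by apply: (aeS _ th0E) => x x1; rewrite /GRing.add/= x1.
Qed.

Lemma LPF_contraction p p' a b : LPF p -> LPF p' -> 0 <= a -> 0 <= b ->
  (forall t, t <= 0 -> norm_a (p.1 t - p'.1 t) <= a * expR (eta * t)) ->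
  (forall t, t <= 0 -> norm_theta (p.2 t - p'.2 t) <= b * expR (eta * t)) ->
  (forall t, t <= 0 -> norm_a (p.1 t - p'.1 t) <= qx * (a + b) * expR (eta * t)) /\
  (forall t, t <= 0 -> norm_theta (p.2 t - p'.2 t) <= qt * (a + b) * expR (eta * t)).
Proof.
move=> [[Xx _ _] [Xt _ _] pI] [[Xx' _ _] [Xt' _ _] pI'] a0 b0 ha hb.
have LB s : s <= 0 ->
    Linfty_norm mu (B Omega (p.1 s) (p.2 s) - B Omega (p'.1 s) (p'.2 s))
      <= c4 * (a + b) * expR (eta * s) /\
    Linfty_norm mu2 (DhB Omega (p.1 s) (p.2 s) - DhB Omega (p'.1 s) (p'.2 s))
      <= c3 * (a + b) * expR (eta * s).
  move=> s0.
  have [h1 /(_ aeOmega) h2] := B_field_norm_Lipschitz M mdl mOmega (Xx _ s0) (Xt _ s0)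
    (Xx' _ s0) (Xt' _ s0) (ha _ s0) (hb _ s0).
  by rewrite -!mulrA ![(a + b) * _]mulrDl.
split=> t t0; have [pIx pIt] := pI t t0; have [pIx' pIt'] := pI' t t0.
- rewrite [leRHS](_ : _ = c3 * (a + b) * (eps / (1 + eps * eta)) * expR (eta * t));
    last by ring.
  have -> : norm_a (p.1 t - p'.1 t) = Linfty_norm mu2 (- p'.1 t - - p.1 t).
    by rewrite opprK addrC.
  apply: (Bochner_integral_norm_le mu2_gt0 (measurable_Ny t) pIx' pIx
    (b := fun s => expR (- (t - s) / eps) * (c3 * (a + b) * expR (eta * s)))).
  + apply: measurable_history; apply: measurable_funM => //; exact: measurable_expRM.
  + move=> s; rewrite /= in_itv/= => st; have s0 := le_trans st t0.
    rewrite -scalerBr.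
    have L1 := (B_field_Linfty (Xx _ s0) (Xt _ s0)).2.
    have L2 := (B_field_Linfty (Xx' _ s0) (Xt' _ s0)).2.
    have [_ h] := Linfty_norm_leZ mu2_gt0 (expR (- (t - s) / eps))
      (conj (LinftyB mu2_gt0 L1 L2) (LB s s0).2).
    rewrite gtr0_norm ?expR_gt0// in h; apply: le_trans h.
    by rewrite -(@Linfty_normN _ _ _ mu2 mu2_gt0) -scalerN (opprB (DhB Omega (p'.1 s) (p'.2 s))).
  + by rewrite integral_history_weight// mulr_ge0// addr_ge0.
- rewrite [leRHS](_ : _ = c4 * (a + b) / `|eta| * expR (eta * t)); last by ring.
  have -> : norm_theta (p.2 t - p'.2 t)
      = Linfty_norm mu ((theta0 - p'.2 t) - (theta0 - p.2 t)).
    congr (Linfty_norm mu _); apply/funext => x.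
    by rewrite /GRing.add /GRing.opp /=; ring.
  apply: (Bochner_integral_norm_le mu_gt0 _ pIt' pIt
    (b := fun s => c4 * (a + b) * expR (eta * s))).
  + exact: measurable_itv.
  + by apply: measurable_funM => //; exact: measurable_expRM.
  + move=> s; rewrite /= in_itv/= => /andP[_ s0].
    by rewrite -(@Linfty_normN _ _ _ mu mu_gt0) opprB; exact: (LB s s0).1.
  + by apply: integral_back_weight => //; rewrite mulr_ge0// addr_ge0.
Qed.

(** The growth bounds in the two spaces give a first estimate of the distance with
    weight exp(eta t), and each use of the contraction multiplies it by a fixed
    factor smaller than 1. *)
Theorem LP_fixed_point_unique p p' : LPF p -> LPF p' -> forall t, t <= 0 ->
  {ae mu2, forall z, p.1 t z = p'.1 t z} /\ {ae mu, forall x, p.2 t x = p'.2 t x}.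
Proof.
move=> pP pP'.
have init (V : zmodType) (X : set V) (nm : V -> R) u u' :
    (forall f g, X f -> X g -> nm (f - g) <= nm f + nm g) -> (forall f, 0 <= nm f) ->
    C_eta X nm eta u -> C_eta X nm eta u' ->
    exists2 a, 0 <= a & forall t, t <= 0 -> nm (u t - u' t) <= a * expR (eta * t).
  move=> nmB nm0 [Xu _ [K uK]] [Xu' _ [K' uK']]; exists (K + K').
    have := uK _ (lexx _); have := uK' _ (lexx _); rewrite mulr0 expR0 !mul1r.
    by move=> h h'; apply: addr_ge0; [exact: le_trans (nm0 _) h'|exact: le_trans (nm0 _) h].
  move=> t t0; rewrite (le_trans (nmB _ _ (Xu _ t0) (Xu' _ t0)))// mulrDl.
  have := uK _ t0; have := uK' _ t0; rewrite mulNr expRN !ler_pdivrMl ?expR_gt0//.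
  by rewrite ![expR _ * _]mulrC => h h'; exact: lerD.
have [[Cx Ct _] [Cx' Ct' _]] := (pP, pP').
have [a a0 ha] := init _ _ _ _ _ (fun f g Lf Lg => (Linfty_norm_leB mu2_gt0
   (conj Lf (lexx _)) (conj Lg (lexx _))).2) (Linfty_norm_ge0 mu2_gt0) Cx Cx'.
have [b b0 hb] := init _ _ _ _ _ (fun f g Lf Lg => (Linfty_norm_leB mu_gt0
   (conj Lf (lexx _)) (conj Lg (lexx _))).2) (Linfty_norm_ge0 mu_gt0) Ct Ct'.
have x0 : 0 <= qx by rewrite mulr_ge0// divr_ge0 ?ltW.
have y0 : 0 <= qt by rewrite divr_ge0.
have iter n : exists a' b', [/\ 0 <= a', 0 <= b', a' + b' = (a + b) * (qx + qt) ^+ n,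
    (forall t, t <= 0 -> norm_a (p.1 t - p'.1 t) <= a' * expR (eta * t)) &
    (forall t, t <= 0 -> norm_theta (p.2 t - p'.2 t) <= b' * expR (eta * t))].
  elim: n => [|n [a' [b' [a'0 b'0 ab ha' hb']]]].
    by exists a, b; rewrite expr0 mulr1.
  have [ha2 hb2] := LPF_contraction pP pP' a'0 b'0 ha' hb'.
  exists (qx * (a' + b')), (qt * (a' + b')); split => //.
  - by rewrite mulr_ge0// addr_ge0.
  - by rewrite mulr_ge0// addr_ge0.
  - by rewrite -mulrDl ab exprS mulrCA.
have q0 : 0 <= qx + qt < 1.
  by rewrite q_lt1 andbT addr_ge0.
move=> t t0; have [[Xx _ _] [Xt _ _] _] := pP; have [[Xx' _ _] [Xt' _ _] _] := pP'.
split.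
- have h : norm_a (p.1 t - p'.1 t) <= 0.
    apply: (ler_add_geometric (K := (a + b) * expR (eta * t)) q0) => n.
    have [a' [b' [a'0 b'0 ab ha' _]]] := iter n.
    rewrite add0r mulrAC -ab (le_trans (ha' _ t0))// ler_wpM2r ?expR_ge0//.
    by rewrite lerDl.
  have [_] := Linfty_norm_leE mu2_gt0 (conj (LinftyB mu2_gt0 (Xx _ t0) (Xx' _ t0)) h).
  by apply: aeS => z; rewrite normr_le0 subr_eq0 => /eqP.
- have h : norm_theta (p.2 t - p'.2 t) <= 0.
    apply: (ler_add_geometric (K := (a + b) * expR (eta * t)) q0) => n.
    have [a' [b' [a'0 b'0 ab _ hb']]] := iter n.
    rewrite add0r mulrAC -ab (le_trans (hb' _ t0))// ler_wpM2r ?expR_ge0//.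
    by rewrite lerDr.
  have [_] := Linfty_norm_leE mu_gt0 (conj (LinftyB mu_gt0 (Xt _ t0) (Xt' _ t0)) h).
  by apply: aeS => z; rewrite normr_le0 subr_eq0 => /eqP.
Qed.

End fixed_points.

(** * Expansion of the graph and of the phase field *)

Section expansion.
Context (R : realType).
Variables (Gamma : R -> R) (H : R -> R -> R) (chi : R -> R) (r M eps : R).
Hypothesis mdl : smooth_model Gamma H chi r.

Local Notation leb := (@lebesgue_measure R).
Local Notation mu := (unit_lebesgue R).
Local Notation mu2 := (unit_lebesgue2 R).
Local Notation I01 f := (\int[leb]_(y in `[0%R, 1%R]) f y).
Local Notation unit_itv := (`[0%R, 1%R]%classic : set (measurableTypeR R)).
Local Notation MG := (sup_norm Gamma).
Local Notation LG := (sup_norm (derive1 Gamma)).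
Local Notation MH := (sup_norm2 H).
Local Notation MDH := (M_DH H).
Local Notation MD2H := (M_D2H H).
Local Notation c1 := (C1 r MG MDH M).
Local Notation c2 := (C2 r MG M).
Local Notation c3 := (C3 r MG LG MDH MD2H M).
Local Notation B := (B_field Gamma H chi r).
Local Notation K := (K_op Gamma H).
Local Notation Ny t := (`]-oo, t]%classic : set (measurableTypeR R)).

Implicit Types theta Om : R -> R.

Let mu_gt0 : (0 < mu setT)%E. Proof. exact: unit_lebesgue_gt0. Qed.
Let mu2_gt0 : (0 < mu2 setT)%E. Proof. exact: unit_lebesgue2_gt0. Qed.

Lemma I01_integrable (f : R -> R) (c : R) : 0 <= c -> measurable_fun setT f ->
  {ae mu, forall y, `|f y| <= c} -> leb.-integrable unit_itv (EFin \o f).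
Proof. by move=> c0 mf fc; case: (I01_normr_le c0 mf fc). Qed.

Lemma measurable_section_Gamma theta x : measurable_fun setT theta ->
  measurable_fun setT (fun y => Gamma (theta y - theta x)).
Proof. by move=> mt; exact: (measurable_section x (measurable_Gamma_diff mdl mt)). Qed.

Lemma K_op_int theta x : measurable_fun setT theta ->
  leb.-integrable unit_itv
    (EFin \o (fun y => H (theta x) (theta y) * Gamma (theta y - theta x))) /\
  `|K theta x| <= MH * MG.
Proof.
move=> mt; apply: I01_normr_le.
- exact: mulr_ge0 (MH_ge0 mdl) (MG_ge0 mdl).
- apply: measurable_funM; first by apply: (measurable_H mdl) => //; exact: measurable_cst.
  exact: measurable_section_Gamma.
- apply: nearW => y; rewrite normrM; apply: ler_pM => //.
    exact: (H_le mdl).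
  exact: (Gamma_le mdl).
Qed.

Lemma measurable_K_op theta : measurable_fun setT theta -> measurable_fun setT (K theta).
Proof.
move=> mt.
apply: (measurable_I01 (g := fun p => h0 H theta p * Gamma (theta p.2 - theta p.1))).
by apply: measurable_funM; [exact: (measurable_h0 mdl)|exact: (measurable_Gamma_diff mdl)].
Qed.

(** On the critical graph the cut-off is inactive, since r exceeds the supremum
    norm of H. *)
Lemma B_field_critical Om theta : B Om (fun=> 0) theta = Om + K theta.
Proof.
apply/funext => x; congr (_ + _); apply: eq_Rintegral => y _.
rewrite addr0 (sigma_id mdl)//.
rewrite (le_trans (H_le mdl _ _))//; case: mdl => _ _ _; exact: ltW.
Qed.

Definition graph_constant : R := 2 * c3 * (c1 + 2 * c2).

(** Along the slaved curve the integrand of the graph component differs from its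
    value on the critical graph at time 0 by at most C3 (C1 eps + C2 |s|), so that
    the fast exponential turns the difference into a term of order eps^2; the
    linear growth is absorbed by half of the exponential rate. *)
Lemma pointwise_graph_expansion Om (theta0 : R -> R) (xi : R -> R * R -> R)
    (theta : R -> R -> R) :
  0 < eps -> (forall x, `|Om x| <= M) -> measurable_fun setT Om ->
  measurable_fun setT theta0 ->
  pointwise_solution Gamma H chi r M eps Om theta0 xi theta ->
  forall p, `|xi 0 p + eps * Dh0 H theta0 (Om + K theta0) p|
    <= graph_constant * eps ^+ 2.
Proof.
move=> eps0 OmM mOm mt [reg sol] p.
have M0 : 0 <= M by exact: le_trans (OmM 0).
have c1_pos := c1_ge0 mdl M0; have c2_pos := c2_ge0 mdl M0; have c3_pos := c3_ge0 mdl M0.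
have theta00 x : theta 0 x = theta0 x.
  by case: (sol 0 (lexx _)) => _ ->; rewrite LP_theta0.
set G := fun s => Dh0 H (theta s) (B Om (xi s) (theta s)) p.
set k := Dh0 H theta0 (Om + K theta0) p.
have mG : measurable_fun (Ny 0) G by exact: (measurable_time_DhB mdl OmM reg).
have [iG _] := history_bounded eps0 c1_pos mG (fun s => regular_DhB_le mdl OmM reg p).
have [ik _] := @history_bounded R eps (fun=> k) 0 `|k| eps0 (normr_ge0 _)
  (measurable_cst _) (fun s _ => lexx _).
have hk : history eps (fun=> k) 0 = eps * k.
  have [i1 _] := @history_bounded R eps (fun=> 1) 0 1 eps0 ler01 (measurable_cst _)
    (fun s _ => eq_ind_r (fun z => z <= 1) (lexx 1) (normr1 R)).
  have := @integral_history_weight R eps 0 1 0 eps0.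
  rewrite !mulr0 addr0 expR0 divr1 !mulr1 mul1r => /(_ ltr01 ler01) h.
  transitivity (history eps (fun=> 1) 0 * k).
    rewrite /history -RintegralZr//.
    by apply: eq_Rintegral => s _; rewrite mulr1.
  congr (_ * _); rewrite /history /Rintegral; transitivity (fine eps%:E) => //.
  congr fine; rewrite -h; apply: eq_integral => s _.
  by rewrite mul0r expR0 !mulr1.
have -> : xi 0 p + eps * k = - history eps (fun s => G s - k) 0.
  case: (sol 0 (lexx _)) => -> _; rewrite /LP_xi -/G -historyB// hk; ring.
rewrite normrN.
(* half of the fast rate is kept to absorb the factor |s| *)
pose a : R := - (2 * eps)^-1.
have ea : 1 + eps * a = 2^-1 by rewrite /a; field; rewrite gt_eqF.
have hist := @history_le R eps (fun s => G s - k) 0 (c3 * eps * (c1 + 2 * c2)) a eps0.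
rewrite ea in hist; have [||||_ h] := hist.
- by rewrite invr_gt0.
- by rewrite mulr_ge0// ?addr_ge0// mulr_ge0// ltW.
- by apply: measurable_funB => //; exact: measurable_cst.
- move=> s s0; rewrite /k -B_field_critical.
  have as0 : 0 <= a * s by rewrite mulr_le0// oppr_le0 invr_ge0 mulr_ge0// ltW.
  have ge1 : 1 <= expR (a * s) by rewrite -[leLHS]expR0 ler_expR.
  have dx q : `|xi s q - 0| <= c1 * eps * expR (a * s).
    rewrite subr0; case: (sol s s0) => -> _.
    rewrite (le_trans (LP_xi_le mdl eps0 OmM reg q s0))// -[leLHS]mulr1 ler_wpM2l//.
    by rewrite mulr_ge0// ltW.
  have dt x : `|theta s x - theta0 x| <= c2 * (2 * eps) * expR (a * s).
    rewrite -theta00 (le_trans (regular_Ltheta reg x s0 (lexx _)))// -mulrA ler_wpM2l//.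
    rewrite subr0 ler0_norm// -ler_pdivrMl ?mulr_gt0//.
    rewrite (le_trans _ (expR_ge1Dx _))// mulrN -mulNr ler_wpDl//.
  rewrite [leRHS](_ : _ = c3 * (c1 * eps * expR (a * s) + c2 * (2 * eps) * expR (a * s)));
    last by ring.
  apply: (DhB_sup_Lipschitz mdl OmM) => //.
  + exact: (regular_mxi reg).
  + exact: (regular_mtheta reg).
- rewrite !mulr0 expR0 mulr1 invrK in h; rewrite (le_trans h)//.
  by rewrite /graph_constant le_eqVlt; apply/orP; left; apply/eqP; ring.
Qed.

Section first_order_field.
Variables (theta Omega : R -> R).
Hypothesis mtheta : measurable_fun setT theta.
Hypothesis OmegaM : norm_theta_le Omega M.

Let mOmega : measurable_fun setT Omega.
Proof. by case: (Linfty_norm_leE mu_gt0 OmegaM). Qed.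
Let aeOmega : {ae mu, forall x, `|Omega x| <= M}.
Proof. by case: (Linfty_norm_leE mu_gt0 OmegaM). Qed.
Let M_ge0 : 0 <= M.
Proof. by case: OmegaM => _; apply: le_trans; exact: Linfty_norm_ge0. Qed.

(** The operators P and T together are the contribution of the first correction
    of the graph, which is minus the derivative of the critical graph along the
    critical phase field. *)
Lemma V1_fieldE x : V1_field Gamma H eps theta Omega x =
  Omega x + I01 (fun y => (h0 H theta (x, y) - eps * Dh0 H theta (Omega + K theta) (x, y))
    * Gamma (theta y - theta x)).
Proof.
have G0 := MG_ge0 mdl; have D0 := MDH_ge0 mdl; have H0 := MH_ge0 mdl.
have mG := measurable_section_Gamma x mtheta.
have md1 : measurable_fun setT (fun y => d1 H (theta x) (theta y)).
  by apply: (measurable_d1H mdl) => //; exact: measurable_cst.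
have md2 : measurable_fun setT (fun y => d2 H (theta x) (theta y)).
  by apply: (measurable_d2H mdl) => //; exact: measurable_cst.
have mK := measurable_K_op mtheta.
pose A y := H (theta x) (theta y) * Gamma (theta y - theta x).
pose P y := Gamma (theta y - theta x) * (d1 H (theta x) (theta y) * Omega x
         + d2 H (theta x) (theta y) * Omega y).
pose T1 y := Gamma (theta y - theta x) * d1 H (theta x) (theta y) * K theta x.
pose T2 y := Gamma (theta y - theta x) * d2 H (theta x) (theta y) * K theta y.
have iA : leb.-integrable unit_itv (EFin \o A) by case: (K_op_int x mtheta).
have iP : leb.-integrable unit_itv (EFin \o P).
  apply: (@I01_integrable _ (MG * (MDH * `|Omega x| + MDH * M))).
  - by rewrite mulr_ge0// addr_ge0// mulr_ge0.
  - exact: (measurable_funM mG (measurable_funD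
      (measurable_funM md1 (measurable_cst _)) (measurable_funM md2 mOmega))).
  - apply: (aeS _ aeOmega) => y Oy; rewrite normrM ler_pM ?(Gamma_le mdl)//.
    rewrite (le_trans (ler_normD _ _))// !normrM lerD//.
      by rewrite ler_wpM2r// (d1H_le mdl).
    by rewrite ler_pM// (d2H_le mdl).
have iT1 : leb.-integrable unit_itv (EFin \o T1).
  apply: (@I01_integrable _ (MG * MDH * `|K theta x|)).
  - by rewrite !mulr_ge0.
  - exact: (measurable_funM (measurable_funM mG md1) (measurable_cst _)).
  - apply: nearW => y; rewrite !normrM ler_wpM2r// ler_pM ?(Gamma_le mdl)//.
    exact: (d1H_le mdl).
have iT2 : leb.-integrable unit_itv (EFin \o T2).
  apply: (@I01_integrable _ (MG * MDH * (MH * MG))).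
  - by rewrite !mulr_ge0.
  - exact: (measurable_funM (measurable_funM mG md2) mK).
  - apply: nearW => y; rewrite !normrM ler_pM ?mulr_ge0//.
      by rewrite ler_pM ?(Gamma_le mdl)// (d2H_le mdl).
    by case: (K_op_int y mtheta).
have PE : P_op Gamma H theta Omega x = - I01 P by [].
have TE : T_op Gamma H theta x = - I01 T1 - I01 T2.
  rewrite /T_op; congr (- _ - _); apply: eq_Rintegral => y _.
    have [iH _] := K_op_int x mtheta.
    rewrite /T1 /K_op -(RintegralZl _ (@measurable_unit_itv R) iH).
    by apply: eq_Rintegral => z _; rewrite -!mulrA.
  have [iH _] := K_op_int y mtheta.
  rewrite /T2 /K_op -(RintegralZl _ (@measurable_unit_itv R) iH).
  by apply: eq_Rintegral => z _; rewrite -!mulrA.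
have iPT1 : leb.-integrable unit_itv (EFin \o (fun y => P y + T1 y)).
  exact: (integrableD (@measurable_unit R) iP iT1).
have iPT : leb.-integrable unit_itv (EFin \o (fun y => P y + T1 y + T2 y)).
  exact: (integrableD (@measurable_unit R) iPT1 iT2).
have iePT : leb.-integrable unit_itv (EFin \o (fun y => eps * (P y + T1 y + T2 y))).
  exact: (integrableZl (@measurable_unit R) eps iPT).
rewrite /V1_field -[K_op _ _ _ _]/(I01 A) PE TE -!addrA; congr (_ + _).
transitivity (I01 A - I01 (fun y => eps * (P y + T1 y + T2 y))).
  rewrite (RintegralZl _ (@measurable_unit R) iPT).
  rewrite (RintegralD (@measurable_unit R) iPT1 iT2) (RintegralD (@measurable_unit R) iP iT1).
  by move: (I01 A) (I01 P) (I01 T1) (I01 T2) => zA zP z1 z2; ring.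
rewrite I01B//; apply: eq_Rintegral => y _.
have addE z : (Omega + K theta) z = Omega z + K theta z by [].
by rewrite /A /P /T1 /T2 /h0 /Dh0 !addE /=; ring.
Qed.

Lemma measurable_V1_field : measurable_fun setT (V1_field Gamma H eps theta Omega).
Proof.
rewrite (_ : V1_field _ _ _ _ _ = fun x => Omega x + I01 (fun y =>
  (h0 H theta (x, y) - eps * Dh0 H theta (Omega + K theta) (x, y))
    * Gamma (theta y - theta x))); last by apply/funext => x; exact: V1_fieldE.
apply: measurable_funD => //.
apply: (measurable_I01 (g := fun p => (h0 H theta p
  - eps * Dh0 H theta (Omega + K theta) p) * Gamma (theta p.2 - theta p.1))).
apply: measurable_funM; last exact: (measurable_Gamma_diff mdl).
apply: measurable_funB; first exact: (measurable_h0 mdl).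
apply: measurable_funM => //; apply: measurable_funD; apply: measurable_funM.
- by apply: (measurable_d1H mdl); [exact: measurable_fst_comp|exact: measurable_snd_comp].
- by apply: measurable_fst_comp; apply: measurable_funD => //; exact: measurable_K_op.
- by apply: (measurable_d2H mdl); [exact: measurable_fst_comp|exact: measurable_snd_comp].
- by apply: measurable_snd_comp; apply: measurable_funD => //; exact: measurable_K_op.
Qed.

End first_order_field.

End expansion.

(** * The continuum-first field *)

Section continuum_route.
Context (R : realType).
Variables (Gamma : R -> R) (H : R -> R -> R) (chi : R -> R) (r M eta eps : R).
Hypothesis mdl : smooth_model Gamma H chi r.
Hypothesis eps_gt0 : 0 < eps.
Hypothesis eta_lt0 : eta < 0.
Hypothesis eps_eta : 0 < 1 + eps * eta.

Local Notation leb := (@lebesgue_measure R).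
Local Notation mu := (unit_lebesgue R).
Local Notation mu2 := (unit_lebesgue2 R).
Local Notation I01 f := (\int[leb]_(y in `[0%R, 1%R]) f y).
Local Notation MG := (sup_norm Gamma).
Local Notation LG := (sup_norm (derive1 Gamma)).
Local Notation MDH := (M_DH H).
Local Notation MD2H := (M_D2H H).
Local Notation c3 := (C3 r MG LG MDH MD2H M).
Local Notation c4 := (C4 r MG LG MDH).
Hypothesis q_lt1 : c3 * (eps / (1 + eps * eta)) + c4 / `|eta| < 1.
Local Notation K := (K_op Gamma H).
Local Notation pw_solution := (pointwise_solution Gamma H chi r M eps).
Local Notation C0 := (graph_constant Gamma H r M).

Let mu_gt0 : (0 < mu setT)%E. Proof. exact: unit_lebesgue_gt0. Qed.
Let mu2_gt0 : (0 < mu2 setT)%E. Proof. exact: unit_lebesgue2_gt0. Qed.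

Lemma bounded_representative (Omega : R -> R) : norm_theta_le Omega M ->
  exists Om : R -> R, [/\ forall x, `|Om x| <= M, measurable_fun setT Om &
    {ae mu, forall x, Om x = Omega x}].
Proof.
move=> OM; have M0 : 0 <= M.
  by case: OM => _; apply: le_trans; exact: Linfty_norm_ge0.
have [mO aeO] := Linfty_norm_leE mu_gt0 OM.
exists (fun x => Num.max (- M) (Num.min M (Omega x))); split.
- move=> x; rewrite ler_norml le_max lexx /= ge_max ge_min lexx /=.
  by rewrite (le_trans _ M0)// oppr_le0.
- by apply: measurable_maxr => //; apply: measurable_minr.
- apply: (aeS _ aeO) => x; rewrite ler_norml => /andP[h1 h2].
  by rewrite (min_idPr h2) (max_idPr h1).
Qed.

Section one_profile.
Variables (Omega theta0 : R -> R).
Hypothesis OmegaM : norm_theta_le Omega M.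
Hypothesis theta0X : X_theta R theta0.
Local Notation LPF := (LP_fixed_point Gamma H chi r eta eps Omega theta0).
Local Notation graph := (continuum_graph Gamma H chi r eta eps Omega theta0).
Local Notation VCF := (V_CF Gamma H chi r eta eps Omega theta0).

Let mOmega : measurable_fun setT Omega.
Proof. by case: (Linfty_norm_leE mu_gt0 OmegaM). Qed.
Let mtheta0 : measurable_fun setT theta0. Proof. exact: Linfty_measurable theta0X. Qed.

Lemma LPF_exists : exists (Om : R -> R) (xi : R -> R * R -> R) (theta : R -> R -> R),
  [/\ forall x, `|Om x| <= M, measurable_fun setT Om,
      {ae mu, forall x, Om x = Omega x}, pw_solution Om theta0 xi theta &
      LPF (xi, theta)].
Proof.
have [Om [OmM mOm OmE]] := bounded_representative OmegaM.
have sol := pointwise_solution_exists mdl eps_gt0 mOm OmM mtheta0 eta_lt0 eps_eta q_lt1.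
exists Om, (xi_sol Gamma H chi r eps Om theta0), (theta_sol Gamma H chi r eps Om theta0).
split => //; apply: (pointwise_solution_LP mdl eps_gt0 eta_lt0 OmegaM theta0X OmM mOm OmE _ sol).
exact: nearW.
Qed.

Lemma continuum_graph_LPF p : LPF p ->
  X_a R (p.1 0) /\ measurable_fun setT graph /\
  {ae mu2, forall z, graph z = h0 H theta0 z + p.1 0 z}.
Proof.
move=> pP; set p0 := xget (fun=> fun=> 0, fun=> fun=> 0) LPF.
have p0P : LPF p0 by exact: (xgetPex _ (ex_intro _ p pP)).
have [[X1 _ _] _ _] := pP; have [[X0 _ _] _ _] := p0P.
split; first exact: X1.
split.
  apply: measurable_funD; first exact: (measurable_h0 mdl).
  by apply: (@Linfty_measurable _ _ _ mu2); exact: X0.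
have [h _] := LP_fixed_point_unique mdl eps_gt0 eta_lt0 eps_eta q_lt1 OmegaM
  p0P pP (lexx 0).
apply: (aeS _ h) => z zE; rewrite -zE.
by [].
Qed.

Lemma measurable_graph_Gamma (a : R * R -> R) : measurable_fun setT a ->
  measurable_fun setT (fun z => a z * Gamma (theta0 z.2 - theta0 z.1)).
Proof. by move=> ma; apply: measurable_funM => //; exact: (measurable_Gamma_diff mdl). Qed.

Lemma measurable_V_CF : measurable_fun setT VCF.
Proof.
have [Om [xi [theta [_ _ _ _ P]]]] := LPF_exists.
have [_ [mg _]] := continuum_graph_LPF P.
apply: measurable_funD => //.
exact: (measurable_I01 (measurable_graph_Gamma mg)).
Qed.

(** By uniqueness, every fixed point computes the field. *)
Lemma V_CF_ae p : LPF p -> {ae mu, forall x, VCF x = Omega x +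
  I01 (fun y => (h0 H theta0 (x, y) + p.1 0 (x, y)) * Gamma (theta0 y - theta0 x))}.
Proof.
move=> /continuum_graph_LPF[Lp [mg gE]].
apply: (aeS _ (ae_section gE)) => x gx; congr (_ + _); apply: I01_ae_eq.
- exact: (measurable_section x (measurable_graph_Gamma mg)).
- apply: (measurable_section x (measurable_graph_Gamma (a := fun z => h0 H theta0 z + p.1 0 z) _)).
  by apply: measurable_funD; [exact: (measurable_h0 mdl)|exact: Linfty_measurable Lp].
- by apply: (aeS _ gx) => y ->.
Qed.

Lemma V_CF_expansion : norm_theta_le (VCF - V1_field Gamma H eps theta0 Omega)
  (MG * C0 * eps ^+ 2).
Proof.
have [Om [xi [theta [OmM mOm OmE sol P]]]] := LPF_exists.
have M0 : 0 <= M by exact: le_trans (OmM 0).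
have [Lp _] := continuum_graph_LPF P.
apply: Linfty_norm_leI => //.
  by apply: measurable_funB; [exact: measurable_V_CF|exact: (measurable_V1_field eps mdl mtheta0 OmegaM)].
have exp_p := pointwise_graph_expansion mdl eps_gt0 OmM mOm mtheta0 sol.
have mDh : measurable_fun setT (Dh0 H theta0 (Omega + K theta0)).
  apply: measurable_funD; apply: measurable_funM.
  - by apply: (measurable_d1H mdl); [exact: measurable_fst_comp|exact: measurable_snd_comp].
  - by apply: measurable_fst_comp; apply: measurable_funD => //; exact: (measurable_K_op mdl).
  - by apply: (measurable_d2H mdl); [exact: measurable_fst_comp|exact: measurable_snd_comp].
  - by apply: measurable_snd_comp; apply: measurable_funD => //; exact: (measurable_K_op mdl).
have G0 := MG_ge0 mdl; have D0 := MDH_ge0 mdl.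
have C00 : 0 <= C0.
  rewrite /graph_constant !mulr_ge0// ?(c3_ge0 mdl M0)//.
  by rewrite addr_ge0 ?(c1_ge0 mdl M0)// mulr_ge0// (c2_ge0 mdl M0).
have ae1 : {ae mu, forall x, Om x = Omega x /\ {ae mu, forall y, Om y = Omega y}}.
  by apply: (aeS _ OmE).
apply: (aeS2 _ ae1 (V_CF_ae P)) => x [OxE OyE] VE.
rewrite (_ : (VCF - _) x = VCF x - V1_field Gamma H eps theta0 Omega x)//.
rewrite VE (V1_fieldE eps mdl mtheta0 OmegaM) opprD addrACA subrr add0r.
pose f y := (h0 H theta0 (x, y) + xi 0 (x, y)) * Gamma (theta0 y - theta0 x).
pose g y := (h0 H theta0 (x, y) - eps * Dh0 H theta0 (Omega + K theta0) (x, y))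
  * Gamma (theta0 y - theta0 x).
have mf : measurable_fun setT f.
  apply: (measurable_section x (measurable_graph_Gamma (a := fun z => h0 H theta0 z + xi 0 z) _)).
  by apply: measurable_funD; [exact: (measurable_h0 mdl)|exact: Linfty_measurable Lp].
have mg : measurable_fun setT g.
  apply: (measurable_section x (measurable_graph_Gamma (a := fun z => h0 H theta0 z
    - eps * Dh0 H theta0 (Omega + K theta0) z) _)).
  by apply: measurable_funB; [exact: (measurable_h0 mdl)|exact: measurable_funM].
have fg : {ae mu, forall y, `|f y - g y| <= MG * C0 * eps ^+ 2}.
  apply: (aeS _ OyE) => y yE; rewrite /f /g -mulrBl normrM mulrC -[leRHS]mulrA.
  apply: ler_pM => //; first exact: (Gamma_le mdl).
  apply: le_trans (exp_p (x, y)); rewrite le_eqVlt; apply/orP; left; apply/eqP.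
  have addE (W : R -> R) z : (W + K theta0) z = W z + K theta0 z by [].
  have -> : Dh0 H theta0 (Omega + K theta0) (x, y) = Dh0 H theta0 (Om + K theta0) (x, y).
    by rewrite /Dh0 !addE /= OxE yE.
  by congr `|_|; ring.
have xi_le z : `|xi 0 z| <= C1 r MG MDH M * eps.
  case: sol => reg /(_ 0 (lexx _))[-> _].
  exact: (LP_xi_le mdl eps_gt0 OmM reg).
have c10 : 0 <= C1 r MG MDH M * eps by exact: le_trans (xi_le (0, 0)).
have H0 := MH_ge0 mdl.
have f_le y : `|f y| <= (sup_norm2 H + C1 r MG MDH M * eps) * MG.
  rewrite normrM; apply: ler_pM => //; last exact: (Gamma_le mdl).
  by rewrite (le_trans (ler_normD _ _))// lerD// (H_le mdl).
have e0 : 0 <= MG * C0 * eps ^+ 2 by rewrite mulr_ge0 ?sqr_ge0// mulr_ge0.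
have intf := I01_integrable (mulr_ge0 (addr_ge0 H0 c10) G0) mf (aeW mu f_le).
have intg : leb.-integrable (`[0%R, 1%R]%classic : set (measurableTypeR R)) (EFin \o g).
  apply: (@I01_integrable _ _ ((sup_norm2 H + C1 r MG MDH M * eps) * MG + MG * C0 * eps ^+ 2)) => //.
    by rewrite addr_ge0// mulr_ge0// addr_ge0.
  apply: (aeS _ fg) => y fgy; rewrite -[g y](subrK (f y)) addrC.
  by rewrite (le_trans (ler_normD _ _))// lerD// distrC.
rewrite I01B//; case: (I01_normr_le e0 _ fg) => //.
exact: measurable_funB.
Qed.

End one_profile.

End continuum_route.

(** * Cells and step functions *)

Section cells.
Context (R : realType) (N : nat).
Hypothesis N_gt0 : (0 < N)%N.
Local Notation leb := (@lebesgue_measure R).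
Local Notation mu := (unit_lebesgue R).
Local Notation I01 f := (\int[leb]_(y in `[0%R, 1%R]) f y).
Local Notation unit_itv := (`[0%R, 1%R]%classic : set (measurableTypeR R)).
Local Notation cell := (@cell R N).
Implicit Types (i j : 'I_N) (x : R).

Definition pt i : R := i.+1%:R / N%:R.

Let N0 : 0 < N%:R :> R. Proof. by rewrite ltr0n. Qed.

Lemma cellP i x : cell i x <-> 0 <= x <= 1 /\ (x <= pt i /\ (i != 0%N :> nat -> i%:R / N%:R < x)).
Proof.
have iN : pt i <= 1.
  by rewrite /pt ler_pdivrMr// mul1r ler_nat.
have i0 : 0 <= i%:R / N%:R :> R by rewrite divr_ge0.
rewrite /cell /pt; case: ifPn => [/eqP iE|iE].
  rewrite iE /= in_itv/= mul1r; split=> [/andP[h1 h2]|[/andP[h1 h2] [h3 _]]].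
    rewrite h1 h2; split => //=; rewrite (le_trans h2)//.
    by move: iN; rewrite /pt iE mul1r.
  by rewrite h1 h3.
rewrite /= in_itv/=; split=> [/andP[h1 h2]|[_ [h3 h4]]].
  by split; [rewrite (le_trans i0 (ltW h1)) (le_trans h2 iN)|split].
by rewrite h4.
Qed.

Lemma measurable_cell i : measurable (cell i : set (measurableTypeR R)).
Proof. by rewrite /cell; case: ifP => _; exact: measurable_itv. Qed.

Lemma cell_sub i : cell i `<=` `[0%R, 1%R]%classic.
Proof. by move=> x /cellP[h _]; rewrite /= in_itv. Qed.

Lemma cell_pt i : cell i (pt i).
Proof.
apply/cellP; split; last first.
  by split => // _; rewrite /pt ltr_pM2r ?invr_gt0// ltr_nat.
by rewrite /pt divr_ge0//= ler_pdivrMr// mul1r ler_nat.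
Qed.

Lemma cell_uniq i j x : cell i x -> cell j x -> i = j.
Proof.
have main (i' j' : 'I_N) : (i' < j')%N -> cell i' x -> cell j' x -> False.
  move=> ij /cellP[_ [xi _]] /cellP[_ [_ xj]].
  have := lt_le_trans (xj _) xi; rewrite -lt0n (leq_ltn_trans _ ij)// => /(_ isT).
  by rewrite /pt ltr_pM2r ?invr_gt0// ltr_nat ltnS leqNgt ij.
move=> xi xj; apply/val_inj; case: (ltngtP i j) => // ij.
- by case: (main _ _ ij xi xj).
- by case: (main _ _ ij xj xi).
Qed.

Lemma cell_cover x : 0 <= x <= 1 -> exists i, cell i x.
Proof.
move=> x01; have /andP[x0 x1] := x01.
have ex : exists n, (n < N)%N && (x <= n.+1%:R / N%:R).
  by exists N.-1; rewrite prednK// leqnn divff ?gt_eqF.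
case: (ex_minnP ex) => n /andP[nN xn] nmin.
exists (Ordinal nN); apply/cellP; split => //; split => //= n0.
rewrite ltNge; apply/negP => xle; have := nmin n.-1.
rewrite prednK ?lt0n// xle andbT => /(_ (ltnW nN)).
by rewrite leqNgt prednK ?lt0n// leqnn.
Qed.

Lemma lebesgue_cell i : fine (leb (cell i)) = N%:R^-1.
Proof.
rewrite /cell; case: ifP => _; rewrite lebesgue_measure_itv/= lte_fin.
  by rewrite invr_gt0 N0 oppr0 adde0.
rewrite ltr_pM2r ?invr_gt0// ltr_nat ltnSn -EFinB /= -mulrBl -natrB//.
by rewrite subSnn mul1r.
Qed.

Lemma lebesgue_cell_lty i : (leb (cell i) < +oo)%E.
Proof.
by rewrite /cell; case: ifP => _; rewrite lebesgue_measure_itv/=; case: ifP => _; rewrite ?ltry.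
Qed.

(** The value outside of all cells is a default that makes functions of [idx]
    defined on the whole line, so that embedded solutions of the finite system
    satisfy the Lyapunov-Perron equations at every real x. *)
Definition idx x : 'I_N :=
  if [pick i : 'I_N | `[< cell i x >]] is Some i then i else Ordinal N_gt0.

Lemma idxE i x : cell i x -> idx x = i.
Proof.
move=> ix; rewrite /idx; case: pickP => [j /asboolP jx|/(_ i)/asboolP//].
exact: cell_uniq jx ix.
Qed.

Lemma idx_pt i : idx (pt i) = i.
Proof. exact: idxE (cell_pt i). Qed.

Lemma idx_sum (f : 'I_N -> R) x : f (idx x) = f (Ordinal N_gt0)
  + \sum_(i < N) (f i - f (Ordinal N_gt0)) * \1_(cell i) x.
Proof.
have [[i ix]|nx] := pselect (exists i, cell i x).
  rewrite (idxE ix) (bigD1 i)//= big1 ?addr0.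
    by rewrite indicE mem_set// mulr1 addrC subrK.
  move=> j ji; rewrite indicE memNset ?mulr0// => jx.
  by move: ji; rewrite (cell_uniq jx ix) eqxx.
rewrite big1 ?addr0; last first.
  by move=> j _; rewrite indicE memNset ?mulr0// => jx; apply: nx; exists j.
rewrite /idx; case: pickP => // j /asboolP jx.
by case: nx; exists j.
Qed.

Lemma measurable_idx (f : 'I_N -> R) : measurable_fun setT (fun x => f (idx x)).
Proof.
rewrite (_ : (fun x => f (idx x)) = fun x => f (Ordinal N_gt0)
  + \sum_(i < N) (f i - f (Ordinal N_gt0)) * \1_(cell i) x); last first.
  by apply/funext => x; exact: idx_sum.
apply: measurable_funD => //; apply: measurable_sum => i.
by apply: measurable_funM => //; apply: measurable_indic; exact: measurable_cell.
Qed.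

Lemma measurable_idx2 (f : 'I_N -> 'I_N -> R) :
  measurable_fun setT (fun p : R * R => f (idx p.1) (idx p.2)).
Proof.
rewrite (_ : (fun p => _) = fun p : R * R =>
    \sum_(i < N) (idx p.1 == i)%:R * f i (idx p.2)); last first.
  apply/funext => p; rewrite (bigD1 (idx p.1))//= eqxx mul1r big1 ?addr0//.
  by move=> j /negPf; rewrite eq_sym => ->; rewrite mul0r.
apply: measurable_sum => i; apply: measurable_funM.
- exact: (measurable_fst_comp (measurable_idx (fun j => (j == i)%:R))).
- exact: (measurable_snd_comp (measurable_idx (f i))).
Qed.

Lemma stepE (v : 'rV[R]_N) i x : cell i x -> step v x = v 0 i.
Proof.
move=> ix; rewrite /step (bigD1 i)//= big1 ?addr0.
  by rewrite indicE mem_set// mulr1.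
move=> j ji; rewrite indicE memNset ?mulr0// => jx.
by move: ji; rewrite (cell_uniq jx ix) eqxx.
Qed.

Lemma ae_cell (P : R -> Prop) : (forall i x, cell i x -> P x) -> {ae mu, forall x, P x}.
Proof.
move=> cP; apply: ae_unit_lebesgueW => y; rewrite /= in_itv/= => /cell_cover[i].
exact: cP.
Qed.

Lemma step_idx (v : 'rV[R]_N) : {ae mu, forall x, v 0 (idx x) = step v x}.
Proof. by apply: ae_cell => i x ix; rewrite (idxE ix) (stepE v ix). Qed.

Lemma measurable_step (v : 'rV[R]_N) : measurable_fun setT (step v).
Proof.
apply: measurable_sum => i; apply: measurable_funM => //.
by apply: measurable_indic; exact: measurable_cell.
Qed.

Lemma I01_cells (f : R -> R) (c : 'I_N -> R) :
  (forall i x, cell i x -> f x = c i) -> I01 f = N%:R^-1 * \sum_(i < N) c i.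
Proof.
move=> fc.
have [|_ E] := @Rintegral_simple R unit_itv N (fun i => cell i) c (@measurable_unit R).
  by move=> i; split; [exact: measurable_cell|exact: cell_sub|exact: lebesgue_cell_lty].
rewrite mulr_sumr; transitivity (\sum_(i < N) fine (leb (cell i)) * c i); last first.
  by apply: eq_bigr => i _; rewrite lebesgue_cell.
rewrite -E; apply: eq_Rintegral => y /set_mem; rewrite /= in_itv/= => /cell_cover[i iy].
rewrite (fc _ _ iy) (bigD1 i)//= big1 ?addr0; first by rewrite indicE mem_set// mul1r.
move=> j ji; rewrite indicE memNset ?mul0r// => jy.
by move: ji; rewrite (cell_uniq jy iy) eqxx.
Qed.

Lemma step_space_values (f : R -> R) i x : step_space R N f -> cell i x ->
  f x = cell_values N f 0 i.
Proof.
move=> [_ /(_ i)[c fc]] ix; rewrite mxE (fc _ ix).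
by rewrite -/(pt i) (fc _ (cell_pt i)).
Qed.

(** A cell has positive measure, hence contains a point at which the essential
    bound holds. *)
Lemma cell_values_le (f : R -> R) M i : step_space R N f -> norm_theta f <= M ->
  `|cell_values N f 0 i| <= M.
Proof.
move=> fS fM; have [Lf _] := fS.
have [_ aef] := Linfty_norm_leE (@unit_lebesgue_gt0 R) (conj Lf fM).
rewrite leNgt; apply/negP => Mlt.
have [A [mA A0 sA]] := aef.
have cA : cell i `<=` A `&` `[0%R, 1%R]%classic.
  move=> x ix; split; last exact: cell_sub ix.
  by apply: sA => /=; apply/negP; rewrite (step_space_values fS ix) -ltNge.
have : (leb (cell i) <= 0)%E.
  rewrite -A0; apply: le_measure => //; rewrite inE.
    exact: measurable_cell.
  by apply: measurableI => //; exact: measurable_unit.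
have := lebesgue_cell i; case: (leb (cell i)) (lebesgue_cell_lty i) => [z| |]//= _ zE.
  by rewrite zE lee_fin leNgt invr_gt0 N0.
by move=> _; have : (0 : R) < N%:R^-1 by [rewrite invr_gt0]; rewrite -zE ltxx.
Qed.

End cells.

Section matrix_norm.
Context (R : realType).

Lemma mx_norm_entry m n (A : 'M[R]_(m, n)) i j : `|A i j| <= `|A|.
Proof.
rewrite [leRHS]mx_normrE.
exact: (le_bigmax _ (fun ij : 'I_m * 'I_n => `|A ij.1 ij.2|) (i, j)).
Qed.

Lemma mx_norm_le m n (A : 'M[R]_(m, n)) c : 0 <= c ->
  (forall i j, `|A i j| <= c) -> `|A| <= c.
Proof.
move=> c0 Ac; rewrite [leLHS]mx_normrE; exact: bigmax_le.
Qed.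

Lemma C_eta_entry m n eta (u : R -> 'M[R]_(m, n)) i j :
  C_eta setT (fun A : 'M[R]_(m, n) => `|A|) eta u ->
  measurable_fun (`]-oo, 0%R]%classic : set (measurableTypeR R)) (fun s => u s i j).
Proof.
move=> [_ cu _]; apply: subspace_continuous_measurable_fun; first exact: measurable_itv.
apply/subspace_continuousP => t; rewrite /= in_itv/= => t0.
apply/cvgrPdist_le => e e0.
have /cvgrPdist_le/(_ _ e0) := cu t t0.
rewrite set_itvE; apply: filterS => s; rewrite sub0r normrN normr_id => h.
by rewrite distrC (le_trans _ h)//; have := mx_norm_entry (u s - u t) i j; rewrite !mxE.
Qed.

Lemma C_eta_mx_Lipschitz m n eta (u : R -> 'M[R]_(m, n)) L K :
  0 <= L -> 0 <= K ->
  (forall s t i j, s <= 0 -> t <= 0 -> `|u s i j - u t i j| <= L * `|s - t|) ->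
  (forall t i j, t <= 0 -> `|u t i j| <= K * expR (eta * t)) ->
  C_eta setT (fun A : 'M[R]_(m, n) => `|A|) eta u.
Proof.
move=> L0 K0 uL uK; split => //.
  move=> t t0; apply/cvgrPdist_le => e e0; rewrite near_withinE.
  have L1 : 0 < L + 1 by rewrite ltr_wpDl.
  near=> s => s0; rewrite sub0r normrN normr_id.
  apply: (@le_trans _ _ ((L + 1) * `|s - t|)).
    apply: mx_norm_le; first by rewrite mulr_ge0// ltW.
    move=> i j; rewrite !mxE (le_trans (uL _ _ i j s0 t0))//.
    by rewrite ler_wpM2r// lerDl.
  rewrite -ler_pdivlMl// mulrC distrC; near: s.
  by apply: cvgr_dist_le => //; rewrite divr_gt0.
exists K => t t0; rewrite mulNr expRN ler_pdivrMl ?expR_gt0// mulrC.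
by apply: mx_norm_le => [|i j]; [rewrite mulr_ge0// expR_ge0|exact: uK].
Unshelve. all: by end_near. Qed.

End matrix_norm.

(** * The reduce-first field *)

Section finite_route.
Context (R : realType) (N : nat).
Hypothesis N_gt0 : (0 < N)%N.
Variables (Gamma : R -> R) (H : R -> R -> R) (chi : R -> R) (r M eta eps : R).
Hypothesis mdl : smooth_model Gamma H chi r.
Hypothesis eps_gt0 : 0 < eps.
Hypothesis eta_lt0 : eta < 0.
Hypothesis eps_eta : 0 < 1 + eps * eta.

Local Notation leb := (@lebesgue_measure R).
Local Notation mu := (unit_lebesgue R).
Local Notation mu2 := (unit_lebesgue2 R).
Local Notation I01 f := (\int[leb]_(y in `[0%R, 1%R]) f y).
Local Notation MG := (sup_norm Gamma).
Local Notation LG := (sup_norm (derive1 Gamma)).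
Local Notation MDH := (M_DH H).
Local Notation MD2H := (M_D2H H).
Local Notation c1 := (C1 r MG MDH M).
Local Notation c2 := (C2 r MG M).
Local Notation c3 := (C3 r MG LG MDH MD2H M).
Local Notation c4 := (C4 r MG LG MDH).
Hypothesis q_lt1 : c3 * (eps / (1 + eps * eta)) + c4 / `|eta| < 1.
Local Notation K := (K_op Gamma H).
Local Notation pw_solution := (pointwise_solution Gamma H chi r M eps).
Local Notation C0 := (graph_constant Gamma H r M).
Local Notation Ny t := (`]-oo, t]%classic : set (measurableTypeR R)).

Variables (w v0 : 'rV[R]_N).
Hypothesis w_le : forall i, `|w 0 i| <= M.
Local Notation LPN := (LPN_solution Gamma H chi r eta eps w v0).
Local Notation BN := (BN_field Gamma H chi r w).
Local Notation idx := (@idx R N N_gt0).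
Local Notation pt := (@pt R N).

Definition embed1 (u : 'rV[R]_N) (x : R) : R := u 0 (idx x).
Definition embed2 (X : 'M[R]_N) (p : R * R) : R := X (idx p.1) (idx p.2).

Local Notation B := (B_field Gamma H chi r (embed1 w)).

Let mu_gt0 : (0 < mu setT)%E. Proof. exact: unit_lebesgue_gt0. Qed.
Let mu2_gt0 : (0 < mu2 setT)%E. Proof. exact: unit_lebesgue2_gt0. Qed.
Let w_bound x : `|embed1 w x| <= M. Proof. exact: w_le. Qed.
Let measurable_embed1 u : measurable_fun setT (embed1 u).
Proof. exact: (measurable_idx N_gt0 (fun i => u 0 i)). Qed.
Let measurable_embed2 X : measurable_fun setT (embed2 X).
Proof. exact: (measurable_idx2 N_gt0 (fun i j => X i j)). Qed.
Let M_ge0 : 0 <= M. Proof. exact: le_trans (w_le (Ordinal N_gt0)). Qed.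
Let c1_pos : 0 <= c1. Proof. exact: (c1_ge0 mdl M_ge0). Qed.
Let c2_pos : 0 <= c2. Proof. exact: (c2_ge0 mdl M_ge0). Qed.

Lemma B_embed X u x : B (embed2 X) (embed1 u) x = BN X u (idx x).
Proof.
rewrite /B_field /BN_field; congr (_ + _).
rewrite -(I01_cells N_gt0 (f := fun y => sigma chi r
  (h0 H (embed1 u) (x, y) + embed2 X (x, y)) * Gamma (embed1 u y - embed1 u x)))//.
by move=> j y jy; rewrite /h0 /embed1 /embed2 /= (idxE N_gt0 jy).
Qed.

Lemma DhB_embed X u p : Dh0 H (embed1 u) (B (embed2 X) (embed1 u)) p =
  d1 H (u 0 (idx p.1)) (u 0 (idx p.2)) * BN X u (idx p.1)
  + d2 H (u 0 (idx p.1)) (u 0 (idx p.2)) * BN X u (idx p.2).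
Proof. by rewrite /Dh0 !B_embed. Qed.

Lemma BN_le X u i : `|BN X u i| <= c2.
Proof.
rewrite -[i in BN X u i](idx_pt R N_gt0) -B_embed.
exact: (B_field_le mdl (measurable_embed2 X) (measurable_embed1 u) (w_bound _)).
Qed.

Lemma DhBN_le (X : 'M[R]_N) (u : 'rV[R]_N) i j :
  `|d1 H (u 0 i) (u 0 j) * BN X u i + d2 H (u 0 i) (u 0 j) * BN X u j| <= c1.
Proof.
have := DhB_embed X u (pt i, pt j); rewrite /= !idx_pt => <-.
exact: (DhB_le mdl (measurable_embed2 X) (measurable_embed1 u) (w_bound _) (w_bound _)).
Qed.

Lemma measurable_BN (X : R -> 'M[R]_N) (u : R -> 'rV[R]_N) i (D : set (measurableTypeR R)) :
  (forall i j, measurable_fun D (fun s => X s i j)) ->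
  (forall i, measurable_fun D (fun s => u s 0 i)) ->
  measurable_fun D (fun s => BN (X s) (u s) i).
Proof.
move=> mX mu_; apply: measurable_funD => //; apply: measurable_funM => //.
apply: measurable_sum => j; apply: measurable_funM.
  apply: (measurable_sigma mdl); apply: measurable_funD => //.
  exact: (measurable_H mdl).
by apply: (measurable_Gamma mdl); exact: measurable_funB.
Qed.

(** At a point x of the line the embedded curve satisfies the equations with index
    [idx x], because the integral over y of a function constant on the cells is the
    mean of its N values. *)
Lemma LPN_embed p : LPN p ->
  pw_solution (embed1 w) (embed1 v0) (fun t => embed2 (p.1 t)) (fun t => embed1 (p.2 t)).
Proof.
move=> [Cx Cv pE].
have mX i j : measurable_fun (Ny 0) (fun s => p.1 s i j) by exact: C_eta_entry Cx.
have mV i : measurable_fun (Ny 0) (fun s => p.2 s 0 i) by exact: C_eta_entry Cv.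
have mB i := measurable_BN i mX mV.
split; last first.
  move=> t t0; have [xE vE] := pE t t0; split=> q.
    rewrite /LP_xi /embed2 xE; congr (- _); apply: eq_Rintegral => s _.
    by rewrite DhB_embed.
  rewrite /LP_theta /embed1 vE; congr (_ - _); apply: eq_Rintegral => s _.
  by rewrite B_embed.
split.
- by move=> t _; exact: measurable_embed2.
- by move=> t _; exact: measurable_embed1.
- move=> t t' q t0 t'0; rewrite /embed2; move: (idx q.1) (idx q.2) => i j.
  have [-> _] := pE t t0; have [-> _] := pE t' t'0.
  rewrite -normrN opprB opprK addrC.
  apply: (@history_Lipschitz _ eps (fun s => d1 H (p.2 s 0 i) (p.2 s 0 j) * BN (p.1 s) (p.2 s) i
    + d2 H (p.2 s 0 i) (p.2 s 0 j) * BN (p.1 s) (p.2 s) j)) => //.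
    apply: measurable_funD; apply: measurable_funM => //.
      exact: (measurable_d1H mdl).
    exact: (measurable_d2H mdl).
  by move=> s _; exact: DhBN_le.
- move=> t t' x t0 t'0; rewrite /embed1; move: (idx x) => i.
  have [_ ->] := pE t t0; have [_ ->] := pE t' t'0.
  rewrite [X in `|X|](_ : _ = - (back_integral (fun s => BN (p.1 s) (p.2 s) i) t
    - back_integral (fun s => BN (p.1 s) (p.2 s) i) t')); last by rewrite /back_integral; ring.
  rewrite normrN; apply: back_integral_Lipschitz => // s _; exact: BN_le.
Qed.

(** The finite system is solved by the pointwise solution of the continuum system
    with step data, which is constant on the cells. *)
Lemma LPN_exists : exists p, LPN p.
Proof.
have [reg sol] := pointwise_solution_exists mdl eps_gt0 (measurable_embed1 w) w_bound
  (measurable_embed1 v0) eta_lt0 eps_eta q_lt1.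
set xi := xi_sol Gamma H chi r eps (embed1 w) (embed1 v0) in reg sol.
set theta := theta_sol Gamma H chi r eps (embed1 w) (embed1 v0) in reg sol.
pose X t : 'M[R]_N := \matrix_(i, j) xi t (pt i, pt j).
pose v t : 'rV[R]_N := \row_i theta t (pt i).
have inv x : forall t, [/\ theta t x = theta t (pt (idx x)),
    forall y, xi t (x, y) = xi t (pt (idx x), y) &
    forall y, xi t (y, x) = xi t (y, pt (idx x))].
  by apply: sol_invariant; rewrite /embed1 idx_pt.
have xE t : xi t = embed2 (X t).
  apply/funext => -[x y]; rewrite /embed2 mxE /=.
  by have [_ -> _] := inv x t; have [_ _ ->] := inv y t.
have vE t : theta t = embed1 (v t).
  by apply/funext => x; rewrite /embed1 mxE; have [-> _ _] := inv x t.
have expR_ge1 t : t <= 0 -> 1 <= expR (eta * t).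
  by move=> t0; rewrite -[leLHS]expR0 ler_expR mulr_le0// ltW.
exists (X, v); split => /=.
- apply: (@C_eta_mx_Lipschitz _ _ _ _ _ (2 * c1) (c1 * eps)).
  + by rewrite mulr_ge0.
  + by rewrite mulr_ge0// ltW.
  + by move=> s t i j s0 t0; rewrite !mxE; exact: (regular_Lxi reg).
  + move=> t i j t0; rewrite mxE; case: (sol t t0) => -> _.
    rewrite (le_trans (LP_xi_le mdl eps_gt0 w_bound reg _ t0))//.
    by rewrite -[leLHS]mulr1 ler_wpM2l ?expR_ge1// mulr_ge0// ltW.
- apply: (@C_eta_mx_Lipschitz _ _ _ _ _ c2 (`|v0| + c2 / `|eta|)) => //.
  + by rewrite addr_ge0// divr_ge0.
  + by move=> s t i j s0 t0; rewrite !mxE; exact: (regular_Ltheta reg).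
  + move=> t i j t0; rewrite mxE; case: (sol t t0) => _ ->.
    rewrite /LP_theta (le_trans (ler_normB _ _))// mulrDl lerD//.
      rewrite (le_trans (mx_norm_entry v0 _ _))//.
      by rewrite -[leLHS]mulr1 ler_wpM2l ?expR_ge1.
    apply: (back_integral_le _ eta_lt0 c2_pos _ _).2.
      exact: (measurable_time_B _ mdl reg).
    move=> s s0; rewrite (le_trans (regular_B_le mdl w_bound reg _ s0))//.
    by rewrite -[leLHS]mulr1 ler_wpM2l// expR_ge1.
- move=> t t0; have [xt tt] := sol t t0; split.
  + move=> i j; rewrite mxE xt /LP_xi; congr (- _); apply: eq_Rintegral => s _.
    by rewrite xE vE DhB_embed /= !idx_pt.
  + move=> i; rewrite mxE tt /LP_theta /embed1 idx_pt; congr (_ - _).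
    by apply: eq_Rintegral => s _; rewrite xE vE B_embed idx_pt.
Qed.

Lemma K_op_cells theta i x : (forall i x, cell i x -> theta x = v0 0 i) -> cell i x ->
  K theta x = N%:R^-1 * \sum_(k < N) H (v0 0 i) (v0 0 k) * Gamma (v0 0 k - v0 0 i).
Proof.
move=> tE ix; apply: (I01_cells N_gt0) => k y ky.
by rewrite (tE _ _ ix) (tE _ _ ky).
Qed.

Lemma h1N_cells theta Omega i j x y :
  (forall i x, cell i x -> theta x = v0 0 i) ->
  (forall i x, cell i x -> Omega x = w 0 i) -> cell i x -> cell j y ->
  Dh0 H theta (Omega + K theta) (x, y) = - h1N Gamma H w v0 i j.
Proof.
move=> tE wE ix jy; have addE z : (Omega + K theta) z = Omega z + K theta z by [].
rewrite /Dh0 /h1N mxE !addE /= (tE _ _ ix) (tE _ _ jy) (wE _ _ ix) (wE _ _ jy).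
by rewrite (K_op_cells tE ix) (K_op_cells tE jy) /VN; ring.
Qed.

Lemma finite_graph_solution : exists2 p, LPN p &
  forall i j, finite_graph Gamma H chi r eta eps w v0 i j = H (v0 0 i) (v0 0 j) + p.1 0 i j.
Proof.
set p := xget (fun=> 0, fun=> 0) LPN; exists p; last by move=> i j; rewrite mxE.
have [p' p'P] := LPN_exists; exact: (xgetPex _ (ex_intro _ p' p'P)).
Qed.

Lemma graph_remainder_le i j :
  `|graph_remainder Gamma H chi r eta eps w v0 i j| <= C0 * eps ^+ 2.
Proof.
have [p pP gE] := finite_graph_solution.
have := pointwise_graph_expansion mdl eps_gt0 w_bound (measurable_embed1 w)
  (measurable_embed1 v0) (LPN_embed pP) (pt i, pt j).
rewrite (h1N_cells (i := i) (j := j)) /embed2 /= ?idx_pt; first last.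
- exact: cell_pt.
- exact: cell_pt.
- by move=> k x kx; rewrite /embed1 (idxE N_gt0 kx).
- by move=> k x kx; rewrite /embed1 (idxE N_gt0 kx).
have -> : graph_remainder Gamma H chi r eta eps w v0 i j =
    finite_graph Gamma H chi r eta eps w v0 i j - H (v0 0 i) (v0 0 j)
    - eps * h1N Gamma H w v0 i j.
  by rewrite /graph_remainder !mxE.
by rewrite gE mulrN [H _ _ + _]addrC addrK.
Qed.

Lemma R_RF_le : norm_theta_le (R_RF Gamma H chi r eta eps w v0) (MG * C0 * eps ^+ 2).
Proof.
apply: Linfty_norm_leI => //; first exact: measurable_step.
apply: (ae_cell N_gt0) => i x ix; rewrite /R_RF (stepE N_gt0 _ ix) mxE normrM.
rewrite ger0_norm ?invr_ge0// ler_pdivrMl ?ltr0n// (le_trans (ler_norm_sum _ _ _))//.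
rewrite mulr_natl -[X in _ *+ X]card_ord -sumr_const; apply: ler_sum => j _.
rewrite normrM mulrC -[leRHS]mulrA; apply: ler_pM => //.
  exact: (Gamma_le mdl).
exact: graph_remainder_le.
Qed.

Section compatibility.
Variable Omega : R -> R.
Hypothesis OmegaM : norm_theta_le Omega M.
Hypothesis Omega_cells : forall i x, cell i x -> Omega x = w 0 i.

Lemma step_X_theta : X_theta R (step v0).
Proof.
case: (@Linfty_norm_leI _ _ _ _ mu_gt0 (step v0) `|v0|) => //.
  exact: measurable_step.
by apply: (ae_cell N_gt0) => i x ix; rewrite (stepE N_gt0 _ ix) mx_norm_entry.
Qed.

Lemma embed_LPF p : LPN p -> LP_fixed_point Gamma H chi r eta eps Omega (step v0)
  (fun t => embed2 (p.1 t), fun t => embed1 (p.2 t)).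
Proof.
move=> /LPN_embed; apply: (pointwise_solution_LP mdl eps_gt0 eta_lt0 OmegaM step_X_theta) => //.
- by apply: (ae_cell N_gt0) => i x ix; rewrite (Omega_cells ix) /embed1 (idxE N_gt0 ix).
- exact: step_idx.
Qed.

(** The embedded finite solution is a fixed point for the same class of step data,
    so it computes the continuum field as well. *)
Lemma V_CF_V_RF : {ae mu, forall x,
  V_CF Gamma H chi r eta eps Omega (step v0) x = V_RF Gamma H chi r eta eps w v0 x}.
Proof.
have [p pP gE] := finite_graph_solution.
have ae1 := V_CF_ae mdl eps_gt0 eta_lt0 eps_eta q_lt1 OmegaM step_X_theta (embed_LPF pP).
have ae2 : {ae mu, forall x, exists i : 'I_N, cell i x}.
  by apply: (@ae_cell _ _ N_gt0 (fun x => exists i : 'I_N, cell i x)) => i x ix; exists i.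
apply: (aeS2 _ ae1 ae2) => x -> [i ix].
rewrite (Omega_cells ix) /V_RF [RHS](stepE N_gt0 _ ix) mxE; congr (_ + _).
apply: (I01_cells N_gt0) => j y jy; rewrite gE /h0 /embed2 /=.
by rewrite !(stepE N_gt0 _ ix) !(stepE N_gt0 _ jy) (idxE N_gt0 ix) (idxE N_gt0 jy).
Qed.

Lemma V_RF_expansion : {ae mu, forall x, V_RF Gamma H chi r eta eps w v0 x =
  V1_field Gamma H eps (step v0) Omega x + R_RF Gamma H chi r eta eps w v0 x}.
Proof.
apply: (ae_cell N_gt0) => i x ix.
rewrite (V1_fieldE eps mdl (measurable_step v0) OmegaM).
rewrite /V_RF /R_RF !(stepE N_gt0 _ ix) !mxE (Omega_cells ix) -addrA; congr (_ + _).
rewrite (I01_cells N_gt0 (c := fun j => (H (v0 0 i) (v0 0 j) + eps * h1N Gamma H w v0 i j)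
  * Gamma (v0 0 j - v0 0 i))); last first.
  move=> j y jy.
  rewrite (h1N_cells (i := i) (j := j)) //; [|by move=> k z kz; rewrite (stepE N_gt0 _ kz)].
  by rewrite /h0 /= !(stepE N_gt0 _ ix) !(stepE N_gt0 _ jy) mulrN opprK.
rewrite -mulrDr -big_split /=; congr (_ * _); apply: eq_bigr => j _.
have -> : graph_remainder Gamma H chi r eta eps w v0 i j =
    finite_graph Gamma H chi r eta eps w v0 i j - H (v0 0 i) (v0 0 j)
    - eps * h1N Gamma H w v0 i j.
  by rewrite /graph_remainder !mxE.
by ring.
Qed.

End compatibility.

End finite_route.

(** * Frequency dependence, choice of parameters, and the theorem *)

Section frequency_dependence.
Context (R : realType).
Variables (Gamma : R -> R) (H : R -> R -> R) (chi : R -> R) (r M eps : R).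
Hypothesis mdl : smooth_model Gamma H chi r.
Hypothesis eps_gt0 : 0 < eps.
Local Notation leb := (@lebesgue_measure R).
Local Notation mu := (unit_lebesgue R).
Local Notation I01 f := (\int[leb]_(y in `[0%R, 1%R]) f y).
Local Notation MG := (sup_norm Gamma).
Local Notation MDH := (M_DH H).
Local Notation K := (K_op Gamma H).

Let mu_gt0 : (0 < mu setT)%E. Proof. exact: unit_lebesgue_gt0. Qed.

(** Only the frequency itself and P depend on the frequency, and both are linear in
    it. *)
Lemma V1_fieldB_le theta Omega Omega' dO : measurable_fun setT theta ->
  norm_theta_le Omega M -> norm_theta_le Omega' M ->
  norm_theta_le (Omega - Omega') dO ->
  norm_theta_le (V1_field Gamma H eps theta Omega - V1_field Gamma H eps theta Omega')
    ((1 + 2 * eps * MG * MDH) * dO).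
Proof.
move=> mt OM O'M dOM.
have G0 := MG_ge0 mdl; have D0 := MDH_ge0 mdl.
have [mO aeO] := Linfty_norm_leE mu_gt0 OM.
have [mO' aeO'] := Linfty_norm_leE mu_gt0 O'M.
have [_ aed] := Linfty_norm_leE mu_gt0 dOM.
have dO0 : 0 <= dO by case: dOM => _; apply: le_trans; exact: Linfty_norm_ge0.
have M0 : 0 <= M by case: OM => _; apply: le_trans; exact: Linfty_norm_ge0.
apply: Linfty_norm_leI => //.
  apply: measurable_funB; first exact: (measurable_V1_field eps mdl mt OM).
  exact: (measurable_V1_field eps mdl mt O'M).
apply: (aeS _ aed) => x dx.
pose P (W : R -> R) y := Gamma (theta y - theta x)
  * (d1 H (theta x) (theta y) * W x + d2 H (theta x) (theta y) * W y).
have mP W : measurable_fun setT W -> measurable_fun setT (P W).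
  move=> mW; apply: measurable_funM; first exact: (measurable_section_Gamma mdl).
  apply: measurable_funD; apply: measurable_funM => //.
  - by apply: (measurable_d1H mdl) => //; exact: measurable_cst.
  - by apply: (measurable_d2H mdl) => //; exact: measurable_cst.
have P_le W a b y : `|W x| <= a -> `|W y| <= b -> `|P W y| <= MG * (MDH * a + MDH * b).
  move=> Wx Wy; rewrite normrM; apply: ler_pM => //; first exact: (Gamma_le mdl).
  rewrite (le_trans (ler_normD _ _))// !normrM; apply: lerD; apply: ler_pM => //.
    exact: (d1H_le mdl).
  exact: (d2H_le mdl).
have iP W : norm_theta_le W M ->
    leb.-integrable (`[0%R, 1%R]%classic : set (measurableTypeR R)) (EFin \o P W).
  move=> /(Linfty_norm_leE mu_gt0)[mW aeW].
  apply: (@I01_integrable _ _ (MG * (MDH * `|W x| + MDH * M))).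
  - by rewrite mulr_ge0// addr_ge0// mulr_ge0.
  - exact: mP.
  - by apply: (aeS _ aeW) => y; exact: P_le.
have -> : (V1_field Gamma H eps theta Omega - V1_field Gamma H eps theta Omega') x
    = (Omega - Omega') x - eps * I01 (P (Omega - Omega')).
  have -> : I01 (P (Omega - Omega')) = I01 (P Omega) - I01 (P Omega').
    rewrite (I01B (iP _ OM) (iP _ O'M)); apply: eq_Rintegral => y _.
    have subE z : (Omega - Omega') z = Omega z - Omega' z by [].
    by rewrite /P !subE; ring.
  rewrite (_ : (V1_field _ _ _ _ _ - _) x = V1_field Gamma H eps theta Omega x
    - V1_field Gamma H eps theta Omega' x)// (_ : (Omega - Omega') x = Omega x - Omega' x)//.
  rewrite /V1_field /P_op -[X in eps * - X]/(I01 (P Omega)).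
  rewrite -[X in _ - (_ + _ + eps * - X + _)]/(I01 (P Omega')); ring.
rewrite (le_trans (ler_normB _ _))// mulrDl mul1r lerD// normrM gtr0_norm//.
have [_ h] : leb.-integrable (`[0%R, 1%R]%classic : set (measurableTypeR R)) (EFin \o P (Omega - Omega')) /\
    `|I01 (P (Omega - Omega'))| <= MG * (MDH * dO + MDH * dO).
  apply: I01_normr_le.
  - by rewrite mulr_ge0// addr_ge0// mulr_ge0.
  - by apply: mP; exact: measurable_funB.
  - by apply: (aeS _ aed) => y; exact: P_le.
rewrite [leRHS](_ : _ = eps * (MG * (MDH * dO + MDH * dO))); last by ring.
by rewrite ler_wpM2l// ltW.
Qed.

End frequency_dependence.

Section admissible_parameters.
Context (R : realType).
Variables (Gamma : R -> R) (H : R -> R -> R) (chi : R -> R) (r M : R).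
Hypothesis mdl : smooth_model Gamma H chi r.
Hypothesis M_ge0 : 0 <= M.
Local Notation MG := (sup_norm Gamma).
Local Notation LG := (sup_norm (derive1 Gamma)).
Local Notation MDH := (M_DH H).
Local Notation MD2H := (M_D2H H).
Local Notation c1 := (C1 r MG MDH M).
Local Notation c3 := (C3 r MG LG MDH MD2H M).
Local Notation c4 := (C4 r MG LG MDH).

Let c1_pos : 0 <= c1. Proof. exact: (c1_ge0 mdl M_ge0). Qed.
Let c3_pos : 0 <= c3. Proof. exact: (c3_ge0 mdl M_ge0). Qed.
Let c4_pos : 0 <= c4. Proof. exact: (c4_ge0 mdl). Qed.

Lemma contraction_factor_le eta eps0 eps : (forall e, 0 < e <= eps0 -> 2^-1 <= 1 + e * eta) ->
  0 < eps <= eps0 ->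
  c3 * (eps / (1 + eps * eta)) + c4 / `|eta| <= c3 * (2 * eps0) + c4 / `|eta|.
Proof.
move=> h he; have := h _ he; case/andP: he => e0 ee0 hh; rewrite lerD2r ler_wpM2l//.
have p0 : 0 < 1 + eps * eta by exact: lt_le_trans hh.
rewrite ler_pdivrMr// (le_trans ee0)// -mulrA [eps0 * _]mulrC mulrA.
rewrite ler_peMl//; first by rewrite (le_trans (ltW e0)).
by rewrite -ler_pdivrMl// mulr1.
Qed.

Lemma admissible_contraction eta eps0 eps : admissible Gamma H r M eta eps0 ->
  0 < eps <= eps0 ->
  [/\ eta < 0, 0 < 1 + eps * eta & c3 * (eps / (1 + eps * eta)) + c4 / `|eta| < 1].
Proof.
case=> [[eta0 eps00] _ _ h supl] he; split => //.
  by apply: lt_le_trans (h _ he).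
apply: le_lt_trans supl; apply: ub_le_sup; last by exists eps.
exists (c3 * (2 * eps0) + c4 / `|eta|) => _ [e e0 <-].
by apply: contraction_factor_le => //; move: e0; rewrite /= in_itv.
Qed.

(** A large |eta| makes C4 / |eta| smaller than 1/2, and then a small eps0 makes the
    remaining terms small: the three bounds on eps0 serve for the condition on C1,
    for the lower bound 1/2, and for the supremum, which is at most 3/4. *)
Lemma admissible_exists : exists eta eps0, admissible Gamma H r M eta eps0.
Proof.
have rH : 0 < r - sup_norm2 H by case: mdl => _ _ _; rewrite subr_gt0.
pose eta : R := - (2 * c4 + 1).
have c41 : 0 < 2 * c4 + 1 by rewrite ltr_wpDl// mulr_ge0.
have eta0 : eta < 0 by rewrite oppr_lt0.
have etaE : `|eta| = 2 * c4 + 1 by rewrite normrN gtr0_norm.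
pose e1 := (r - sup_norm2 H) / (c1 + 1); pose e2 := (2 * (2 * c4 + 1))^-1.
pose e3 := (8 * (c3 + 1))^-1.
have c11 : 0 < c1 + 1 by rewrite ltr_wpDl.
have c31 : 0 < c3 + 1 by rewrite ltr_wpDl.
have e10 : 0 < e1 by rewrite divr_gt0.
have e20 : 0 < e2 by rewrite invr_gt0 mulr_gt0.
have e30 : 0 < e3 by rewrite invr_gt0 mulr_gt0.
pose eps0 := Num.min e1 (Num.min e2 e3).
have eps00 : 0 < eps0 by rewrite !lt_min e10 e20 e30.
have le1 : eps0 <= e1 by rewrite ge_min lexx.
have le2 : eps0 <= e2 by rewrite !ge_min lexx orbT.
have le3 : eps0 <= e3 by rewrite !ge_min lexx !orbT.
have half e : 0 < e <= eps0 -> 2^-1 <= 1 + e * eta.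
  move=> /andP[e0 ee]; have : e * (2 * c4 + 1) <= 2^-1.
    rewrite (@le_trans _ _ (e2 * (2 * c4 + 1)))//.
      by rewrite ler_wpM2r ?(ltW c41)// (le_trans ee).
    by rewrite /e2 le_eqVlt; apply/orP; left; apply/eqP; field; rewrite gt_eqF.
  by rewrite /eta; lra.
have c4eta : c4 / `|eta| < 2^-1.
  by rewrite etaE ltr_pdivrMr// mulrDr mulrA mulVf// mul1r mulr1 ltrDl.
exists eta, eps0; split => //.
- rewrite (@le_lt_trans _ _ (c1 * e1))//; first by rewrite ler_wpM2l.
  rewrite /e1 mulrA ltr_pdivrMr// mulrC; rewrite mulrDr mulr1 ltrDl.
  exact: rH.
- apply: (@le_lt_trans _ _ (c3 * (2 * eps0) + c4 / `|eta|)).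
    apply: sup_le_ub => [|_ [e e0 <-]].
      by exists (c3 * (eps0 / (1 + eps0 * eta)) + c4 / `|eta|), eps0; rewrite //= in_itv/= eps00 lexx.
    by apply: contraction_factor_le => //; move: e0; rewrite /= in_itv.
  have : c3 * (2 * eps0) <= 4^-1.
    rewrite (@le_trans _ _ (c3 * (2 * e3)))//; first by rewrite ler_wpM2l// ler_wpM2l.
    rewrite (@le_trans _ _ ((c3 + 1) * (2 * e3)))//.
      by rewrite ler_wpM2r ?lerDl// mulr_ge0// ltW.
    by rewrite le_eqVlt; apply/orP; left; apply/eqP; rewrite /e3; field; rewrite gt_eqF.
  by move: c4eta; lra.
Qed.

End admissible_parameters.

Theorem theorem5p7 (R : realType)
  (Gamma : R -> R) (H : R -> R -> R) (chi : R -> R) (r M : R)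
  (om : nat -> R -> R) (omega : R -> R)
  (GammaC1 : Cb 1 Gamma) (Gamma_per : periodic Gamma (2 * pi))
  (HC2 : Cb2 2 H)
  (H_per1 : forall y, periodic (H ^~ y) (2 * pi))
  (H_per2 : forall x, periodic (H x) (2 * pi))
  (chiP : cutoff_profile chi)
  (rMH : sup_norm2 H < r)
  (omS : forall N, (0 < N)%N -> step_space R N (om N))
  (omegaX : X_theta R omega)
  (om_cvg : (fun N => norm_theta (om N - omega)) @ \oo --> (0 : R))
  (om_bnd : has_ubound [set norm_theta (om N) | N in [set N | (0 < N)%N]])
  (M_bnd : Num.max (norm_theta omega)
             (sup [set norm_theta (om N) | N in [set N | (0 < N)%N]]) <= M) :
  (exists eta eps0, admissible Gamma H r M eta eps0) /\
  forall eta eps0, admissible Gamma H r M eta eps0 ->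
  exists C CCF : R, forall eps, 0 < eps <= eps0 ->
  [/\ (* reduce-first route *)
      forall N (v : 'rV[R]_N), (0 < N)%N ->
        let w := cell_values N (om N) in
        let theta := step v in
        let RRF := R_RF Gamma H chi r eta eps w v in
        V_RF Gamma H chi r eta eps w v
          = om N + K_op Gamma H theta + eps *: P_op Gamma H theta (om N)
            + eps *: T_op Gamma H theta + RRF %[ae unit_lebesgue R] /\
        norm_theta_le RRF (sup_norm Gamma * C * eps ^+ 2),
      (* continuum-first route *)
      forall Omega, norm_theta_le Omega M ->
        exists RCF : (R -> R) -> (R -> R),
        forall theta, X_theta R theta ->
          V_CF Gamma H chi r eta eps Omega theta
            = Omega + K_op Gamma H theta + eps *: P_op Gamma H theta Omega
              + eps *: T_op Gamma H theta + RCF theta %[ae unit_lebesgue R] /\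
          norm_theta_le (RCF theta) (CCF * eps ^+ 2) &
      (* compatibility *)
      [/\ forall N (v : 'rV[R]_N), (0 < N)%N ->
            let w := cell_values N (om N) in
            V_CF Gamma H chi r eta eps (om N) (step v)
              = V_RF Gamma H chi r eta eps w v %[ae unit_lebesgue R],
          forall N (v : 'rV[R]_N), (0 < N)%N ->
            let w := cell_values N (om N) in
            norm_theta_le
              (V_RF Gamma H chi r eta eps w v
               - V1_field Gamma H eps (step v) (om N)) (C * eps ^+ 2),
          forall Omega theta, norm_theta_le Omega M -> X_theta R theta ->
            norm_theta_le
              (V_CF Gamma H chi r eta eps Omega theta
               - V1_field Gamma H eps theta Omega) (CCF * eps ^+ 2) &
          forall N (v : 'rV[R]_N), (0 < N)%N ->
            let w := cell_values N (om N) in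
            norm_theta_le
              (V_RF Gamma H chi r eta eps w v
               - V_CF Gamma H chi r eta eps omega (step v))
              ((1 + 2 * eps * sup_norm Gamma * M_DH H)
                 * norm_theta (om N - omega) + C * eps ^+ 2)]].
Proof.
have mdl : smooth_model Gamma H chi r by split.
have M_ge0 : 0 <= M.
  apply: le_trans M_bnd; rewrite le_max; apply/orP; left.
  by apply: Linfty_norm_ge0; exact: unit_lebesgue_gt0.
have omega_le : norm_theta_le omega M.
  by split => //; apply: le_trans M_bnd; rewrite le_max lexx.
have om_le N : (0 < N)%N -> norm_theta_le (om N) M.
  move=> N0; split; first by case: (omS _ N0).
  apply: le_trans M_bnd; rewrite le_max; apply/orP; right.
  by apply: ub_le_sup => //; exists N.
split; first exact: (admissible_exists mdl M_ge0).
move=> eta eps0 adm.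
have G0 := MG_ge0 mdl.
set C0 := graph_constant Gamma H r M.
have C00 : 0 <= C0.
  rewrite /C0 /graph_constant; apply: mulr_ge0.
    by apply: mulr_ge0 => //; exact: (c3_ge0 mdl M_ge0).
  apply: addr_ge0; first exact: (c1_ge0 mdl M_ge0).
  by apply: mulr_ge0 => //; exact: (c2_ge0 mdl M_ge0).
exists (C0 * (1 + 2 * sup_norm Gamma)), (sup_norm Gamma * C0) => eps he.
have [eta_lt0 eps_eta q_lt1] := admissible_contraction mdl M_ge0 adm he.
have /andP[eps_gt0 _] := he.
have mu_gt0 := @unit_lebesgue_gt0 R.
have CF Omega theta : norm_theta_le Omega M -> X_theta R theta ->
    norm_theta_le (V_CF Gamma H chi r eta eps Omega theta
      - V1_field Gamma H eps theta Omega) (sup_norm Gamma * C0 * eps ^+ 2).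
  by move=> LO Lt; exact: (V_CF_expansion mdl eps_gt0 eta_lt0 eps_eta q_lt1 LO Lt).
have w_le N : (0 < N)%N -> forall i, `|cell_values N (om N) 0 i| <= M.
  by move=> N0 i; apply: cell_values_le => //; [exact: omS|case: (om_le _ N0)].
have om_cells N : (0 < N)%N -> forall i x, @cell R N i x -> om N x = cell_values N (om N) 0 i.
  by move=> N0 i x; apply: step_space_values => //; exact: omS.
have RFE N (v : 'rV[R]_N) (N0 : (0 < N)%N) :=
  V_RF_expansion N0 eta eps mdl v (om_le _ N0) (om_cells _ N0).
have RRF N (v : 'rV[R]_N) (N0 : (0 < N)%N) :=
  R_RF_le N0 mdl eps_gt0 eta_lt0 eps_eta q_lt1 v (w_le _ N0).
have sq0 : 0 <= eps ^+ 2 by exact: sqr_ge0.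
have mV1 N (v : 'rV[R]_N) (N0 : (0 < N)%N) Omega : norm_theta_le Omega M ->
    measurable_fun setT (V1_field Gamma H eps (step v) Omega).
  by move=> LO; exact: (measurable_V1_field eps mdl (measurable_step v) LO).
have RF N (v : 'rV[R]_N) (N0 : (0 < N)%N) :
    norm_theta_le (V_RF Gamma H chi r eta eps (cell_values N (om N)) v
      - V1_field Gamma H eps (step v) (om N)) (sup_norm Gamma * C0 * eps ^+ 2).
  apply: (Linfty_norm_le_ae mu_gt0 _ _ (RRF N v N0)).
    by apply: measurable_funB; [exact: measurable_step|exact: (mV1 _ _ N0 _ (om_le _ N0))].
  apply: (aeS _ (RFE N v N0)) => x xE.
  by rewrite (_ : (V_RF _ _ _ _ _ _ _ _ - _) x = V_RF Gamma H chi r eta eps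
    (cell_values N (om N)) v x - V1_field Gamma H eps (step v) (om N) x)// xE addrC addKr.
split.
- move=> N v N0; split.
    apply: (aeS _ (RFE N v N0)) => x xE _; exact: xE.
  apply: Linfty_norm_le_trans (RRF N v N0); rewrite ler_wpM2r// ler_wpM2l//.
  by rewrite ler_peMr// lerDl mulr_ge0.
- move=> Omega LO; exists (fun theta => V_CF Gamma H chi r eta eps Omega theta
    - V1_field Gamma H eps theta Omega) => theta Lt; split; last exact: CF.
  apply: aeW => x _; set V := V_CF _ _ _ _ _ _ _ _.
  have VE : V x = V1_field Gamma H eps theta Omega x
      + (V x - V1_field Gamma H eps theta Omega x) by rewrite addrC subrK.
  exact: VE.
- split.
  + move=> N v N0 w.
    apply: (aeS _ (V_CF_V_RF N0 mdl eps_gt0 eta_lt0 eps_eta q_lt1 v (w_le _ N0)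
      (om_le _ N0) (om_cells _ N0))) => x xE _; exact: xE.
  + move=> N v N0 w; apply: Linfty_norm_le_trans (RF N v N0).
    rewrite ler_wpM2r// mulrC ler_wpM2l//.
    by rewrite mulr_natl mulr2n addrA lerDr addr_ge0.
  + exact: CF.
  + move=> N v N0 w.
    have Xv : X_theta R (step v) by exact: (step_X_theta N0 v).
    have dO : norm_theta_le (om N - omega) (norm_theta (om N - omega)).
      split => //; apply: LinftyB => //; by case: (om_le _ N0).
    have := Linfty_norm_leB mu_gt0 (Linfty_norm_leD mu_gt0 (RF N v N0)
      (V1_fieldB_le mdl eps_gt0 (measurable_step v) (om_le _ N0) omega_le dO))
      (CF _ _ omega_le Xv).
    have -> : forall a b c d : R -> R, (a - b) + (b - c) - (d - c) = a - d.
      by move=> a b c d; rewrite addrA subrK opprB addrA subrK.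
    apply: Linfty_norm_le_trans.
    set D := (1 + _) * _.
    rewrite addrAC [leLHS]addrC lerD2l -mulrDl ler_wpM2r//.
    have -> : sup_norm Gamma * C0 + sup_norm Gamma * C0 = C0 * (2 * sup_norm Gamma) by ring.
    by rewrite ler_wpM2l// lerDr.
Qed.
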